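(* The determinantal random point process in the plane $\mathbb C\cong\mathbb R^2$ with correlation kernel $$K(x,y)=e^{-\frac\pi2\left(|x|^2+|y|^2-2x\overline y\right)}$$ (the Ginibre point process) satisfies $$\lim_{N\to\infty}\mathbb E\,\mathcal W_N=-\frac12(\gamma+\log\pi),$$ where $\gamma$ is the Euler constant.
   Context: A point process with random configuration $\{a_i\}$ is determinantal with kernel $K$ if its correlation functions are $\rho_k(x_1,\dots,x_k)=\det(K(x_i,x_j))_{i,j=1}^k$ for all $k\ge 1$, where $\rho_k$ is characterized by $\mathbb E\sum_{i_1,\dots,i_k\text{ pairwise distinct}}F(a_{i_1},\dots,a_{i_k})=\int F\rho_k$. For $N\ge1$ and $x\in\mathbb C$ let $$E_N(x)=\sum_{(m,n)\in\mathbb Z^2\setminus\{0\}}e^{2i\pi\left(m\,\mathrm{Re}(x)/N+n\,\mathrm{Im}(x)/N\right)}\frac{1}{m^2+n^2}$$ (understood as the Fourier series of an $(N\mathbb Z)^2$-periodic $L^2_{loc}$ function, smooth away from $(N\mathbb Z)^2$; equivalently, $\frac1{2\pi}E_N$ is the zero-average solution $G$ of $-\Delta G=2\pi(\delta_0-\frac1{N^2})$ on $\mathbb R^2/(N\mathbb Z)^2$). Let $\eta(\tau)=q^{1/24}\prod_{k\ge1}(1-q^k)$, $q=e^{2i\pi\tau}$, be the Dedekind eta function. For a configuration $\{a_i\}\subset\mathbb C$, $$\mathcal W_N=\frac1{2\pi N^2}\sum_{i\neq j,\ a_i,a_j\in[0,N]^2}E_N(a_i-a_j)+\log\frac{N}{2\pi\eta(i)^2},$$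 where in $\eta(i)$ the symbol $i$ is the imaginary unit. *)

(* Defs.v *)
From HB Require Import structures.
From mathcomp Require Import all_boot all_order all_algebra.
From mathcomp Require Import complex.
From mathcomp Require Import all_classical all_reals all_analysis.
From mathcomp Require Import measurable_realfun.

Set Implicit Arguments.
Unset Strict Implicit.
Unset Printing Implicit Defensive.

Import Order.TTheory GRing.Theory Num.Theory.
Import numFieldNormedType.Exports.

Local Open Scope classical_set_scope.
Local Open Scope complex_scope.
Local Open Scope ring_scope.

(* Points of C = R^2 are pairs, so as to inherit the product topology, Borel
   sigma-algebra and Lebesgue measure; [toC] is used wherever the complex
   structure matters. *)
Notation plane R := (R * R)%type.

Definition toC (R : realType) (x : plane R) : R[i] := x.1 +i* x.2.

Definition lebesgue2 (R : realType) :=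
  (@lebesgue_measure R \x @lebesgue_measure R)%E.

Definition Cexp (R : realType) (z : R[i]) : R[i] :=
  (expR (complex.Re z))%:C * (cos (complex.Im z) +i* sin (complex.Im z)).

Definition Cintegral (R : realType) d (T : measurableType d)
    (mu : {measure set T -> \bar R}) (D : set T) (f : T -> R[i]) : R[i] :=
  (\int[mu]_(x in D) complex.Re (f x)) +i* (\int[mu]_(x in D) complex.Im (f x)).

Definition Clim (R : realType) (u : nat -> R[i]) : R[i] :=
  limn (fun n => complex.Re (u n)) +i* limn (fun n => complex.Im (u n)).

Definition euler_gamma (R : realType) : R :=
  limn (fun n : nat => \sum_(1 <= k < n.+1) k%:R^-1 - ln n%:R).

Definition dedekind_eta (R : realType) (tau : R[i]) : R[i] :=
  let c : R[i] := 2%:R * 'i * (pi : R)%:C * tau in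
  Cexp (c / 24%:R) * Clim (fun n => \prod_(1 <= k < n.+1) (1 - Cexp c ^+ k)).

(* The points of the configuration at w are the [pt i w] for [i] in [idx w];
   the values [pt i w] for other [i] are junk. *)
Record point_process (R : realType) d (T : measurableType d) := PointProcess {
  idx : T -> set nat;
  pt : nat -> T -> plane R;
  measurable_idx : forall i, measurable [set w | idx w i];
  measurable_pt : forall i, measurable_fun setT (pt i);
  locally_finite : forall w (r : R),
    finite_set [set i | idx w i /\ `|pt i w| <= r] }.

(* Integral over (R^2)^k against Lebesgue measure, in iterated form; only used
   for nonnegative measurable functions. *)
Fixpoint iterated_integral (R : realType) (k : nat) :
    (k.-tuple (plane R) -> \bar R) -> \bar R :=
  match k with
  | 0 => fun F => F [tuple]
  | k'.+1 => fun F =>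
      (\int[@lebesgue2 R]_x
         iterated_integral (fun t : k'.-tuple (plane R) => F [tuple of x :: t]))%E
  end.

Definition is_correlation_function (R : realType) d (T : measurableType d)
    (P : probability T R) (X : point_process R T) (k : nat)
    (rho : k.-tuple (plane R) -> R) : Prop :=
  [/\ measurable_fun setT rho, forall x, 0 <= rho x &
    forall F : k.-tuple (plane R) -> \bar R,
      measurable_fun setT F -> (forall x, 0 <= F x)%E ->
      (\int[P]_w (\esum_(s in [set s : k.-tuple nat |
                      uniq s /\ (forall i, i \in s -> idx X w i)])
                    F (map_tuple ((pt X)^~ w) s))
       = iterated_integral (fun x => F x * (rho x)%:E))%E].

Definition is_determinantal (R : realType) d (T : measurableType d)
    (P : probability T R) (X : point_process R T)
    (K : R[i] -> R[i] -> R[i]) : Prop :=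
  forall k : nat, (0 < k)%N -> exists2 rho : k.-tuple (plane R) -> R,
    is_correlation_function P X rho &
    forall x : k.-tuple (plane R),
      (rho x)%:C = \det (\matrix_(i < k, j < k) K (toC (tnth x i)) (toC (tnth x j))).

Definition ginibre_kernel (R : realType) (x y : R[i]) : R[i] :=
  Cexp (- ((pi : R) / 2)%:C * (`|x| ^+ 2 + `|y| ^+ 2 - 2%:R * x * y^*)).

Definition lattice (R : realType) (N : R) : set (plane R) :=
  [set p | exists m n : int, p = (m%:~R * N, n%:~R * N)].

Definition square (R : realType) (N : R) : set (plane R) :=
  `[0, N] `*` `[0, N].

(* All iterated directional derivatives of f are differentiable on U. *)
Definition smooth_on (R : realType) (U : set (plane R)) (f : plane R -> R) :=
  forall vs : seq (plane R), forall x, U x ->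
    differentiable (foldr (fun v g => 'D_v g) f vs) x.

Definition L2loc (R : realType) (f : plane R -> R) : Prop :=
  measurable_fun setT f /\
  forall A : set (plane R), compact A ->
    (\int[@lebesgue2 R]_(x in A) (f x ^+ 2)%:E < +oo)%E.

Definition fourier_coef (R : realType) (N : R) (f : plane R -> R) (m n : int)
    : R[i] :=
  (N ^- 2)%:C * Cintegral (@lebesgue2 R) (square N) (fun x : plane R =>
    (f x)%:C * Cexp (- (2%:R * 'i * (pi : R)%:C
                        * (m%:~R * x.1 / N + n%:~R * x.2 / N)%:C))).

(* The series defining E_N is not absolutely convergent: E_N is characterized
   as the periodic L^2_loc function, smooth away from the lattice, whose
   Fourier series it is. This determines its values off the lattice (and
   leaves its values on the lattice unconstrained). *)
Record is_EN (R : realType) (N : R) (f : plane R -> R) : Prop := IsEN {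
  EN_periodic : forall x y, lattice N y -> f (x + y) = f x;
  EN_L2loc : L2loc f;
  EN_smooth : smooth_on (~` lattice N) f;
  EN_fourier : forall m n : int,
    fourier_coef N f m n =
      if (m, n) == (0, 0) then 0 else ((m%:~R ^+ 2 + n%:~R ^+ 2)^-1 : R)%:C }.

(* The sum has finitely many terms by local finiteness, and eta(i) is a
   positive real number, so that taking real parts loses nothing. *)
Definition W (R : realType) d (T : measurableType d) (X : point_process R T)
    (N : R) (EN : plane R -> R) (w : T) : R :=
  (2 * pi * N ^+ 2)^-1 *
    (\sum_(p \in [set p : nat * nat | [/\ p.1 <> p.2, idx X w p.1, idx X w p.2,
                    square N (pt X p.1 w) & square N (pt X p.2 w)]])
       EN (pt X p.1 w - pt X p.2 w))
  + ln (N / (2 * pi * complex.Re (dedekind_eta ('i : R[i]) ^+ 2))).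

(* Main.v *)
(* By determinantality the two-point function of the Ginibre process is
   1 - exp(-pi |x - y|^2), so E W_N is a constant minus the integral of E_N
   against exp(-pi |z|^2) times the autocorrelation of the square, a product
   of tent functions; as E_N is periodic with mean zero, this is an integral
   over [0,N]^2 of E_N(z) p(z.1) p(z.2), with p the tent-weighted Gaussian
   folded along the period ([gauss1_fold]). Since p is even about N/2, p(u) is
   a function of cos(2 pi u / N), hence a pointwise limit of Bernstein
   polynomials in that cosine, and E_N may be replaced by any function with the
   same cosine coefficients. The Kronecker limit formula provides one
   ([green]), equal near the origin to - pi log|z|^2 up to a bounded term that
   tends to - 2 pi log(eta(i)^2). Dominated convergence then leaves the
   integral of 2 log|z|^2 exp(-pi |z|^2) over a quadrant, which polar
   coordinates reduce to Euler's integral of log v against exp(-v). *)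
From HB Require Import structures.
Require Import Defs.
From mathcomp Require Import all_boot all_order all_algebra.
From mathcomp Require Import complex.
From mathcomp Require Import all_classical all_reals all_analysis.
From mathcomp Require Import measurable_realfun.
From mathcomp Require Import ring lra.

Set Implicit Arguments.
Unset Strict Implicit.
Unset Printing Implicit Defensive.

Import Order.TTheory GRing.Theory Num.Theory.
Import numFieldNormedType.Exports.

Local Open Scope classical_set_scope.
Local Open Scope ring_scope.

(** * Lebesgue integration on the line and the plane *)

(** All that is known of E_N is its Fourier coefficients and its square integrability; no pointwise
    formula for it is ever derived. The comparison with the Green function is made only under
    integrals against products of cosines, so that no uniqueness theorem for Fourier series
    intervenes. Correlation functions are tested against nonnegative functions, whereas E_N changes
    sign: it enters through its positive and negative parts. The logarithm of N in W_N compensates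
    the rescaling of the Green function from a cell of side 2 pi. Since the Gaussian has mass 1/4 on
    a quadrant, the additive constant of W_N can be put under the same integral. There ln(2 pi / N)
    multiplies only the difference between the Gaussian and its folded and truncated version, which
    is O(1/N), so the divergence disappears before any limit is taken. The constant log(eta(i)^2)
    cancels likewise against the regularized Green function at the origin, whose two tails are each
    twice the logarithm of the Euler product. *)

Section affine.
Variable R : realType.
Notation mu := (@lebesgue_measure R).

Lemma measurable_fun_affine (a b : R) :
  measurable_fun setT ((fun x : R => (a * x + b)%R) : measurableTypeR R -> measurableTypeR R).
Proof.
by apply: measurable_funD => //; apply: measurable_funM => //; exact: measurable_cst.
Qed.

(** The image measure under the affine map, multiplied by [a], gives every half-open interval its
    length, and only one measure does so. *)
Lemma lebesgue_measure_affine (a b : R) (A : set R) : 0 < a -> measurable A ->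
  mu A = (a%:E * mu ((fun x => (a * x + b)%R) @^-1` A))%E.
Proof.
move=> a0 mA.
pose phi : measurableTypeR R -> measurableTypeR R := fun x => a * x + b.
pose m : {measure set (measurableTypeR R) -> \bar R} := mscale (NngNum (ltW a0)) (pushforward mu phi).
have mphi := measurable_fun_affine a b.
have -> : (a%:E * mu ((fun x => (a * x + b)%R) @^-1` A))%E = m mphi A by [].
apply: lebesgue_measure_unique => // _ [[u v]] _ <-.
transitivity (a%:E * mu (phi @^-1` `]u, v]%classic))%E; last by [].
have -> : phi @^-1` `]u, v]%classic = `](u - b) / a, (v - b) / a]%classic.
  apply/seteqP; split => x /=; rewrite !in_itv /= ltr_pdivrMr// ler_pdivlMr//;
   rewrite ltrBlDr lerBrDr mulrC//.
rewrite !lebesgue_measure_itv /= !lte_fin.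
rewrite ltr_pM2r ?invr_gt0// ltrD2r; case: ifPn => _; last by rewrite mule0.
rewrite -!EFinD -EFinM; congr EFin; field; exact: lt0r_neq0.
Qed.

Local Open Scope ereal_scope.

Lemma ge0_integral_affine (a b : R) (f : R -> \bar R) : (0 < a)%R ->
  measurable_fun setT f -> (forall x, 0 <= f x) ->
  \int[mu]_x f x = a%:E * \int[mu]_x f (a * x + b)%R.
Proof.
move=> a0 mf f0.
pose phi : measurableTypeR R -> measurableTypeR R := fun x => (a * x + b)%R.
pose m : {measure set (measurableTypeR R) -> \bar R} := mscale (NngNum (ltW a0)) (pushforward mu phi).
have mphi := measurable_fun_affine a b.
transitivity (\int[m mphi]_x f x).
  apply: eq_measure_integral => A mA _; exact: (lebesgue_measure_affine b).
rewrite ge0_integral_mscale //= ge0_integral_pushforward//=.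
Qed.

Lemma ge0_integral_shift (b : R) (f : R -> \bar R) :
  measurable_fun setT f -> (forall x, 0 <= f x) ->
  \int[mu]_x f x = \int[mu]_x f (x + b)%R.
Proof.
move=> mf f0; rewrite (@ge0_integral_affine 1 b)// mul1e.
by apply: eq_integral => x _; rewrite mul1r.
Qed.

Lemma ge0_integral_opp (f : R -> \bar R) :
  measurable_fun setT f -> (forall x, 0 <= f x) ->
  \int[mu]_x f x = \int[mu]_x f (- x)%R.
Proof.
move=> mf f0.
transitivity (\int[pushforward mu (-%R : _ -> measurableTypeR R)]_x f x).
  by apply: eq_measure_integral => A mA _; rewrite -[LHS](lebesgue_measureN mA).
by rewrite ge0_integral_pushforward.
Qed.

End affine.

Section tonelli_plane.
Variable R : realType.
Notation mu := (@lebesgue_measure R).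
Notation mu2 := (@lebesgue2 R).
Local Open Scope ereal_scope.

Let muS : {sigma_finite_measure set (measurableTypeR R) -> \bar R} := mu.

Lemma ge0_integral_lebesgue2 (f : R * R -> \bar R) :
  measurable_fun setT f -> (forall x, 0 <= f x) ->
  \int[mu2]_z f z = \int[mu]_x \int[mu]_y f (x, y).
Proof. by move=> mf f0; have := @fubini_tonelli1 _ _ _ _ R muS muS f mf f0. Qed.

Lemma ge0_integral_lebesgue2C (f : R * R -> \bar R) :
  measurable_fun setT f -> (forall x, 0 <= f x) ->
  \int[mu2]_z f z = \int[mu]_y \int[mu]_x f (x, y).
Proof. by move=> mf f0; have := @fubini_tonelli2 _ _ _ _ R muS muS f mf f0. Qed.

Lemma measurable_int_lebesgue (f : R * R -> \bar R) :
  measurable_fun setT f -> (forall x, 0 <= f x) ->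
  measurable_fun setT (fun x => \int[mu]_y f (x, y)).
Proof. by move=> mf f0; have := @measurable_fun_fubini_tonelli_F _ _ _ _ R muS f mf f0. Qed.

Lemma tonelli_lebesgue (f : R -> R -> \bar R) :
  measurable_fun setT (fun z => f z.1 z.2) -> (forall x y, 0 <= f x y) ->
  \int[mu]_x \int[mu]_y f x y = \int[mu]_y \int[mu]_x f x y.
Proof.
move=> mf f0; have f0' z : 0 <= f z.1 z.2 by [].
by rewrite -(ge0_integral_lebesgue2 mf f0') (ge0_integral_lebesgue2C mf f0').
Qed.

Let prod2 : {measure set (measurableTypeR R * measurableTypeR R)%type -> \bar R} :=
  product_measure1 muS muS.

(** Tonelli on the product of two planes asks that planar measure be sigma-finite. Squares of an
    increasing exhaustion of the line cover the plane, since the larger of two indices serves both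
    coordinates. *)
Let prod2_sigma_finite : sigma_finite setT prod2.
Proof.
have /sigma_finiteP[F [TF ndF Foo]] := sigma_finiteT muS.
exists (fun n => F n `*` F n).
  apply/esym; rewrite -subTset => -[x y] _.
  have : (\bigcup_n F n) x by rewrite -TF.
  have : (\bigcup_n F n) y by rewrite -TF.
  move=> [n _ Fny] [m _ Fmx]; exists (maxn n m) => //; split.
    by move: Fmx; apply/subsetPset/ndF; rewrite leq_maxr.
  by move: Fny; apply/subsetPset/ndF; rewrite leq_maxl.
move=> n; have [mF Foon] := Foo n; split; first exact: measurableX.
by rewrite /prod2 /= product_measure1E// lte_mul_pinfty// ge0_fin_numE.
Qed.

Let mu2_mixin := Measure_isSigmaFinite.Build _ _ _ prod2 prod2_sigma_finite.
Let mu2S : {sigma_finite_measure set (measurableTypeR R * measurableTypeR R)%type -> \bar R} :=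
  HB.pack (Measure.sort prod2) mu2_mixin.

Lemma tonelli_lebesgue2 (f : (R * R) * (R * R) -> \bar R) :
  measurable_fun setT f -> (forall x, 0 <= f x) ->
  \int[mu2]_x \int[mu2]_y f (x, y) = \int[mu2]_y \int[mu2]_x f (x, y).
Proof. by move=> mf f0; have := @fubini_tonelli _ _ _ _ R mu2S mu2S f mf f0. Qed.

Lemma lebesgue2_setX (A B : set R) : measurable A -> measurable B ->
  mu2 (A `*` B) = mu A * mu B.
Proof. by move=> mA mB; have := @product_measure1E _ _ _ _ R muS muS A B mA mB. Qed.

Lemma lebesgue2_indic (A : set (R * R)) : measurable A ->
  \int[mu2]_x (\1_A x)%:E = mu2 A.
Proof. by move=> mA; have := @integral_indic _ _ R mu2S setT measurableT A mA; rewrite setIT. Qed.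

End tonelli_plane.

(** * Autocorrelation of the square and its reduction to one period *)

Section square_autocorrelation.
Variable R : realType.
Notation mu := (@lebesgue_measure R).
Notation mu2 := (@lebesgue2 R).

(** Length of the overlap of [[0, N]] with its translate by [u]. *)
Definition tent (N u : R) : R := Num.max 0 (N - `|u|).

Lemma tent_ge0 N u : 0 <= tent N u.
Proof. by rewrite le_max lexx. Qed.

Lemma measurable_tent N : measurable_fun setT (tent N).
Proof.
apply: measurable_maxr; first exact: measurable_cst.
by apply: measurable_funB; [exact: measurable_cst|exact: normr_measurable].
Qed.

(** The interval consists of the [x] in [[0, N]] for which [x - u] is also in [[0, N]]. *)
Lemma lebesgue_measure_tent (N u : R) : 0 <= N ->
  mu (`[Num.max 0 u, Num.min N (N + u)]%classic) = (tent N u)%:E.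
Proof.
move=> N0; rewrite lebesgue_measure_itv /= lte_fin /tent.
have [u0|u0] := leP 0 u.
  rewrite ger0_norm// (min_idPl _) ?lerDl//.
  case: (ltP u N) => Nu; rewrite -?EFinB; congr EFin.
    by apply/esym/max_idPr; rewrite subr_ge0 ltW.
  by apply/esym/max_idPl; rewrite subr_le0.
rewrite ltr0_norm// (min_idPr _) ?gerDl ?ltW// opprK oppr0 adde0.
case: (ltP 0 (N + u)) => Nu; congr EFin.
Qed.

Lemma measurable_square N : measurable (@square R N).
Proof. by apply: measurableX; exact: measurable_itv. Qed.

Local Open Scope ereal_scope.

Lemma ge0_integral_reflect (b : R) (f : R -> \bar R) :
  measurable_fun setT f -> (forall x, 0 <= f x) ->
  \int[mu]_x f x = \int[mu]_x f (b - x)%R.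
Proof.
move=> mf f0; rewrite (ge0_integral_shift b mf f0) ge0_integral_opp//.
  by apply: eq_integral => x _; rewrite addrC.
apply: measurableT_comp => //.
by apply: measurable_funD => //; exact: measurable_cst.
Qed.

Lemma measurable_fun_sub_plane (x : R * R) :
  measurable_fun setT (fun y : R * R => (x - y)%R).
Proof.
by apply: measurable_fun_pair => /=; apply: measurable_funB => //; exact: measurable_cst.
Qed.

Lemma ge0_integral2_reflect (x : R * R) (f : R * R -> \bar R) :
  measurable_fun setT f -> (forall x, 0 <= f x) ->
  \int[mu2]_y f y = \int[mu2]_y f (x - y)%R.
Proof.
move=> mf f0.
have mg : measurable_fun setT (fun y : R * R => f (x - y)%R).
  by apply: measurableT_comp => //; exact: measurable_fun_sub_plane.
rewrite (ge0_integral_lebesgue2 mf f0).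
rewrite (ge0_integral_lebesgue2 mg (fun y => f0 (x - y)%R)).
rewrite (ge0_integral_reflect x.1).
- apply: eq_integral => y _; rewrite (ge0_integral_reflect x.2)//.
  exact: measurableT_comp.
- exact: measurable_int_lebesgue.
- by move=> ?; apply: integral_ge0.
Qed.

(** Substituting [z = x - y] and exchanging the integrals leaves, for fixed [z], the area of the
    intersection of the square with its translate by [z], a product of two overlap lengths. *)
Lemma square_autocorrelation (N : R) (f : R * R -> \bar R) : (0 <= N)%R ->
  measurable_fun setT f -> (forall x, 0 <= f x) ->
  \int[mu2]_x \int[mu2]_y
    ((\1_(square N) x * \1_(square N) y)%:E * f (x - y)%R) =
  \int[mu2]_z ((tent N z.1 * tent N z.2)%:E * f z).
Proof.
move=> N0 mf f0.
have mQ := measurable_square N.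
pose F (w : (R * R) * (R * R)) :=
  (\1_(square N) w.1 * \1_(square N) (w.1 - w.2)%R)%:E * f w.2.
have F0 w : 0 <= F w by apply: mule_ge0 => //; rewrite lee_fin mulr_ge0.
have mF : measurable_fun setT F.
  apply: emeasurable_funM; last exact: measurableT_comp.
  apply/measurable_EFinP; apply: measurable_funM; first by apply: measurableT_comp.
  apply: measurableT_comp => //.
  apply: measurable_fun_pair => /=; apply: measurable_funB => //;
    by apply: measurableT_comp => //.
transitivity (\int[mu2]_x \int[mu2]_z F (x, z)).
  apply: eq_integral => x _.
  have mFx : measurable_fun setT (fun z => F (x, z)) by exact: measurableT_comp.
  rewrite (ge0_integral2_reflect x mFx (fun z => F0 (x, z))).
  by apply: eq_integral => y _; rewrite /F /= subKr.
rewrite (tonelli_lebesgue2 mF F0); apply: eq_integral => z _; rewrite /F /=.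
under eq_integral do rewrite muleC.
rewrite ge0_integralZl//.
- rewrite muleC; congr (_ * _).
  pose I (u : R) := `[(Num.max 0 u)%R, (Num.min N (N + u))%R]%classic.
  have mI u : measurable (I u) by exact: measurable_itv.
  transitivity (\int[mu2]_x (\1_(I z.1 `*` I z.2) x)%:E).
    apply: eq_integral => x _; congr EFin; rewrite !indicE -natrM mulnb.
    congr (_%:R); congr nat_of_bool; apply/andP/idP; rewrite !inE /square /I /= !in_itv /=.
      move=> [[/andP[a1 a2] /andP[a3 a4]] [/andP[a5 a6] /andP[a7 a8]]].
      by split; rewrite ge_max le_min; lra.
    rewrite !ge_max !le_min.
    move=> [/andP[/andP[a1 a2] /andP[a3 a4]] /andP[/andP[a5 a6] /andP[a7 a8]]].
    by split; split; lra.
  rewrite lebesgue2_indic; last exact: measurableX.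
  by rewrite lebesgue2_setX// /I !lebesgue_measure_tent// EFinM.
- apply/measurable_EFinP; apply: measurable_funM => //.
  apply: measurableT_comp => //.
  by apply: measurable_fun_pair => /=; apply: measurable_funB => //; exact: measurable_cst.
Qed.

(** The tent lives on [[-N, N]]. Its negative half, translated by [N], lands on [[0, N]] with weight
    [u], beside the weight [N - u] of the positive half. *)
Lemma integral_tent (N : R) (f : R -> \bar R) : (0 <= N)%R ->
  measurable_fun setT f -> (forall x, 0 <= f x) ->
  \int[mu]_u ((tent N u)%:E * f u) =
  \int[mu]_(u in `[0%R, N]) ((N - u)%:E * f u + u%:E * f (u - N)%R).
Proof.
move=> N0 mf f0.
have mtf : measurable_fun setT (fun u => (tent N u)%:E * f u).
  by apply: emeasurable_funM => //; apply/measurable_EFinP; exact: measurable_tent.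
have tf0 u : 0 <= (tent N u)%:E * f u by rewrite mule_ge0// lee_fin tent_ge0.
transitivity (\int[mu]_(u in `[0%R, N]) ((tent N u)%:E * f u) +
   \int[mu]_(u in `[(- N)%R, 0%R[) ((tent N u)%:E * f u)).
  rewrite -ge0_integral_setU//; last first.
    - rewrite disj_set2E; apply/eqP; rewrite -subset0 => u [] /=.
      by rewrite !in_itv /= => /andP[u0 _] /andP[_]; rewrite ltNge u0.
    - exact: measurable_funS mtf.
  rewrite [RHS]integral_mkcond; apply: eq_integral => u _; rewrite patchE.
  case: ifPn => //; rewrite notin_setE/= => /not_orP[]; rewrite !in_itv/= => /negP h1 /negP h2.
  suff -> : tent N u = 0%R by rewrite mul0e.
  apply/max_idPl; rewrite subr_le0; case: (leP 0%R u) h1 h2 => u0 /=.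
    by rewrite -ltNge => /ltW Nu _; rewrite ger0_norm.
  by rewrite andbT -ltNge => _ Nu; rewrite ltr0_norm//; lra.
rewrite ge0_integralD//; last 4 first.
- by move=> u; rewrite /= in_itv/= => /andP[_ uN]; rewrite mule_ge0// lee_fin subr_ge0.
- apply: emeasurable_funM; last exact: measurable_funTS.
  by apply/measurable_EFinP/measurable_funB => //; exact: measurable_cst.
- by move=> u; rewrite /= in_itv/= => /andP[u0 _]; rewrite mule_ge0.
- apply: emeasurable_funM; first exact/measurable_EFinP.
  apply: measurable_funTS; apply: measurableT_comp => //.
  by apply: measurable_funB => //; exact: measurable_cst.
congr (_ + _).
  apply: eq_integral => u; rewrite inE /= in_itv/= => /andP[u0 uN].
  by rewrite /tent ger0_norm// max_r// subr_ge0.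
(* The negative half is [[-N, 0[], so its translate misses the endpoint [N], a null set. *)
rewrite -[RHS]integral_itv_bndo_bndc; last first.
  apply: emeasurable_funM; first exact/measurable_EFinP.
  apply: measurable_funTS; apply: measurableT_comp => //.
  by apply: measurable_funB => //; exact: measurable_cst.
rewrite integral_mkcond [RHS]integral_mkcond (ge0_integral_shift (- N))//.
- apply: eq_integral => u _; rewrite !patchE !mem_setE !in_itv/= lerBrDr addNr subr_lt0.
  case: ifPn => // /andP[u0 uN]; rewrite /tent ltr0_norm ?subr_lt0//.
  by rewrite opprB subKr max_r.
- exact/(measurable_restrictT _ _).1/measurable_funTS.
- by move=> x; rewrite erestrict_ge0.
Qed.

End square_autocorrelation.

(** * The expectation of W_N as an integral against E_N *)

Section gaussian_folding.
Variable R : realType.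
Notation mu := (@lebesgue_measure R).
Notation mu2 := (@lebesgue2 R).

Definition gauss1 (u : R) : R := expR (- (pi * u ^+ 2)).

(* The sum over k of (1 - |v| / N)^+ * gauss1 v at v = u + k N, for 0 <= u <= N. *)
Definition gauss1_fold (N u : R) : R :=
  (1 - u / N) * gauss1 u + (u / N) * gauss1 (u - N).

Lemma gauss1_ge0 u : 0 <= gauss1 u.
Proof. exact: expR_ge0. Qed.

Lemma gauss1_le1 u : gauss1 u <= 1.
Proof. by rewrite -expR0 ler_expR oppr_le0 mulr_ge0 ?pi_ge0 ?sqr_ge0. Qed.

Lemma continuous_gauss1 : continuous gauss1.
Proof.
move=> x; apply: (@continuous_comp _ _ _ (fun u : R => - (pi * u ^+ 2)) expR).
  apply: (@continuousN _ _ _ (fun u : R => pi * u ^+ 2)); apply: continuousM; first exact: cst_continuous.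
  exact: exprn_continuous.
exact: continuous_expR.
Qed.

Lemma measurable_gauss1 : measurable_fun setT gauss1.
Proof. apply: continuous_measurable_fun; exact: continuous_gauss1. Qed.

Lemma measurable_gauss1_fold N : measurable_fun setT (gauss1_fold N).
Proof.
have m1 : measurable_fun setT (fun u : R => u / N).
  by apply: measurable_funM => //; exact: measurable_cst.
apply: measurable_funD; apply: measurable_funM => //.
- by apply: measurable_funB => //; exact: measurable_cst.
- exact: measurable_gauss1.
- apply: measurableT_comp; first exact: measurable_gauss1.
  by apply: measurable_funB => //; exact: measurable_cst.
Qed.

Lemma gauss1_fold_itv N u : 0 < N -> 0 <= u <= N -> 0 <= gauss1_fold N u <= 1.
Proof.
move=> N0 /andP[u0 uN].
have t0 : 0 <= u / N by rewrite divr_ge0// ltW.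
have t1 : u / N <= 1 by rewrite ler_pdivrMr// mul1r.
have := gauss1_ge0 u; have := gauss1_ge0 (u - N).
have := gauss1_le1 u; have := gauss1_le1 (u - N).
by rewrite /gauss1_fold; move: (u / N) (gauss1 u) (gauss1 _) t0 t1 => t a b *; nra.
Qed.

Local Open Scope ereal_scope.

Lemma integral_indicM d (T : measurableType d) (m : {measure set T -> \bar R})
    (D : set T) (f : T -> \bar R) :
  \int[m]_(x in D) f x = \int[m]_x ((\1_D x)%:E * f x).
Proof.
rewrite integral_mkcond; apply: eq_integral => x _; rewrite patchE indicE.
by case: ifPn => _; rewrite ?mul1e ?mul0e.
Qed.

(** The two-point function [1 - gauss1 * gauss1] is not a product, so the coordinates are folded one
    at a time, with the factor [c] of the other one frozen. The weights [N - u] and [u] add up to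
    [N], which settles the term 1, and they average the two Gaussians into [N] times
    [gauss1_fold]. *)
Lemma integral_tent_fold (N c : R) (f : R -> \bar R) : (0 < N)%R -> (0 <= c <= 1)%R ->
  measurable_fun setT f -> (forall x, 0 <= f x) -> (forall u, f (u - N)%R = f u) ->
  \int[mu]_u ((tent N u)%:E * (f u * (1 - c * gauss1 u)%:E)) =
  N%:E * \int[mu]_u ((\1_`[0%R, N]%classic u)%:E * (f u * (1 - c * gauss1_fold N u)%:E)).
Proof.
move=> N0 /andP[c0 c1] mf f0 fper.
have w0 u : (0 <= 1 - c * gauss1 u)%R.
  by rewrite subr_ge0 mulr_ile1// ?gauss1_ge0// gauss1_le1.
have mw : measurable_fun setT (fun u => 1 - c * gauss1 u)%R.
  apply: measurable_funB; first exact: measurable_cst.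
  by apply: measurable_funM; [exact: measurable_cst|exact: measurable_gauss1].
rewrite integral_tent; last 3 first.
- exact: ltW.
- by apply: emeasurable_funM => //; exact/measurable_EFinP.
- by move=> u; rewrite mule_ge0// lee_fin.
have p1 u : (0 <= u <= N)%R -> (0 <= 1 - c * gauss1_fold N u)%R.
  move=> /(gauss1_fold_itv N0)/andP[p0 p1].
  by rewrite subr_ge0 mulr_ile1.
rewrite integral_indicM -ge0_integralZl_EFin//; last 3 first.
- move=> u _; rewrite indicE; case: (boolP (u \in _)) => [|_]; last by rewrite mul0e.
  rewrite inE/= in_itv/= => /p1 h.
  by rewrite mul1e mule_ge0// lee_fin.
- apply: emeasurable_funM; first exact/measurable_EFinP/measurable_indic.
  apply: emeasurable_funM => //.
  apply/measurable_EFinP; apply: measurable_funB; first exact: measurable_cst.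
  by apply: measurable_funM; [exact: measurable_cst|exact: measurable_gauss1_fold].
- exact: ltW.
apply: eq_integral => u _; rewrite indicE; case: (boolP (u \in _)) => [|_]; last by rewrite !mul0e mule0.
rewrite inE/= in_itv/= => /[dup] /p1 h /andP[u0 uN].
rewrite !mul1e fper !(muleCA _ (f u)) -!EFinM -ge0_muleDr; last 2 first.
- by rewrite lee_fin; apply: mulr_ge0 => //; rewrite subr_ge0.
- by rewrite lee_fin; apply: mulr_ge0.
congr (_ * _); rewrite -EFinD; congr EFin.
rewrite /gauss1_fold; field; exact: lt0r_neq0.
Qed.

(** Two passes of [integral_tent_fold]: over the second coordinate with [c = gauss1 x] and, after an
    exchange of integrals, over the first with [c = gauss1_fold N y]. *)
Lemma integral_tent_fold2 (N : R) (f : R * R -> \bar R) : (0 < N)%R ->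
  measurable_fun setT f -> (forall x, 0 <= f x) ->
  (forall u v, f (u - N, v)%R = f (u, v)) ->
  (forall u v, f (u, v - N)%R = f (u, v)) ->
  \int[mu2]_z ((tent N z.1 * tent N z.2)%:E *
     (f z * (1 - gauss1 z.1 * gauss1 z.2)%:E)) =
  (N ^+ 2)%:E * \int[mu2]_(z in square N)
     (f z * (1 - gauss1_fold N z.1 * gauss1_fold N z.2)%:E).
Proof.
move=> N0 mf f0 per1 per2.
pose D : set R := `[0%R, N]%classic.
have mD : measurable D by exact: measurable_itv.
have mI : measurable_fun setT (fun u : R => (\1_D u)%:E : \bar R) by exact/measurable_EFinP/measurable_indic.
have mD1 : measurable_fun setT (fun z : R * R => (\1_D z.1)%:E : \bar R).
  by apply: (measurableT_comp mI).
have mD2 : measurable_fun setT (fun z : R * R => (\1_D z.2)%:E : \bar R).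
  by apply: (measurableT_comp mI).
have mt1 : measurable_fun setT (fun z : R * R => (tent N z.1)%:E : \bar R).
  by apply/measurable_EFinP; apply: measurableT_comp => //; exact: measurable_tent.
have mt2 : measurable_fun setT (fun z : R * R => (tent N z.2)%:E : \bar R).
  by apply/measurable_EFinP; apply: measurableT_comp => //; exact: measurable_tent.
have mg1 : measurable_fun setT (fun z : R * R => gauss1 z.1).
  by apply: measurableT_comp => //; exact: measurable_gauss1.
have mg2 : measurable_fun setT (fun z : R * R => gauss1 z.2).
  by apply: measurableT_comp => //; exact: measurable_gauss1.
have mp1 : measurable_fun setT (fun z : R * R => gauss1_fold N z.1).
  by apply: measurableT_comp => //; exact: measurable_gauss1_fold.
have mp2 : measurable_fun setT (fun z : R * R => gauss1_fold N z.2).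
  by apply: measurableT_comp => //; exact: measurable_gauss1_fold.
have m1B (F G : R * R -> R) : measurable_fun setT F -> measurable_fun setT G ->
    measurable_fun setT (fun z => (1 - F z * G z)%:E : \bar R).
  move=> mF mG; apply/measurable_EFinP; apply: measurable_funB; first exact: measurable_cst.
  exact: measurable_funM.
have w0 (a b : R) : (0 <= a <= 1)%R -> (0 <= b <= 1)%R -> 0 <= (1 - a * b)%:E.
  by move=> /andP[a0 a1] /andP[b0 b1]; rewrite lee_fin subr_ge0 mulr_ile1.
have g01 u : (0 <= gauss1 u <= 1)%R by rewrite gauss1_ge0 gauss1_le1.
have DP u (x : \bar R) : ((0 <= u <= N)%R -> 0 <= x) -> 0 <= (\1_D u)%:E * x.
  rewrite indicE; case: (boolP (u \in _)) => [|_]; last by rewrite mul0e.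
  by rewrite inE /D /= in_itv/= mul1e => h; apply.
have p01 u : (0 <= u <= N)%R -> (0 <= gauss1_fold N u <= 1)%R by exact: gauss1_fold_itv.
have N0e : 0 <= N%:E by rewrite lee_fin ltW.
have W0 x y : 0 <= (\1_D y)%:E * (f (x, y) * (1 - gauss1 x * gauss1_fold N y)%:E).
  by apply: DP => yD; apply: mule_ge0 => //; apply: w0 => //; exact: p01.
have NW0 x y : 0 <= N%:E * ((\1_D y)%:E * (f (x, y) * (1 - gauss1 x * gauss1_fold N y)%:E)).
  exact: mule_ge0.
have mf1 u : measurable_fun setT (fun v => f (u, v)) by exact: measurableT_comp.
have mf2 v : measurable_fun setT (fun u => f (u, v)) by exact: measurableT_comp.
rewrite ge0_integral_lebesgue2; last 2 first.
- apply: emeasurable_funM; last by apply: emeasurable_funM => //; exact: m1B.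
  exact: (emeasurable_funM mt1 mt2).
- by move=> z; apply: mule_ge0; [rewrite lee_fin mulr_ge0// tent_ge0|rewrite mule_ge0// w0].
transitivity (\int[mu]_x \int[mu]_y ((tent N x)%:E * (N%:E * ((\1_D y)%:E *
    (f (x, y) * (1 - gauss1 x * gauss1_fold N y)%:E))))).
  apply: eq_integral => x _.
  have mH : measurable_fun setT (fun y => f (x, y) * (1 - gauss1 x * gauss1 y)%:E).
    apply: emeasurable_funM => //.
    have := m1B (fun z => gauss1 z.1) (fun z => gauss1 z.2) mg1 mg2.
    by move=> /measurableT_comp /(_ (measurable_pair1 x)).
  have mH' : measurable_fun setT (fun y => f (x, y) * (1 - gauss1 x * gauss1_fold N y)%:E).
    apply: emeasurable_funM => //.
    have := m1B (fun z => gauss1 z.1) (fun z => gauss1_fold N z.2) mg1 mp2.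
    by move=> /measurableT_comp /(_ (measurable_pair1 x)).
  transitivity (\int[mu]_y ((tent N x)%:E * ((tent N y)%:E * (f (x, y) * (1 - gauss1 x * gauss1 y)%:E)))).
    by apply: eq_integral => y _; rewrite EFinM -muleA.
  rewrite ge0_integralZl_EFin//; last 3 first.
  - move=> y _; apply: mule_ge0; rewrite ?lee_fin ?tent_ge0//.
    by apply: mule_ge0 => //; exact: w0.
  - by apply: emeasurable_funM => //; apply/measurable_EFinP; exact: measurable_tent.
  - exact: tent_ge0.
  have mDH : measurable_fun setT (fun y => (\1_D y)%:E *
      (f (x, y) * (1 - gauss1 x * gauss1_fold N y)%:E)) by exact: emeasurable_funM.
  rewrite (integral_tent_fold N0 (g01 x) (mf1 x) (fun y => f0 (x, y)) (per2 x)) [RHS]ge0_integralZl_EFin//; last 2 first.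
  - by apply: emeasurable_funM; first exact: measurable_cst.
  - exact: tent_ge0.
  congr (_ * _); rewrite [RHS]ge0_integralZl_EFin//; exact: ltW.
rewrite tonelli_lebesgue; last 2 first.
- apply: emeasurable_funM => //; apply: emeasurable_funM; first exact: measurable_cst.
  apply: emeasurable_funM => //; apply: emeasurable_funM.
    by apply: (measurableT_comp mf); exact: measurable_fun_pair.
  exact: m1B.
- by move=> x y; apply: mule_ge0; rewrite ?lee_fin ?tent_ge0.
rewrite [in RHS]integral_indicM.
have indE z : (\1_(square N) z = \1_D z.2 * \1_D z.1 :> R)%R.
  rewrite !indicE -natrM mulnb; congr (_%:R); congr nat_of_bool.
  by apply/idP/andP; rewrite !inE /square => -[].
have mR : measurable_fun setT (fun z : R * R => (\1_(square N) z)%:E * (f z * (1 - gauss1_fold N z.1 * gauss1_fold N z.2)%:E)).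
  apply: emeasurable_funM; last by apply: emeasurable_funM => //; exact: m1B.
  by apply/measurable_EFinP/measurable_indic; exact: measurable_square.
have R0 z : 0 <= (\1_(square N) z)%:E * (f z * (1 - gauss1_fold N z.1 * gauss1_fold N z.2)%:E).
  rewrite indE EFinM -muleA; apply: (DP) => z2; apply: (DP) => z1.
  by apply: mule_ge0 => //; apply: w0; exact: p01.
rewrite (ge0_integral_lebesgue2C mR R0) -ge0_integralZl_EFin; last 4 first.
- exact: measurableT.
- by move=> y _; apply: integral_ge0 => x _; exact: R0.
- have := @measurable_int_lebesgue R (fun z => (\1_(square N) (z.2, z.1))%:E * (f (z.2, z.1) * (1 - gauss1_fold N z.2 * gauss1_fold N z.1)%:E)).
  apply => [|z]; last exact: (R0 (z.2, z.1)).
  have := measurableT_comp mR (@measurable_swap _ _ R R); exact.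
- exact: sqr_ge0.
apply: eq_integral => y _.
(* Outside [D] both integrands vanish. The case is split off because [gauss1_fold N y] is known to
   lie in [[0, 1]] only for [y] in [D]. *)
case: (boolP (y \in D)) => yD; last first.
  rewrite [LHS]integral0_eq; last first.
    by move=> x _ /=; rewrite [(\1_D y)%R]indicE (negbTE yD) mul0e !mule0.
  rewrite integral0_eq ?mule0// => x _ /=.
  by rewrite indE/= [(\1_D y)%R]indicE (negbTE yD) mul0r mul0e.
have yN : (0 <= y <= N)%R by move: yD; rewrite inE /D /= in_itv.
transitivity (\int[mu]_x (N%:E * ((tent N x)%:E * (f (x, y) * (1 - gauss1_fold N y * gauss1 x)%:E)))).
  by apply: eq_integral => x _ /=; rewrite [(\1_D y)%R]indicE yD mul1e muleCA [(gauss1 x * _)%R]mulrC.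
have mH : measurable_fun setT (fun x => f (x, y) * (1 - gauss1_fold N y * gauss1 x)%:E).
  apply: emeasurable_funM => //.
  apply/measurable_EFinP; apply: measurable_funB; first exact: measurable_cst.
  by apply: measurable_funM; [exact: measurable_cst|exact: measurable_gauss1].
rewrite (ge0_integralZl_EFin _ measurableT _ _ (ltW N0)); last 2 first.
- move=> x _; apply: mule_ge0; rewrite ?lee_fin ?tent_ge0//.
  by apply: mule_ge0 => //; apply: w0 => //; exact: p01.
- by apply: emeasurable_funM => //; apply/measurable_EFinP; exact: measurable_tent.
rewrite (integral_tent_fold N0 (p01 _ yN) (mf2 y) (fun x => f0 (x, y)) (fun u => per1 u y)).
have -> : (N ^+ 2)%:E = N%:E * N%:E by rewrite expr2.
have Dy1 : \1_D y = 1%R :> R by rewrite indicE yD.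
have e : \int[mu]_x ((\1_D x)%:E * (f (x, y) * (1 - gauss1_fold N y * gauss1_fold N x)%:E)) =
   \int[mu]_x ((\1_(square N) (x, y))%:E *
     (f (x, y) * (1 - gauss1_fold N x * gauss1_fold N y)%:E)).
  apply: eq_integral => x _; rewrite indE/= Dy1 mul1r.
  by rewrite [(gauss1_fold N x * _)%R]mulrC.
by move: e => /(congr1 (fun J => N%:E * N%:E * J)) <-; rewrite -muleA.
Qed.

End gaussian_folding.

(** * Two-point function of the Ginibre kernel *)

Section ginibre_two_point.
Variable R : realType.
Local Open Scope complex_scope.

Lemma CexpD (z w : R[i]) : Cexp (z + w) = Cexp z * Cexp w.
Proof.
case: z => a b; case: w => c d; rewrite /Cexp /= expRD cosD sinD.
by apply/eqP; rewrite eq_complex /=; apply/andP; split; apply/eqP; ring.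
Qed.

Lemma Cexp_real (a : R) : Cexp a%:C = (expR a)%:C.
Proof. by rewrite /Cexp /= cos0 sin0; apply/eqP; rewrite eq_complex /=; apply/andP; split; apply/eqP; ring. Qed.

Lemma ginibre_kernel_diag (x : R[i]) : ginibre_kernel x x = 1.
Proof.
rewrite /ginibre_kernel normCK (_ : _ + _ - _ = 0); last by ring.
by rewrite mulr0 -[0]/(0%:C) Cexp_real expR0.
Qed.

(** The exponents of the two factors are complex conjugates: imaginary parts cancel and real parts
    add up to [- pi |x - y|^2]. *)
Lemma ginibre_kernel_offdiag (x y : R * R) :
  ginibre_kernel (toC x) (toC y) * ginibre_kernel (toC y) (toC x) =
  (gauss1 (x - y).1 * gauss1 (x - y).2)%:C.
Proof.
rewrite /ginibre_kernel -CexpD /gauss1 -expRD -Cexp_real; congr Cexp.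
rewrite !normCK; case: x => a b; case: y => c d; rewrite /toC /=.
by apply/eqP; rewrite eq_complex /=; apply/andP; split; apply/eqP; field.
Qed.

Lemma ginibre_det2 (x : 2.-tuple (R * R)) :
  \det (\matrix_(i < 2, j < 2)
    ginibre_kernel (toC (tnth x i)) (toC (tnth x j))) =
  (1 - gauss1 (tnth x ord0 - tnth x ord_max).1 *
       gauss1 (tnth x ord0 - tnth x ord_max).2)%:C.
Proof.
rewrite (expand_det_row _ ord0) !big_ord_recl big_ord0 /cofactor !det_mx11 !mxE /=.
rewrite expr0 expr1 !ginibre_kernel_diag addr0 !mul1r mulN1r mulrN.
rewrite (_ : lift ord0 ord0 = ord_max :> 'I_2); last exact/val_inj.
rewrite (_ : lift ord_max 0 = ord0 :> 'I_2); last exact/val_inj.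
by rewrite ginibre_kernel_offdiag; apply/eqP; rewrite eq_complex /= subr0 !eqxx.
Qed.

End ginibre_two_point.

Section pair_statistics.
Variables (R : realType) (d : measure_display) (T : measurableType d).
Variables (P : probability T R) (X : point_process R T).
Notation mu2 := (@lebesgue2 R).
Local Open Scope ereal_scope.

Definition distinct_pairs (w : T) : set (nat * nat) :=
  [set p | [/\ p.1 <> p.2, idx X w p.1 & idx X w p.2]].

(** Ordered pairs of distinct indices correspond one to one to the duplicate-free 2-tuples over
    which the correlation identity sums. *)
Lemma integral_distinct_pairs (rho : 2.-tuple (R * R) -> R)
    (F : (R * R) * (R * R) -> \bar R) :
  is_correlation_function P X rho -> measurable_fun setT F -> (forall z, 0 <= F z) ->
  \int[P]_w (\esum_(p in distinct_pairs w) F (pt X p.1 w, pt X p.2 w)) =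
  \int[mu2]_x \int[mu2]_y (F (x, y) * (rho [tuple x; y])%:E).
Proof.
move=> [_ _ hrho] mF F0.
pose G (t : 2.-tuple (R * R)) := F (tnth t ord0, tnth t ord_max).
have mG : measurable_fun setT G.
  apply: (measurableT_comp mF).
  by apply: measurable_fun_pair; exact: measurable_tnth.
transitivity (iterated_integral (fun x : 2.-tuple (R * R) => G x * (rho x)%:E)); last first.
  rewrite /=; apply: eq_integral => x _; apply: eq_integral => y _.
  by [].
rewrite -(hrho G mG (fun t => F0 _)); apply: eq_integral => w _.
rewrite [RHS](reindex_esum (distinct_pairs w) _ (fun p => [tuple p.1; p.2])).
  by apply: eq_esum => -[i j] _; rewrite /G !(tnth_nth point) /=.
split.
- move=> [i j] [/= ij wi wj]; split; first by rewrite inE andbT; apply/eqP.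
  by move=> k; rewrite !inE => /orP[] /eqP ->.
- by move=> [i j] [i' j'] _ _ /(congr1 val)/= [-> ->].
- move=> t [/= ut wt]; exists (tnth t ord0, tnth t ord_max).
  + have /= := ut; case/tupleP : t ut wt => i t ut wt; case/tupleP : t ut wt => j t.
    rewrite (tuple0 t) /= => ut wt _; split => /=.
    * rewrite !(tnth_nth 0%N) /=; move: ut; rewrite inE andbT => /eqP; exact.
    * by rewrite (tnth_nth 0%N) /=; apply: wt; rewrite !inE eqxx.
    * by rewrite (tnth_nth 0%N) /=; apply: wt; rewrite !inE eqxx orbT.
  + apply: eq_from_tnth => k; rewrite [LHS](tnth_nth 0%N) /=.
    by case: k => -[|[|//]] /= h; congr tnth; exact: val_inj.
Qed.

(** The set of pairs depends on [w]. Extending the summand by 0 gives a double series over all pairs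
    of naturals, whose terms are measurable because membership of each index is a measurable
    event. *)
Lemma measurable_esum_distinct_pairs (F : (R * R) * (R * R) -> \bar R) :
  measurable_fun setT F -> (forall z, 0 <= F z) ->
  measurable_fun setT
    (fun w => \esum_(p in distinct_pairs w) F (pt X p.1 w, pt X p.2 w)).
Proof.
move=> mF F0.
pose a i j w := if (i, j) \in distinct_pairs w then F (pt X i w, pt X j w) else 0.
have a0 i j w : 0 <= a i j w by rewrite /a; case: ifPn.
rewrite (_ : (fun w => _) = fun w => \sum_(i <oo) \sum_(j <oo) a i j w); last first.
  apply/funext => w; rewrite esum_mkcond.
  under eq_eseriesr do rewrite nneseries_esumT//.
  rewrite nneseries_esumT; last by move=> i; exact: esum_ge0.
  rewrite (@esum_esum _ _ _ _ (fun=> setT) (fun i j => a i j w))//.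
  rewrite (_ : setT `*`` _ = setT); last by apply/seteqP; split.
  by apply: eq_esum => -[i j] _.
apply: ge0_emeasurable_sum => [i w _ _|i _]; first exact: nneseries_ge0.
apply: ge0_emeasurable_sum => [j w _ _|j _] //.
have mij : measurable_fun setT (fun w => F (pt X i w, pt X j w)).
  by apply: (measurableT_comp mF); apply: measurable_fun_pair; exact: measurable_pt.
pose D := [set w | (i, j) \in distinct_pairs w].
have mD : measurable D.
  rewrite (_ : D = if i == j then set0 else [set w | idx X w i] `&` [set w | idx X w j]).
    by case: ifPn => // _; apply: measurableI; exact: measurable_idx.
  apply/seteqP; split => w; rewrite /D /= inE /distinct_pairs /=.
    by move=> [/eqP/negbTE -> ? ?].
  by case: ifPn => // /eqP ij [? ?].
rewrite (_ : a i j = (fun w => F (pt X i w, pt X j w)) \_ D).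
  exact/(measurable_restrictT _ mD).1/measurable_funTS.
apply/funext => w; rewrite patchE /a.
by rewrite (_ : (w \in D) = ((i, j) \in distinct_pairs w))// /D mem_setE.
Qed.

(** The norm on the plane is the sup norm, so the square lies in the closed ball of radius [N],
    where local finiteness applies. *)
Lemma finite_pairs_square (N : R) (w : T) :
  finite_set [set p : nat * nat | [/\ p.1 <> p.2, idx X w p.1, idx X w p.2,
    square N (pt X p.1 w) & square N (pt X p.2 w)]].
Proof.
pose A := [set i | idx X w i /\ (`|pt X i w| <= N)%R].
have fA : finite_set A by exact: locally_finite.
apply: (@sub_finite_set _ _ (A `*` A)); last exact: finite_setX.
have sqN (z : R * R) : square N z -> (`|z| <= N)%R.
  case: z => u v [] /=; rewrite !in_itv /= => /andP[u0 uN] /andP[v0 vN].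
  by rewrite prod_normE /= ge_max !ger0_norm// uN vN.
by move=> [i j] [/= _ wi wj /sqN si /sqN sj]; split; split.
Qed.

End pair_statistics.

(** * Cosine coefficients and integrability of E_N *)

Section EN_properties.
Variables (R : realType) (N : R) (f : R * R -> R).
Hypothesis N0 : 0 < N.
Hypothesis hf : is_EN N f.
Notation mu2 := (@lebesgue2 R).
Local Open Scope complex_scope.

Lemma EN_measurable : measurable_fun setT f.
Proof. by case: (EN_L2loc hf). Qed.

Lemma EN_periodic1 u v : f (u - N, v) = f (u, v).
Proof.
rewrite -(EN_periodic hf (u, v) (y := (- N, 0))); first by congr f; congr pair; rewrite addr0.
by exists (-1)%Z, 0%Z; rewrite mul0r mulrN1z mulN1r.
Qed.

Lemma EN_periodic2 u v : f (u, v - N) = f (u, v).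
Proof.
rewrite -(EN_periodic hf (u, v) (y := (0, - N))); first by congr f; congr pair; rewrite addr0.
by exists 0%Z, (-1)%Z; rewrite mul0r mulrN1z mulN1r.
Qed.

(** Real part of the Fourier identity; as [f] is real, only the cosine of the character remains. *)
Lemma EN_fourier_cos (m n : int) :
  \int[mu2]_(x in square N) (f x * cos (2 * pi / N * (m%:~R * x.1 + n%:~R * x.2))) =
  if (m, n) == (0, 0) then 0 else N ^+ 2 / (m%:~R ^+ 2 + n%:~R ^+ 2).
Proof.
have := EN_fourier hf m n; rewrite /fourier_coef.
set c : R := if (m, n) == (0, 0) then 0 else (m%:~R ^+ 2 + n%:~R ^+ 2)^-1.
have -> : (if (m, n) == (0, 0) then 0 else (m%:~R ^+ 2 + n%:~R ^+ 2)^-1%:C) = c%:C.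
  by rewrite /c; case: ifP.
rewrite /Cintegral; set I1 := Rintegral _ _ _; set I2 := Rintegral _ _ _.
move=> /(congr1 (@complex.Re R)) /=; rewrite mul0r subr0 => h.
have N20 : N ^+ 2 != 0 by rewrite expf_neq0// gt_eqF.
have -> : (if (m, n) == (0, 0) then 0 else N ^+ 2 / (m%:~R ^+ 2 + n%:~R ^+ 2)) = N ^+ 2 * c.
  by rewrite /c; case: ifP; rewrite ?mulr0.
rewrite -h mulrA mulfV// mul1r /I1; apply: eq_Rintegral => x _.
rewrite [X in Cexp X](_ : _ = 0 +i* (- (2 * pi / N * (m%:~R * x.1 + n%:~R * x.2)))); last first.
  apply/eqP; rewrite eq_complex /=; apply/andP; split; apply/eqP; field; exact: lt0r_neq0.
by rewrite /Cexp /= expR0 cosN sinN; ring.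
Qed.

Lemma EN_mean0 : \int[mu2]_(x in square N) f x = 0.
Proof.
have := EN_fourier_cos 0 0; rewrite eqxx => <-; apply: eq_Rintegral => x _.
by rewrite !mul0r addr0 mulr0 cos0 mulr1.
Qed.

Lemma compact_square : compact (@square R N).
Proof. by apply: compact_setX; exact: segment_compact. Qed.

Local Open Scope ereal_scope.

Lemma lebesgue2_square : mu2 (square N) = (N ^+ 2)%:E.
Proof.
rewrite /square lebesgue2_setX// lebesgue_measure_itv /= lte_fin N0 -EFinB subr0.
by rewrite -EFinM expr2.
Qed.

(** Square integrability suffices on a set of finite area, by [|a| <= 1 + a^2]. *)
Lemma EN_integrable : mu2.-integrable (square N) (EFin \o f).
Proof.
have [mf /(_ _ compact_square) foo] := EN_L2loc hf.
apply/integrableP; split; first exact/measurable_EFinP/measurable_funTS.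
have mQ := measurable_square N.
have mf2 : measurable_fun (square N) (fun x => (f x ^+ 2)%:E).
  apply/measurable_EFinP; apply: measurable_funX.
  exact: measurable_funTS.
apply: (@le_lt_trans _ _ (\int[mu2]_(x in square N) (cst 1 x + (f x ^+ 2)%:E))).
  apply: ge0_le_integral => //.
  - apply: measurableT_comp => //; apply/measurable_EFinP; exact: measurable_funTS.
  - by apply: emeasurable_funD => //; exact: measurable_cst.
  - move=> x _; rewrite /= lee_fin -[leRHS]addrC -(real_normK (num_real (f x))).
    move: `|f x|%R (normr_ge0 (f x)) => a a0; nra.
rewrite ge0_integralD//; last first.
  by move=> x _; rewrite lee_fin sqr_ge0.
apply: lte_add_pinfty => //; rewrite integral_cst// mul1e.
by rewrite [X in X < _](_ : _ = (N ^+ 2)%:E) ?ltry//; exact: lebesgue2_square.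
Qed.

End EN_properties.

Section expectation_W.
Variables (R : realType) (d : measure_display) (T : measurableType d).
Variables (P : probability T R) (X : point_process R T).
Hypothesis hX : is_determinantal P X (@ginibre_kernel R).
Variables (N : R).
Hypothesis N0 : 0 < N.
Notation mu2 := (@lebesgue2 R).

Definition square_pairs (w : T) : set (nat * nat) :=
  [set p | [/\ p.1 <> p.2, idx X w p.1, idx X w p.2,
    square N (pt X p.1 w) & square N (pt X p.2 w)]].

Definition square_pair_sum (h : R * R -> R) (w : T) : R :=
  \sum_(p \in square_pairs w) h (pt X p.1 w - pt X p.2 w).

Let F (h : R * R -> R) (z : (R * R) * (R * R)) : \bar R :=
  ((\1_(square N) z.1 * \1_(square N) z.2) * h (z.1 - z.2))%:E.

Let F0 h : (forall z, 0 <= h z) -> forall z, (0 <= F h z)%E.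
Proof. by move=> h0 z; rewrite lee_fin !mulr_ge0. Qed.

Let mF h : measurable_fun setT h -> measurable_fun setT (F h).
Proof.
move=> mh; apply/measurable_EFinP; apply: measurable_funM.
  by apply: measurable_funM; apply: measurableT_comp => //;
    apply: measurable_indic; exact: measurable_square.
apply: measurableT_comp => //.
by apply: measurable_fun_pair => /=; apply: measurable_funB => //;
  apply: measurableT_comp.
Qed.

Lemma esum_square_pair_sum h w : (forall z, 0 <= h z) ->
  (\esum_(p in distinct_pairs X w) F h (pt X p.1 w, pt X p.2 w) =
  (square_pair_sum h w)%:E)%E.
Proof.
move=> h0; have fS : finite_set (square_pairs w) by exact: finite_pairs_square.
transitivity (\esum_(p in square_pairs w) (h (pt X p.1 w - pt X p.2 w))%:E)%E.
  rewrite esum_mkcond [RHS]esum_mkcond; apply: eq_esum => -[i j] _.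
  case: (boolP ((i, j) \in square_pairs w)) => ijS.
    move: (ijS); rewrite inE => -[/= ij wi wj si sj].
    rewrite ifT; last by rewrite inE; split.
    by rewrite /F /= !indicE !mem_set// !mul1r.
  case: ifPn => // ijD; rewrite /F /= !indicE.
  case: (boolP (pt X i w \in _)) => si; last by rewrite !mul0r.
  case: (boolP (pt X j w \in _)) => sj; last by rewrite mulr0 mul0r.
  move: ijS ijD; rewrite notin_setE inE => nS [/= ij wi wj]; exfalso; apply: nS.
  by split => //=; apply: set_mem.
rewrite esum_fset//; last by move=> p _; rewrite lee_fin.
by rewrite /square_pair_sum fsumEFin.
Qed.

Lemma measurable_square_pair_sum (h : R * R -> R) : measurable_fun setT h -> (forall z, 0 <= h z) ->
  measurable_fun setT (square_pair_sum h).
Proof.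
move=> mh h0; apply/measurable_EFinP.
rewrite (_ : _ \o _ = fun w => (\esum_(p in distinct_pairs X w) F h (pt X p.1 w, pt X p.2 w))%E).
  by apply: measurable_esum_distinct_pairs; [exact: mF|exact: F0].
by apply/funext => w; rewrite esum_square_pair_sum.
Qed.

Local Open Scope ereal_scope.

(** Three reductions in a row: the two-point function of the kernel, the autocorrelation of the
    square, and folding along the period. The sign condition on [h] is the one under which
    correlation functions may be tested. *)
Lemma integral_square_pair_sum (h : R * R -> R) : measurable_fun setT h -> (forall z, (0 <= h z)%R) ->
  (forall u v, h (u - N, v)%R = h (u, v)) -> (forall u v, h (u, v - N)%R = h (u, v)) ->
  \int[P]_w (square_pair_sum h w)%:E =
  (N ^+ 2)%:E * \int[mu2]_(z in square N)
     (h z * (1 - gauss1_fold N z.1 * gauss1_fold N z.2))%:E.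
Proof.
move=> mh h0 per1 per2.
have [rho rhoX rhoE] := hX (isT : (0 < 2)%N).
transitivity (\int[P]_w (\esum_(p in distinct_pairs X w) F h (pt X p.1 w, pt X p.2 w))).
  by apply: eq_integral => w _; rewrite esum_square_pair_sum.
rewrite (integral_distinct_pairs rhoX (mF mh) (F0 h0)).
have rho2 (x y : R * R) : rho [tuple x; y] = (1 - gauss1 (x - y).1 * gauss1 (x - y).2)%R.
  have := rhoE [tuple x; y]; rewrite ginibre_det2 /= => /(congr1 (@complex.Re R)) /= ->.
  by rewrite !(tnth_nth point).
pose k (z : R * R) : \bar R := (h z)%:E * (1 - gauss1 z.1 * gauss1 z.2)%:E.
have mk : measurable_fun setT k.
  apply: emeasurable_funM; first exact/measurable_EFinP.
  apply/measurable_EFinP; apply: measurable_funB; first exact: measurable_cst.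
  by apply: measurable_funM; apply: measurableT_comp => //; exact: measurable_gauss1.
have k0 z : 0 <= k z.
  apply: mule_ge0; rewrite lee_fin// subr_ge0 mulr_ile1 ?gauss1_ge0 ?gauss1_le1//.
transitivity (\int[mu2]_x \int[mu2]_y
    ((\1_(square N) x * \1_(square N) y)%:E * k (x - y)%R)).
  apply: eq_integral => x _; apply: eq_integral => y _.
  by rewrite /F /k /= rho2 EFinM -muleA.
rewrite (square_autocorrelation (ltW N0) mk k0).
have hE0 z : 0 <= (h z)%:E by rewrite lee_fin.
rewrite (@integral_tent_fold2 R N (EFin \o h) N0 _ hE0)//=.
- exact/measurable_EFinP.
- by move=> u v; rewrite per1.
- by move=> u v; rewrite per2.
Qed.

(** The positive and negative parts of [f] inherit its periodicity and integrability, so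
    [integral_square_pair_sum] applies to each; both expectations are finite and can be
    subtracted. *)
Lemma expectation_W (f : R * R -> R) : is_EN N f ->
  'E_P[W X N f] =
  (ln (N / (2 * pi * complex.Re (dedekind_eta ('i : R[i]) ^+ 2)%C)) -
   (2 * pi)^-1 * \int[mu2]_(z in square N)
     (f z * (gauss1_fold N z.1 * gauss1_fold N z.2)))%:E.
Proof.
move=> hf.
have mQ := measurable_square N.
have mf := EN_measurable hf.
have intf := EN_integrable N0 hf.
pose w (z : R * R) : R := (gauss1_fold N z.1 * gauss1_fold N z.2)%R.
have mw : measurable_fun setT w.
  by apply: measurable_funM; apply: measurableT_comp => //; exact: measurable_gauss1_fold.
have w01 z : square N z -> (0 <= w z <= 1)%R.
  case: z => u v [/=]; rewrite !in_itv/= => /(gauss1_fold_itv N0)/andP[a0 a1].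
  move=> /(gauss1_fold_itv N0)/andP[b0 b1]; rewrite /w /=.
  by rewrite mulr_ge0//= mulr_ile1.
have intM (g : R * R -> R) (v : R * R -> R) : measurable_fun setT g -> measurable_fun setT v ->
    mu2.-integrable (square N) (EFin \o g) ->
    (forall z, square N z -> (0 <= v z <= 1)%R) ->
    mu2.-integrable (square N) (EFin \o (fun z => g z * v z)%R).
  move=> mg mv ig v01; apply: le_integrable ig => //.
    by apply/measurable_EFinP; apply: measurable_funM; exact: measurable_funTS.
  move=> z /v01/andP[v0 v1]; rewrite /= lee_fin normrM ler_piMr// ger0_norm//.
have mw1 : measurable_fun setT (fun z => 1 - w z)%R.
  by apply: measurable_funB => //; exact: measurable_cst.
have w101 z : square N z -> (0 <= 1 - w z <= 1)%R.
  by move=> /w01/andP[w0 w1]; rewrite subr_ge0 w1/= lerBlDr lerDl.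
pose fp : R * R -> R := (f^\+)%R; pose fm : R * R -> R := (f^\-)%R.
have mfp : measurable_fun setT fp by exact: measurable_funrpos.
have mfm : measurable_fun setT fm by exact: measurable_funrneg.
have fp0 z : (0 <= fp z)%R by exact: funrpos_ge0.
have fm0 z : (0 <= fm z)%R by exact: funrneg_ge0.
have fE z : f z = (fp z - fm z)%R by rewrite -[in LHS](funrposBneg f).
have ifp : mu2.-integrable (square N) (EFin \o fp) by exact: integrable_funrpos.
have ifm : mu2.-integrable (square N) (EFin \o fm) by exact: integrable_funrneg.
have per1 u v : f (u - N, v)%R = f (u, v) := EN_periodic1 hf u v.
have per2 u v : f (u, v - N)%R = f (u, v) := EN_periodic2 hf u v.
have Ip : \int[P]_x (square_pair_sum fp x)%:E =
    (N ^+ 2 * \int[mu2]_(z in square N) (fp z * (1 - w z)))%:E.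
  rewrite integral_square_pair_sum//; last 2 first.
    - by move=> u v; rewrite /fp /funrpos per1.
    - by move=> u v; rewrite /fp /funrpos per2.
  rewrite [RHS]EFinM; congr (_ * _); rewrite /Rintegral fineK//.
  by apply: integrable_fin_num => //; exact: intM.
have Im : \int[P]_x (square_pair_sum fm x)%:E =
    (N ^+ 2 * \int[mu2]_(z in square N) (fm z * (1 - w z)))%:E.
  rewrite integral_square_pair_sum//; last 2 first.
    - by move=> u v; rewrite /fm /funrneg per1.
    - by move=> u v; rewrite /fm /funrneg per2.
  rewrite [RHS]EFinM; congr (_ * _); rewrite /Rintegral fineK//.
  by apply: integrable_fin_num => //; exact: intM.
have sp0 x : (0 <= square_pair_sum fp x)%R by apply: fsumr_ge0.
have sm0 x : (0 <= square_pair_sum fm x)%R by apply: fsumr_ge0.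
have isp : P.-integrable setT (EFin \o square_pair_sum fp).
  apply/integrableP; split; first by apply/measurable_EFinP; exact: measurable_square_pair_sum.
  under eq_integral do rewrite /= ger0_norm//.
  by rewrite Ip ltry.
have ism : P.-integrable setT (EFin \o square_pair_sum fm).
  apply/integrableP; split; first by apply/measurable_EFinP; exact: measurable_square_pair_sum.
  under eq_integral do rewrite /= ger0_norm//.
  by rewrite Im ltry.
set K := ln _; pose c : R := ((2 * pi * N ^+ 2)^-1)%R.
have WE x : W X N f x = (c * (square_pair_sum fp x - square_pair_sum fm x) + K)%R.
  rewrite /W -/c -/K; congr (c * _ + K)%R.
  have fS : finite_set (square_pairs x) by exact: finite_pairs_square.
  rewrite -[LHS]/(square_pair_sum f x) /square_pair_sum !fsbig_finite//=.
  by rewrite -sumrB; apply: eq_bigr => p _; exact: fE.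
rewrite unlock /=.
transitivity (\int[P]_x (c%:E * ((EFin \o square_pair_sum fp) x - (EFin \o square_pair_sum fm) x) + cst K%:E x)).
  by apply: eq_integral => x _; rewrite WE.
rewrite integralD//; last 2 first.
- by apply: integrableZl => //; exact: integrableB.
- exact: finite_measure_integrable_cst.
rewrite integralZl//; last exact: integrableB.
rewrite integralB//.
have -> : \int[P]_x cst K%:E x = K%:E by rewrite integral_cst//= probability_setT mule1.
rewrite Ip Im.
rewrite -EFinB -EFinM -EFinD; congr EFin; rewrite addrC; congr (_ + _)%R.
(* As [f] has mean zero, the term 1 of [1 - w] contributes nothing and only a change of sign is
   left. *)
have -> : (\int[mu2]_(z in square N) (f z * w z) = - (\int[mu2]_(z in square N) (fp z * (1 - w z)) - \int[mu2]_(z in square N) (fm z * (1 - w z))))%R.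
  rewrite -RintegralB//; [|exact: intM|exact: intM].
  transitivity (\int[mu2]_(z in square N) (f z - f z * (1 - w z)))%R.
    by apply: eq_Rintegral => z _; ring.
  rewrite RintegralB//; [|exact: intM].
  rewrite (EN_mean0 N0 hf) sub0r; congr (- _)%R; apply: eq_Rintegral => z _.
  by rewrite fE; ring.
have : (pi != 0 :> R)%R by rewrite gt_eqF// pi_gt0.
rewrite /c -mulrBr; move: (pi : R) => p p0; field.
by rewrite p0 lt0r_neq0.
Qed.

End expectation_W.

(** * Logarithmic moments of the Gaussian in the plane *)

Section log_series.
Variable R : realType.

(* ln |1 - r e^(i t)|^2, with c = cos t. *)
Definition log_quad (r c : R) : R := ln (1 - 2 * r * c + r ^+ 2).

Lemma quad_ge (r c : R) : 0 <= r -> `|c| <= 1 -> (1 - r) ^+ 2 <= 1 - 2 * r * c + r ^+ 2.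
Proof. by rewrite ler_norml => r0 /andP[c1 c2]; nra. Qed.

Let cosS (t : R) (m : nat) : cos (m.+2%:R * t) = 2 * cos t * cos (m.+1%:R * t) - cos (m%:R * t).
Proof.
have -> : m.+2%:R * t = m.+1%:R * t + t by rewrite -!natr1; ring.
have -> : m%:R * t = m.+1%:R * t - t by rewrite -!natr1; ring.
rewrite cosD cosB; ring.
Qed.

(** The sum is the derivative in [r] of the partial sum of the logarithmic series. Multiplied by the
    quadratic it telescopes, thanks to the recurrence [cosS]. *)
Let quad_sum (r t : R) (M : nat) :
  (1 - 2 * r * cos t + r ^+ 2) * \sum_(m < M) r ^+ m * cos (m.+1%:R * t) =
  cos t - r - r ^+ M * (cos (M.+1%:R * t) - r * cos (M%:R * t)).
Proof.
elim: M => [|M IH]; first by rewrite big_ord0 mulr0 expr0 !mul1r mul0r cos0; ring.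
rewrite big_ord_recr /= mulrDr IH [r ^+ M.+1]exprS cosS; ring.
Qed.

(** The quantity inside the norm vanishes at [r = 0], and by [quad_sum] its derivative in [r] is a
    single remainder, at most [4 r^M / (1 - r)^2]; the mean value theorem adds a factor [r]. The
    bound is uniform in [t], which later permits termwise integration. *)
Lemma log_quad_series (r t : R) (M : nat) : 0 <= r < 1 ->
  `|log_quad r (cos t) + 2 * \sum_(m < M) r ^+ m.+1 * cos (m.+1%:R * t) / m.+1%:R|
    <= 4 * r ^+ M.+1 / (1 - r) ^+ 2.
Proof.
move=> /andP[r0 r1].
pose p : {poly R} := 1 - (2 * cos t) *: 'X + 'X^2.
pose q : {poly R} := \sum_(m < M) (2 * cos (m.+1%:R * t) / m.+1%:R) *: 'X^(m.+1).
have pE x : p.[x] = 1 - 2 * x * cos t + x ^+ 2 by rewrite /p !hornerE; ring.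
have qE x : q.[x] = 2 * \sum_(m < M) x ^+ m.+1 * cos (m.+1%:R * t) / m.+1%:R.
  rewrite /q horner_sum mulr_sumr; apply: eq_bigr => m _.
  by rewrite hornerZ hornerXn; ring.
have dpE x : p^`().[x] = 2 * x - 2 * cos t.
  rewrite /p derivD derivB derivXn derivZ derivX -polyC1 derivC.
  by rewrite hornerD hornerMn hornerXn !hornerE /= expr1 -mulr_natr; ring.
have dqE x : q^`().[x] = 2 * \sum_(m < M) x ^+ m * cos (m.+1%:R * t).
  rewrite /q raddf_sum horner_sum mulr_sumr; apply: eq_bigr => m _ /=.
  rewrite derivZ derivXn hornerZ hornerMn hornerXn -mulr_natr /=; field.
  by rewrite addrC natr1 pnatr_eq0.
pose D : R -> R := (@ln R \o horner p) + horner q.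
pose dD x := p.[x]^-1 * p^`().[x] + q^`().[x].
have p0 (x : R) : 0 <= x < 1 -> 0 < p.[x].
  move=> /andP[x0 x1]; apply: (@lt_le_trans _ _ ((1 - x) ^+ 2)).
    by rewrite exprn_gt0// subr_gt0.
  by rewrite pE; apply: quad_ge => //; exact: cos_max.
have dDP (x : R) : 0 <= x < 1 -> is_derive x 1 D (dD x).
  move=> /p0 px; apply: is_deriveD; apply: is_derive1_comp; exact: is_derive1_ln.
have dDb (x : R) : 0 <= x <= r -> `|dD x| <= 4 * r ^+ M / (1 - r) ^+ 2.
  move=> /andP[x0 xr]; have x1 := le_lt_trans xr r1.
  have px : 0 < p.[x] by apply: p0; rewrite x0.
  have -> : dD x = - 2 * x ^+ M * (cos (M.+1%:R * t) - x * cos (M%:R * t)) / p.[x].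
    have := quad_sum x t M; rewrite /dD dpE dqE -pE => h.
    have pn : p.[x] != 0 by exact: lt0r_neq0.
    apply: (mulfI pn); rewrite mulrDr mulrA mulfV// mul1r.
    by rewrite [in RHS]mulrC mulfVK// [p.[x] * _]mulrCA h; ring.
  rewrite !normrM normfV (gtr0_norm px) normrN [`|2|]ger0_norm// (ger0_norm (exprn_ge0 _ x0)).
  apply: ler_pM.
  - by rewrite !mulr_ge0// exprn_ge0.
  - by rewrite invr_ge0 ltW.
  - rewrite -mulrA (_ : 4 = 2 * 2); last by ring.
    rewrite -[leRHS]mulrA ler_pM2l// mulrC; apply: ler_pM => //.
    + exact: exprn_ge0.
    + rewrite (le_trans (ler_normB _ _))// normrM (ger0_norm x0).
      have := cos_max (M.+1%:R * t); have := cos_max (M%:R * t).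
      by move: `|cos _| (normr_ge0 (cos (M%:R * t))) => a a0; move: `|cos _| => b; nra.
    + by rewrite lerXn2r// nnegrE.
  - rewrite lef_pV2 ?posrE//; last by rewrite exprn_gt0// subr_gt0.
    rewrite pE (le_trans _ (quad_ge x0 (cos_max t)))// lerXn2r ?nnegrE ?subr_ge0 ?(ltW r1) ?(ltW x1)//.
    by rewrite lerD2l lerN2.
have [||c] := @MVT_segment R D dD 0 r r0.
- move=> x; rewrite in_itv/= => /andP[x0 xr]; apply: dDP.
  by rewrite ltW//= (lt_trans xr).
- apply: derivable_within_continuous => x; rewrite in_itv/= => /andP[x0 xr].
  by have [] := dDP x _; rewrite ?x0 ?(le_lt_trans xr).
rewrite in_itv/= subr0 => cr.
have -> : D 0 = 0.
  rewrite /D !fctE /= pE qE mulr0 mul0r subr0 expr0n addr0 ln1 add0r.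
  by rewrite big1 ?mulr0// => m _; rewrite expr0n /= !mul0r.
have -> : D r = log_quad r (cos t) + 2 * \sum_(m < M) r ^+ m.+1 * cos (m.+1%:R * t) / m.+1%:R.
  by rewrite /D !fctE /= pE qE.
rewrite subr0 => ->; rewrite normrM (ger0_norm r0).
rewrite [leRHS](_ : _ = 4 * r ^+ M / (1 - r) ^+ 2 * r); last by rewrite exprS; ring.
by rewrite ler_wpM2r// dDb.
Qed.

End log_series.

Section integration_tools.
Variable R : realType.
Notation mu := (@lebesgue_measure R).
Notation mu2 := (@lebesgue2 R).

Lemma dominated_Rintegral d (T : measurableType d) (m : {measure set T -> \bar R})
    (D : set T) (f_ : nat -> T -> R) (f g : T -> R) : measurable D ->
  (forall n, measurable_fun D (f_ n)) ->
  (forall x, D x -> f_ ^~ x @ \oo --> f x) ->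
  m.-integrable D (EFin \o g) ->
  (forall n x, D x -> `|f_ n x| <= g x) ->
  m.-integrable D (EFin \o f) /\
  (\int[m]_(x in D) f_ n x @[n --> \oo] --> \int[m]_(x in D) f x).
Proof.
move=> mD mf_ cvf ig fg.
have mf : measurable_fun D f by apply: (measurable_fun_cvg mf_).
have [|||||+ _ +] := @dominated_convergence _ _ _ m D mD (fun n => EFin \o f_ n) (EFin \o f) (EFin \o g).
- by move=> n; exact/measurable_EFinP.
- exact/measurable_EFinP.
- apply: aeW => x Dx; apply: cvg_EFin; last exact: cvf.
  exact: nearW.
- exact: ig.
- by apply: aeW => x n Dx; rewrite /= lee_fin; exact: fg.
move=> intf cv; split => //.
apply: (@fine_cvg _ _ _ _ (fun n => \int[m]_(x in D) (f_ n x)%:E)%E).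
rewrite /Rintegral fineK//; exact: integrable_fin_num.
Qed.

Lemma Rintegral_FTC (f F : R -> R) (a b : R) : a < b -> continuous f ->
  (forall x : R, is_derive x 1 F (f x)) ->
  \int[mu]_(x in `[a, b]) f x = F b - F a.
Proof.
move=> ab cf dF; rewrite /Rintegral.
have cF (x : R) : {for x, continuous F}.
  by apply/differentiable_continuous/derivable1_diffP; exact: ex_derive.
rewrite (@continuous_FTC2 _ _ F)//.
- exact: continuous_subspaceT.
- split => //.
  + by apply: cvg_at_right_filter; exact: cF.
  + by apply: cvg_at_left_filter; exact: cF.
- by move=> x _; rewrite derive1E; apply: derive_val.
Qed.

Lemma continuous_integrable (f : R -> R) (a b : R) : continuous f ->
  mu.-integrable `[a, b] (EFin \o f).
Proof.
move=> cf; apply: continuous_compact_integrable; first exact: segment_compact.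
exact: continuous_subspaceT.
Qed.

Local Open Scope ereal_scope.
Let muS : {sigma_finite_measure set (measurableTypeR R) -> \bar R} := mu.

Lemma Fubini_rect (A B : set R) (f : R * R -> R) : measurable A -> measurable B ->
  mu2.-integrable (A `*` B) (EFin \o f) ->
  \int[mu2]_(z in A `*` B) (f z)%:E =
  \int[mu]_(y in B) \int[mu]_(x in A) (f (x, y))%:E.
Proof.
move=> mA mB intf; rewrite integral_mkcond.
pose g := (EFin \o f) \_ (A `*` B).
have mAB : measurable (A `*` B) by exact: measurableX.
have ig : (@product_measure1 _ _ _ _ R muS muS).-integrable setT g.
  by apply/integrable_restrict => //; rewrite setTI.
have := @integral21_prod_meas1 _ _ _ _ R muS muS g ig.
rewrite /fubini_G => h; transitivity (\int[mu]_y \int[mu]_x g (x, y)); first by rewrite -h.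
rewrite [RHS]integral_mkcond; apply: eq_integral => y _; rewrite patchE.
case: ifPn => yB.
  rewrite [RHS]integral_mkcond; apply: eq_integral => x _.
  rewrite /g !patchE (_ : ((x, y) \in A `*` B) = (x \in A))//.
  by apply/idP/idP; rewrite !inE; [case|move=> xA; split => //; exact: set_mem].
apply: integral0_eq => x _; rewrite /g patchE; case: ifPn => //.
by rewrite inE => -[_ /= yB']; move: yB; rewrite notin_setE.
Qed.

End integration_tools.

(** * Polar change of variables on a quadrant *)

Section polar.
Variable R : realType.
Notation mu := (@lebesgue_measure R).
Notation mu2 := (@lebesgue2 R).
Notation halfline := (`]0%R, +oo[%classic : set R).
Local Open Scope ereal_scope.

Lemma integral_oneDsqrV :
  \int[mu]_(t in halfline) ((oneDsqr t)^-1)%:E = (pi / 2)%:E :> \bar R.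
Proof.
rewrite integral_itv_obnd_cbnd ?integral0y_oneDsqr//.
apply/measurable_EFinP; apply: measurable_funTS.
by apply: continuous_measurable_fun; exact: continuous_oneDsqrV.
Qed.

(** The slope replaces the angle: [y = x t], followed by [v = x sqrt(1 + t^2)] for fixed [t],
    separates the variables, and the factor in [t] integrates to [pi / 2]. Only linear substitutions
    on the line occur. *)
Lemma ge0_integral_polar (F : R -> \bar R) :
  measurable_fun setT F -> (forall s, 0 <= F s) ->
  \int[mu]_x \int[mu]_y ((\1_halfline x * \1_halfline y)%:E * F (x ^+ 2 + y ^+ 2)%R) =
  (pi / 2)%:E * \int[mu]_v ((\1_halfline v * v)%:E * F (v ^+ 2)%R).
Proof.
move=> mF F0.
have mH : measurable_fun setT (\1_halfline : R -> R) by exact: measurable_indic.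
have HE (x : R) : \1_halfline x = (0 < x)%R%:R :> R.
  by rewrite indicE mem_setE in_itv/= andbT.
have Hv0 (x : R) : (0 <= \1_halfline x * x)%R.
  by rewrite HE; case: ltP; rewrite ?mul0r// mul1r => /ltW.
transitivity (\int[mu]_x \int[mu]_t
    ((\1_halfline x * x * \1_halfline t)%:E * F (x ^+ 2 * (1 + t ^+ 2))%R)).
  apply: eq_integral => x _.
  case: (ltP 0%R x) => x0; last first.
    by rewrite !integral0_eq// => y _; rewrite HE ltNge x0 /= !mul0r mul0e.
  rewrite (ge0_integral_affine 0 x0); last 2 first.
  - apply: emeasurable_funM.
      by apply/measurable_EFinP; apply: measurable_funM => //; exact: measurable_cst.
    apply: measurableT_comp => //; apply: measurable_funD; first exact: measurable_cst.
    exact: measurable_funX.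
  - by move=> y; rewrite mule_ge0// lee_fin mulr_ge0.
  rewrite -ge0_integralZl_EFin//; last 3 first.
  - by move=> y _; rewrite mule_ge0// lee_fin mulr_ge0.
  - apply: emeasurable_funM.
      apply/measurable_EFinP; apply: measurable_funM; first exact: measurable_cst.
      by apply: measurableT_comp => //; exact: measurable_fun_affine.
    apply: measurableT_comp => //; apply: measurable_funD; first exact: measurable_cst.
    by apply: measurable_funX; exact: measurable_fun_affine.
  - exact: ltW.
  apply: eq_integral => t _.
  rewrite muleA -EFinM; congr (_%:E * F _).
    by rewrite addr0 !HE pmulr_rgt0// mulrCA mulrA.
  by rewrite addr0 exprMn; ring.
rewrite tonelli_lebesgue; last 2 first.
- apply: emeasurable_funM.
    apply/measurable_EFinP; apply: measurable_funM.
      by apply: measurable_funM => //; apply: measurableT_comp.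
    exact: measurableT_comp.
  apply: measurableT_comp => //; apply: measurable_funM.
    by apply: measurable_funX.
  by apply: measurable_funD; [exact: measurable_cst|apply: measurable_funX].
- by move=> x y; rewrite mule_ge0// lee_fin mulr_ge0.
set J := \int[mu]_v ((\1_halfline v * v)%:E * F (v ^+ 2)%R).
have mJ : measurable_fun setT (fun v : R => (\1_halfline v * v)%:E * F (v ^+ 2)%R).
  apply: emeasurable_funM.
    by apply/measurable_EFinP; exact: measurable_funM.
  by apply: measurableT_comp => //; exact: measurable_funX.
have J0 : 0 <= J by apply: integral_ge0 => v _; rewrite mule_ge0// lee_fin.
transitivity (\int[mu]_t ((\1_halfline t * (1 + t ^+ 2)^-1)%:E * J)).
  apply: eq_integral => t _.
  have t2 : (0 < 1 + t ^+ 2)%R by rewrite ltr_pwDl// sqr_ge0.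
  pose a := Num.sqrt (1 + t ^+ 2)%R.
  have a0 : (0 < a)%R by rewrite sqrtr_gt0.
  have a2 : (a ^+ 2 = 1 + t ^+ 2)%R by rewrite sqr_sqrtr// ltW.
  rewrite /J (ge0_integral_affine 0 a0 mJ); last by move=> v; rewrite mule_ge0// lee_fin.
  rewrite muleA -EFinM -ge0_integralZl_EFin//.
  - apply: eq_integral => x _; rewrite addr0 muleA -EFinM exprMn a2 [(_ * x ^+ 2)%R]mulrC.
    congr (_ * _); congr EFin; rewrite [in RHS]HE pmulr_rgt0// -HE -a2.
    by field; exact: lt0r_neq0.
  - by move=> v _; rewrite mule_ge0// lee_fin.
  - by apply: (measurableT_comp mJ); exact: measurable_fun_affine.
  - by rewrite !mulr_ge0 ?invr_ge0// ltW.
rewrite ge0_integralZr//; last 2 first.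
- apply/measurable_EFinP; apply: measurable_funM => //.
  by apply: continuous_measurable_fun; exact: continuous_oneDsqrV.
- by move=> t _; rewrite lee_fin mulr_ge0// invr_ge0 addr_ge0// sqr_ge0.
congr (_ * _); rewrite -integral_oneDsqrV [RHS]integral_indicM.
by apply: eq_integral => t _; rewrite EFinM.
Qed.

End polar.

(** * Euler's constant as a Gaussian integral *)

Section gamma_integral.
Variable R : realType.
Notation mu := (@lebesgue_measure R).
Notation halfline := (`]0%R, +oo[%classic : set R).

(** Radial density of [log |z|^2]: the factor [v] is the Jacobian, and it makes the function
    continuous at 0. *)
Definition xlnsqr (v : R) : R := v * ln (v ^+ 2).

Lemma norm_xlnsqr_le v : `|xlnsqr v| <= 2 + 2 * v ^+ 2.
Proof.
have [->|v0] := eqVneq v 0; first by rewrite /xlnsqr mul0r normr0 expr0n mulr0 addr0.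
have nv0 : 0 < `|v| by rewrite normr_gt0.
rewrite /xlnsqr normrM -(real_normK (num_real v)) lnXn// normrMn -mulr_natl.
move: `|v| nv0 => x x0.
have h1 : ln x < x by exact: ln_sublinear.
have h2 : - ln x < x^-1 by rewrite -lnV//; apply: ln_sublinear; rewrite invr_gt0.
have xx : x * x^-1 = 1 by rewrite mulfV// gt_eqF.
have [l0|l0] := leP 0 (ln x).
  by rewrite ger0_norm//; nra.
rewrite ltr0_norm//.
have : x * - ln x < 1 by rewrite -xx ltr_pM2l.
nra.
Qed.

(** A bound that vanishes at 0, obtained from [- ln y < 1 / y] at [y = sqrt |v|]. *)
Lemma norm_xlnsqr_le_sqrt v : `|v| <= 1 -> `|xlnsqr v| <= 4 * Num.sqrt `|v|.
Proof.
have [->|v0] := eqVneq v 0; first by rewrite /xlnsqr mul0r normr0 sqrtr0 mulr0.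
have nv0 : 0 < `|v| by rewrite normr_gt0.
rewrite /xlnsqr normrM -(real_normK (num_real v)) lnXn// normrMn.
move: `|v| nv0 => x x0 x1.
pose y := Num.sqrt x; have y0 : 0 < y by rewrite sqrtr_gt0.
have xy : x = y ^+ 2 by rewrite sqr_sqrtr// ltW.
rewrite -/y xy lnXn// normrMn.
have h2 : - ln y < y^-1 by rewrite -lnV//; apply: ln_sublinear; rewrite invr_gt0.
have yy : y * y^-1 = 1 by rewrite mulfV// gt_eqF.
have yle1 : y <= 1 by rewrite -sqrtr1 ler_sqrt.
rewrite ler0_norm ?ln_le0//.
have : y * - ln y <= 1 by rewrite -yy ler_pM2l// ltW.
move=> h; rewrite (_ : y ^+ 2 * _ = 4 * y * (y * - ln y)); last by ring.
by rewrite ler_piMr// mulr_ge0// ltW.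
Qed.

Lemma continuous_xlnsqr : continuous xlnsqr.
Proof.
move=> v; have [->|v0] := eqVneq v 0; last first.
  apply: cvgM; first exact: cvg_id.
  apply: (@continuous_comp _ _ _ (fun v : R => v ^+ 2) (@ln R)); first exact: exprn_continuous.
  by apply: continuous_ln; rewrite exprn_even_gt0.
suff h : xlnsqr w @[w --> (0 : R)] --> (0 : R).
  by rewrite /continuous_at [X in _ --> X](_ : _ = 0)// /xlnsqr mul0r.
have near0 (r : R) : 0 < r -> \forall w \near (0 : R), `|w| <= r.
  by move=> r0; apply: nbhs0_le.
apply/cvgrPdist_le => e e0.
near=> w; rewrite sub0r normrN; apply: (le_trans (norm_xlnsqr_le_sqrt _)).
  by near: w; apply: near0.
have : `|w| <= (e / 4) ^+ 2 by near: w; apply: near0; rewrite exprn_gt0// divr_gt0.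
rewrite -ler_sqrt ?sqr_ge0// sqrtr_sqr (@ger0_norm _ (e / 4)) ?divr_ge0 ?(ltW e0)//.
by rewrite ler_pdivlMr// mulrC.
Unshelve. all: by end_near. Qed.

(** With [W = 1 - c v^2], the function [(1 - W^(n+1)) ln v^2 + sum of W^(j+1) / (j+1)] is, for
    [v > 0], an antiderivative of [k] times the integrand: the derivative of the sum cancels the
    term in which the logarithm is differentiated. The constant 1 makes the coefficient of the
    logarithm vanish at 0, hence continuity there; the harmonic sum is the value of the second term
    at 0. *)
Lemma integral_xlnsqr_pow (c : R) (n : nat) : 0 < c ->
  \int[mu]_(v in `[0, (Num.sqrt c)^-1]) (xlnsqr v * (1 - c * v ^+ 2) ^+ n) =
  (- ln c - \sum_(j < n.+1) j.+1%:R^-1) / (2 * c * n.+1%:R).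
Proof.
move=> c0; set b := (Num.sqrt c)^-1.
have b0 : 0 < b by rewrite invr_gt0 sqrtr_gt0.
have b2 : c * b ^+ 2 = 1 by rewrite exprVn sqr_sqrtr ?ltW// mulfV// gt_eqF.
pose W : {poly R} := 1 - c *: 'X^2.
pose P1 : {poly R} := 1 - W ^+ n.+1.
pose P2 : {poly R} := \sum_(j < n.+1) j.+1%:R^-1 *: W ^+ j.+1.
have WE v : W.[v] = 1 - c * v ^+ 2 by rewrite /W !hornerE.
have dW v : W^`().[v] = - (2 * c * v).
  by rewrite /W derivB derivZ derivXn -polyC1 derivC hornerD hornerN horner0 hornerZ hornerMn hornerXn /= expr1 -mulr_natr; ring.
pose F : R -> R := (horner P1 * (@ln R \o horner 'X^2) + horner P2)%R.
pose k : R := (2 * c * n.+1%:R).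
pose f v := k * (xlnsqr v * (1 - c * v ^+ 2) ^+ n).
have P1E v : P1.[v] = c * v ^+ 2 * \sum_(j < n.+1) W.[v] ^+ j.
  rewrite /P1 hornerD hornerN horner_exp -polyC1 hornerC.
  rewrite -[X in X - _](expr1n _ n.+1) subrXX (_ : 1 - W.[v] = c * v ^+ 2); last by rewrite WE; ring.
  by congr (_ * _); apply: eq_bigr => j _; rewrite expr1n mul1r.
have dP1 v : P1^`().[v] = k * v * W.[v] ^+ n.
  rewrite /P1 derivB -polyC1 derivC deriv_exp hornerD hornerN horner0 hornerMn hornerM horner_exp dW /=.
  by rewrite -mulr_natr /k; ring.
have dP2 v : P2^`().[v] = - (2 * c * v) * \sum_(j < n.+1) W.[v] ^+ j.
  rewrite /P2 raddf_sum horner_sum mulr_sumr; apply: eq_bigr => j _ /=.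
  rewrite derivZ deriv_exp hornerZ hornerMn hornerM horner_exp dW -mulr_natr /=.
  by field; rewrite addrC natr1 pnatr_eq0.
have dF (v : R) : 0 < v -> is_derive v 1 F (f v).
  move=> v0; have v2 : 0 < ('X^2 : {poly R}).[v] by rewrite hornerXn exprn_gt0.
  have dl : is_derive v 1 (@ln R \o horner 'X^2) (('X^2 : {poly R}).[v]^-1 * ('X^2 : {poly R})^`().[v]).
    by apply: is_derive1_comp; exact: is_derive1_ln.
  apply: is_derive_eq.
  rewrite /= dP1 dP2 P1E derivXn hornerMn !hornerXn /= expr1.
  rewrite /f /xlnsqr -WE /GRing.scale /=.
  rewrite -mulr_natr; field; exact: lt0r_neq0.
pose S : {poly R} := \sum_(j < n.+1) W ^+ j.
have SE v : S.[v] = \sum_(j < n.+1) W.[v] ^+ j.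
  by rewrite /S horner_sum; apply: eq_bigr => j _; rewrite horner_exp.
have FE v : F v = ((c *: 'X) * S).[v] * xlnsqr v + P2.[v].
  by rewrite /F !fctE /= P1E hornerXn hornerM hornerZ hornerX SE /xlnsqr; ring.
have cp (p : {poly R}) : continuous (horner p) by exact: continuous_horner.
have cF : continuous F.
  rewrite (_ : F = fun v => ((c *: 'X) * S).[v] * xlnsqr v + P2.[v]); last exact/funext.
  by move=> v; apply: cvgD; [apply: cvgM; [exact: cp|exact: continuous_xlnsqr]|exact: cp].
have cg : continuous (fun v => xlnsqr v * (1 - c * v ^+ 2) ^+ n).
  rewrite (_ : (fun v => _) = fun v => xlnsqr v * (W ^+ n).[v]).
    by move=> v; apply: cvgM; [exact: continuous_xlnsqr|exact: cp].
  by apply/funext => v; rewrite horner_exp WE.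
have k0 : k != 0 by rewrite /k !mulf_neq0 ?pnatr_eq0// gt_eqF.
have fint : \int[mu]_(v in `[0, b]) f v = F b - F 0.
  rewrite /Rintegral (@continuous_FTC2 _ _ F)//.
  - apply: continuous_subspaceT => v.
    by apply: cvgM; [exact: cvg_cst|exact: cg].
  - split => //.
    + by move=> v; rewrite in_itv/= => /andP[v0 _]; have [] := dF v v0.
    + by apply: cvg_at_right_filter; exact: cF.
    + by apply: cvg_at_left_filter; exact: cF.
  - move=> v; rewrite in_itv/= => /andP[v0 _].
    by rewrite derive1E; have dv := dF v v0; apply: derive_val.
apply: (mulfI k0); rewrite [RHS]mulrC divfK//.
rewrite -RintegralZl//; last exact: continuous_integrable.
rewrite fint /F !fctE /= !hornerXn.
have Wb : W.[b] = 0 by rewrite WE b2 subrr.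
have W0 : W.[0] = 1 by rewrite WE expr0n mulr0 subr0.
rewrite P1E b2 mul1r big_ord_recl Wb expr0 big1 ?addr0; last by move=> j _; rewrite expr0n.
rewrite P1E expr0n /= mulr0 !mul0r mul1r.
have -> : P2.[b] = 0.
  by rewrite /P2 horner_sum big1// => j _; rewrite hornerZ horner_exp Wb expr0n mulr0.
have -> : P2.[0] = \sum_(j < n.+1) j.+1%:R^-1.
  by rewrite /P2 horner_sum; apply: eq_bigr => j _; rewrite hornerZ horner_exp W0 expr1n mulr1.
rewrite addr0 add0r; congr (_ - _).
by rewrite /b exprVn sqr_sqrtr ?(ltW c0)// lnV.
Qed.

Lemma bernoulli_pow (t : R) (m : nat) : 0 <= t <= 1 -> 1 - m%:R * t <= (1 - t) ^+ m.
Proof.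
move=> /andP[t0 t1]; elim: m => [|m IH]; first by rewrite mul0r subr0 expr0.
have m0 : 0 <= m%:R :> R by [].
rewrite exprS -natr1; apply: (@le_trans _ _ ((1 - t) * (1 - m%:R * t))).
  by move: (m%:R : R) m0 => k k0; nra.
by rewrite ler_wpM2l// subr_ge0.
Qed.

Lemma pow_le_expR (x : R) (m : nat) : (0 < m)%N ->
  Num.max 0 (1 - x / m%:R) ^+ m <= expR (- x).
Proof.
move=> m0; have mn0 : m%:R != 0 :> R by rewrite pnatr_eq0 -lt0n.
rewrite [in leRHS](_ : - x = (- (x / m%:R)) * m%:R); last by field.
rewrite expRM_natr; apply: lerXn2r; rewrite ?nnegrE ?expR_ge0 ?le_max ?lexx//.
by rewrite ge_max expR_ge0/= expR_ge1Dx.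
Qed.

(** The lower side of the squeeze raises [exp(- t) (1 - t^2) <= 1 - t], at [t = x / (n+1)], to the
    power [n+1] and concludes by Bernoulli's inequality. *)
Lemma cvg_pow_expR (x : R) : 0 <= x ->
  Num.max 0 (1 - x / n.+1%:R) ^+ n.+1 @[n --> \oo] --> expR (- x).
Proof.
move=> x0.
have h1 : expR (- x) * (1 - x ^+ 2 * n.+1%:R^-1) @[n --> \oo] --> expR (- x).
  rewrite [X in _ --> X](_ : _ = expR (- x) * (1 - x ^+ 2 * 0)); last by ring.
  apply: cvgM; first exact: cvg_cst.
  apply: cvgB; first exact: cvg_cst.
  by apply: cvgM; [exact: cvg_cst|exact: cvg_harmonic].
apply: (squeeze_cvgr _ h1 (@cvg_cst _ (expR (- x)) _ \oo _)).
near=> n; apply/andP; split; last exact: pow_le_expR.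
have n0 : 0 < n.+1%:R :> R by [].
have xn : x <= n.+1%:R.
  apply: (@le_trans _ _ n%:R); last by rewrite ler_nat.
  by near: n; exact: nbhs_infty_ger.
set m := n.+1; have mR0 : m%:R != 0 :> R by rewrite gt_eqF.
pose t := x / m%:R.
have t0 : 0 <= t by rewrite divr_ge0.
have t1 : t <= 1 by rewrite ler_pdivrMr// mul1r.
rewrite max_r ?subr_ge0//.
have e1 : expR (- t) * (1 - t ^+ 2) <= 1 - t.
  have := expR_ge1Dx t; rewrite expRN => e1t; rewrite ler_pdivrMl ?expR_gt0//.
  by nra.
apply: (@le_trans _ _ ((expR (- t) * (1 - t ^+ 2)) ^+ m)); last first.
  apply: lerXn2r => //; rewrite nnegrE ?subr_ge0//.
  by rewrite mulr_ge0 ?expR_ge0// subr_ge0 expr_le1.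
rewrite exprMn -expRM_natr (_ : - t * m%:R = - x); last by rewrite /t; field.
rewrite ler_wpM2l ?expR_ge0//.
have -> : x ^+ 2 / m%:R = m%:R * t ^+ 2 by rewrite /t; field.
by apply: bernoulli_pow; rewrite sqr_ge0/= expr_le1.
Unshelve. all: by end_near. Qed.

(** As [pi >= 2], the surplus decay [exp(- (pi - 1) v^2)] absorbs the factor [1 + v^2], leaving the
    integrable [gauss_fun]. *)
Lemma norm_xlnsqr_gauss1_le v : `|xlnsqr v| * gauss1 v <= 2 * gauss_fun v.
Proof.
have p2 : 2 <= pi :> R by exact: pi_ge2.
apply: (@le_trans _ _ ((2 + 2 * v ^+ 2) * gauss1 v)).
  by rewrite ler_wpM2r ?gauss1_ge0// norm_xlnsqr_le.
rewrite /gauss_fun /gauss1 (_ : - (pi * v ^+ 2) = - (v ^+ 2) + - ((pi - 1) * v ^+ 2)); last by ring.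
rewrite expRD (_ : _ * (_ * _) =
  2 * expR (- v ^+ 2) * ((1 + v ^+ 2) * expR (- ((pi - 1) * v ^+ 2)))); last by ring.
rewrite ler_piMr ?mulr_ge0 ?expR_ge0// expRN ler_pdivrMr ?expR_gt0// mul1r.
apply: (le_trans _ (expR_ge1Dx _)); rewrite lerD2l.
by rewrite ler_peMl ?sqr_ge0// lerBrDr.
Qed.

Lemma measurable_halfline : measurable halfline.
Proof. exact: measurable_itv. Qed.

(** The Gaussian is approximated from below by powers of [1 - pi v^2 / (n+1)], cut off at 0, for
    which [integral_xlnsqr_pow] produces a harmonic sum against a logarithm: the sequence defining
    Euler's constant is present before the limit. *)
Lemma euler_gamma_integral :
  mu.-integrable halfline (fun v => (xlnsqr v * gauss1 v)%:E) /\
  2 * pi * \int[mu]_(v in halfline) (xlnsqr v * gauss1 v) = - (euler_gamma R + ln pi).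
Proof.
pose f_ (n : nat) v := xlnsqr v * Num.max 0 (1 - pi * v ^+ 2 / n.+1%:R) ^+ n.+1.
have ig : mu.-integrable halfline (EFin \o (fun v => 2 * gauss_fun v)).
  apply: (@integrableS _ _ _ _ setT) => //.
  exact: (integrableZl measurableT 2 (@integrableT_gauss R)).
have mx : measurable_fun setT xlnsqr.
  by apply: continuous_measurable_fun; exact: continuous_xlnsqr.
have [||||int cv] := @dominated_Rintegral R _ _ mu halfline f_
    (fun v => xlnsqr v * gauss1 v) (fun v => 2 * gauss_fun v) measurable_halfline.
- move=> n; apply: measurable_funTS; apply: measurable_funM => //.
  apply: measurable_funX; apply: measurable_maxr; first exact: measurable_cst.
  apply: measurable_funB; first exact: measurable_cst.
  apply: measurable_funM; last exact: measurable_cst.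
  by apply: measurable_funM; [exact: measurable_cst|exact: measurable_funX].
- move=> v _; apply: cvgM; first exact: cvg_cst.
  by apply: cvg_pow_expR; rewrite mulr_ge0 ?sqr_ge0// pi_ge0.
- exact: ig.
- move=> n v _; apply: le_trans (norm_xlnsqr_gauss1_le v).
  rewrite normrM ler_wpM2l// ger0_norm ?exprn_ge0 ?le_max ?lexx//.
  exact: pow_le_expR.
split; first exact: int.
have pi0 : 0 < pi :> R by exact: pi_gt0.
have fint n : \int[mu]_(v in halfline) f_ n v =
    (- ln (pi / n.+1%:R) - \sum_(j < n.+2) j.+1%:R^-1) / (2 * (pi / n.+1%:R) * n.+2%:R).
  have c0 : 0 < pi / n.+1%:R :> R by rewrite divr_gt0.
  rewrite -(integral_xlnsqr_pow n.+1 c0) Rintegral_mkcond [RHS]Rintegral_mkcond.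
  set c := pi / n.+1%:R; set b := (Num.sqrt c)^-1.
  have b0 : 0 < b by rewrite invr_gt0 sqrtr_gt0.
  have b2 : c * b ^+ 2 = 1 by rewrite exprVn sqr_sqrtr ?(ltW c0)// mulfV// gt_eqF.
  apply: eq_Rintegral => v _; rewrite !patchE !mem_setE !in_itv/= andbT.
  rewrite /f_ (_ : pi * v ^+ 2 / n.+1%:R = c * v ^+ 2); last by rewrite /c mulrAC.
  have [v0|v0|<-] := ltgtP 0 v; rewrite /=.
  - case: (leP v b) => vb.
      by rewrite max_r// subr_ge0 -b2 ler_pM2l// lerXn2r// nnegrE ltW.
    rewrite max_l ?expr0n ?mulr0// subr_le0 -b2 ler_pM2l// lerXn2r// ?nnegrE ?ltW//.
  - by [].
  (* The open half-line omits 0 while the closed interval contains it; the integrand vanishes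
     there. *)
  - by rewrite (ltW b0) /xlnsqr !mul0r.
pose a := \int[mu]_(v in halfline) (xlnsqr v * gauss1 v).
have lim : (\sum_(1 <= k < n.+1) k%:R^-1 - ln n%:R : R) @[n --> \oo] --> - ln pi - 2 * pi * a.
  (* The closed form of the integrals, solved for the harmonic sum: [1 + harmonic n] is
     [(n+2) / (n+1)], and [harmonic n.+1] removes the last term [1 / (n+2)] of the longer sum. *)
  rewrite -cvg_shiftS [X in X @ _ --> _](_ : _ = fun n => - ln pi - harmonic n.+1 -
     2 * pi * ((1 + harmonic n) * \int[mu]_(v in halfline) f_ n v)).
    have c1 : (harmonic n.+1 : R) @[n --> \oo] --> (0 : R).
      by rewrite cvg_shiftS; exact: cvg_harmonic.
    have -> : - ln pi - 2 * pi * a = - ln pi - 0 - 2 * pi * ((1 + 0) * a) by ring.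
    apply: cvgB; first by apply: cvgB => //; exact: cvg_cst.
    apply: cvgM; first exact: cvg_cst.
    apply: cvgM; last exact: cv.
    by apply: cvgD; [exact: cvg_cst|exact: cvg_harmonic].
  apply/funext => n; rewrite fint /harmonic /=.
  have n1 : n.+1%:R != 0 :> R by rewrite pnatr_eq0.
  rewrite ln_div ?posrE// big_add1 /= big_mkord [in RHS]big_ord_recr /=.
  set H := \sum_(i < n.+1) _; set l := ln n.+1%:R; set lp := ln pi.
  have n2 : n.+2%:R != 0 :> R by rewrite pnatr_eq0.
  have nE : n.+2%:R = n.+1%:R + 1 :> R by rewrite natr1.
  move: n2; rewrite nE; move: (n.+1%:R : R) n1 => x x0 x1.
  have : pi != 0 :> R by rewrite gt_eqF.
  by move: (pi : R) => p p0; field; rewrite p0 x0 x1.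
by rewrite /euler_gamma (cvg_lim _ lim)// -/a; ring.
Qed.

End gamma_integral.

(** * Radial integrals over a quadrant *)

Section radial_integrals.
Variable R : realType.
Notation mu := (@lebesgue_measure R).
Notation mu2 := (@lebesgue2 R).
Notation halfline := (`]0%R, +oo[%classic : set R).
Notation quadrant := (halfline `*` halfline).

Lemma measurable_quadrant : measurable (quadrant : set (R * R)).
Proof. by apply: measurableX; exact: measurable_itv. Qed.

Lemma measurable_radius2 : measurable_fun setT (fun z : R * R => z.1 ^+ 2 + z.2 ^+ 2).
Proof. by apply: measurable_funD; apply: measurable_funX. Qed.

Lemma ge0_integral_radial (h : R -> R) : measurable_fun setT h -> (forall s, 0 <= h s) ->
  (\int[mu2]_(z in quadrant) (h (z.1 ^+ 2 + z.2 ^+ 2))%:E =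
  (pi / 2)%:E * \int[mu]_(v in halfline) (v * h (v ^+ 2))%:E)%E.
Proof.
move=> mh h0.
rewrite integral_indicM [in RHS]integral_indicM.
have mH : measurable_fun setT (\1_halfline : R -> R) by exact: measurable_indic.
have HE (z : R * R) : \1_quadrant z = \1_halfline z.1 * \1_halfline z.2 :> R.
  rewrite !indicE -natrM mulnb; congr (_%:R); congr nat_of_bool.
  by apply/idP/andP; rewrite !inE => -[].
have /(@ge0_integral_polar R) := (measurable_EFinP setT h).2 mh.
move=> /(_ (fun s => _)) pol; rewrite [LHS]ge0_integral_lebesgue2; last 2 first.
- apply: emeasurable_funM.
    by apply/measurable_EFinP/measurable_indic; exact: measurable_quadrant.
  by apply/measurable_EFinP; apply: measurableT_comp => //; exact: measurable_radius2.
- by move=> z; apply: mule_ge0; rewrite lee_fin.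
transitivity (\int[mu]_x \int[mu]_y ((\1_halfline x * \1_halfline y)%:E * (h (x ^+ 2 + y ^+ 2))%:E))%E.
  by apply: eq_integral => x _; apply: eq_integral => y _; rewrite HE.
rewrite pol => [|s]; last by rewrite lee_fin.
by congr (_ * _)%E; apply: eq_integral => v _; rewrite -!EFinM mulrA.
Qed.

Lemma Rintegral_radial (h : R -> R) : measurable_fun setT h ->
  mu.-integrable halfline (fun v => (v * h (v ^+ 2))%:E) ->
  mu2.-integrable quadrant (fun z => (h (z.1 ^+ 2 + z.2 ^+ 2))%:E) /\
  \int[mu2]_(z in quadrant) h (z.1 ^+ 2 + z.2 ^+ 2) =
  pi / 2 * \int[mu]_(v in halfline) (v * h (v ^+ 2)).
Proof.
move=> mh ih.
have mD := measurable_quadrant.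
have mhl : measurable halfline by exact: measurable_itv.
have pi2 : 0 <= pi / 2 :> R by rewrite divr_ge0// pi_ge0.
have mv (k : R -> R) : measurable_fun setT k -> measurable_fun halfline (fun v => v * k (v ^+ 2)).
  move=> mk; apply: measurable_funTS; apply: measurable_funM => //.
  by apply: measurableT_comp => //; exact: measurable_funX.
have ile (k : R -> R) : measurable_fun setT k -> (forall s, `|k s| <= `|h s|) ->
    mu.-integrable halfline (fun v => (v * k (v ^+ 2))%:E).
  move=> mk kh; apply: le_integrable ih => //; first by apply/measurable_EFinP; exact: mv.
  by move=> v _; rewrite /= lee_fin !normrM ler_wpM2l.
have i2 (k : R -> R) : measurable_fun setT k -> (forall s, 0 <= k s) -> (forall s, `|k s| <= `|h s|) ->
    mu2.-integrable quadrant (fun z => (k (z.1 ^+ 2 + z.2 ^+ 2))%:E) /\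
  \int[mu2]_(z in quadrant) k (z.1 ^+ 2 + z.2 ^+ 2) =
  pi / 2 * \int[mu]_(v in halfline) (v * k (v ^+ 2)).
  move=> mk k0 kh.
  have fin : (\int[mu]_(v in halfline) (v * k (v ^+ 2))%:E)%E \is a fin_num.
    by apply: integrable_fin_num => //; exact: ile.
  split.
    apply/integrableP; split.
      apply/measurable_EFinP; apply: measurable_funTS.
      by apply: measurableT_comp => //; exact: measurable_radius2.
    under eq_integral do rewrite /= ger0_norm//.
    rewrite ge0_integral_radial// lte_mul_pinfty//.
    by rewrite ltey_eq fin.
  rewrite /Rintegral ge0_integral_radial// fineM//.
have hB s : h s = h^\+%R s - h^\-%R s by rewrite -[in LHS](funrposBneg h).
have hp_le s : `|h^\+%R s| <= `|h s|.
  rewrite ger0_norm ?funrpos_ge0//.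
  by rewrite /funrpos ge_max ler_norm normr_ge0.
have hm_le s : `|h^\-%R s| <= `|h s|.
  rewrite ger0_norm ?funrneg_ge0//.
  by rewrite /funrneg ge_max -normrN ler_norm normr_ge0.
have mp : measurable_fun setT h^\+%R by exact: measurable_funrpos.
have mm : measurable_fun setT h^\-%R by exact: measurable_funrneg.
have [ip Ep] := i2 _ mp (fun s => funrpos_ge0 h s) hp_le.
have [im Em] := i2 _ mm (fun s => funrneg_ge0 h s) hm_le.
have e2 : (fun z : R * R => (h (z.1 ^+ 2 + z.2 ^+ 2))%:E) =
    (fun z => (h^\+%R (z.1 ^+ 2 + z.2 ^+ 2))%:E - (h^\-%R (z.1 ^+ 2 + z.2 ^+ 2))%:E)%E.
  by apply/funext => z; rewrite -EFinB -hB.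
split; first by rewrite e2; exact: integrableB.
transitivity (\int[mu2]_(z in quadrant) (h^\+%R (z.1 ^+ 2 + z.2 ^+ 2) - h^\-%R (z.1 ^+ 2 + z.2 ^+ 2))).
  by apply: eq_Rintegral => z _; rewrite hB.
rewrite RintegralB// Ep Em -mulrBr; congr (_ * _).
rewrite -RintegralB//; [|exact: ile|exact: ile].
by apply: eq_Rintegral => v _; rewrite -mulrBr -hB.
Qed.

Definition gauss2 (z : R * R) : R := gauss1 z.1 * gauss1 z.2.

Lemma gauss2E (z : R * R) : gauss2 z = expR (- (pi * (z.1 ^+ 2 + z.2 ^+ 2))).
Proof. by rewrite /gauss2 /gauss1 -expRD; congr expR; ring. Qed.

Let measurable_radial_gauss (k : R -> R) : measurable_fun setT k ->
  measurable_fun setT (fun s => k s * expR (- (pi * s))).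
Proof.
move=> mk; apply: measurable_funM => //; apply: measurableT_comp => //.
by apply: measurableT_comp => //; apply: measurable_funM => //; exact: measurable_cst.
Qed.

(** From [1 + v^2 / 2 <= exp(v^2 / 2)] one gets [(1 + v^2)^2 <= 4 exp(v^2)], and [pi - 1 >= 1]
    provides that much decay. *)
Lemma gauss1_majorant (v : R) : (1 + v ^+ 2) ^+ 2 * gauss1 v <= 4 * gauss_fun v.
Proof.
have p2 : 2 <= pi :> R by exact: pi_ge2.
rewrite /gauss_fun /gauss1 (_ : - (pi * v ^+ 2) = - (v ^+ 2) + - ((pi - 1) * v ^+ 2)); last by ring.
rewrite expRD mulrCA [leRHS]mulrC ler_wpM2l ?expR_ge0//.
rewrite expRN ler_pdivrMr ?expR_gt0//.
have v20 := sqr_ge0 v.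
apply: (@le_trans _ _ (4 * expR (v ^+ 2))); last first.
  by rewrite ler_pM2l// ler_expR ler_peMl// lerBrDr.
have -> : v ^+ 2 = v ^+ 2 / 2 + v ^+ 2 / 2 by field.
rewrite expRD; have h := expR_ge1Dx (v ^+ 2 / 2).
have h0 : 0 <= v ^+ 2 / 2 by rewrite divr_ge0.
by move: (expR _) h => e h; move: (v ^+ 2 / 2) h0 h => x x0 h; nra.
Qed.

Let radial_majorant_integrable :
  mu.-integrable halfline (fun v => (v * ((1 + `|ln (v ^+ 2)| + v ^+ 2) * expR (- (pi * v ^+ 2))))%:E).
Proof.
apply: (@le_integrable _ _ _ mu halfline (measurable_itv _) _ (fun v => (16 * gauss_fun v)%:E)).
- apply/measurable_EFinP; apply: measurable_funTS.
  apply: measurable_funM => //.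
  apply: (@measurableT_comp _ _ _ _ _ _ (fun s => (1 + `|ln s| + s) * expR (- (pi * s)))); last exact: measurable_funX.
  apply: measurable_radial_gauss; apply: measurable_funD => //.
  apply: measurable_funD; first exact: measurable_cst.
  by apply: measurableT_comp => //; exact: measurable_ln.
- move=> v; rewrite /= in_itv/= andbT => v0; rewrite lee_fin.
  rewrite [leRHS]ger0_norm ?mulr_ge0 ?gauss_fun_ge0// ger0_norm; last first.
    by rewrite !mulr_ge0 ?addr_ge0 ?sqr_ge0 ?expR_ge0// ltW.
  rewrite mulrA -[expR _]/(gauss1 v).
  apply: (@le_trans _ _ (4 * ((1 + v ^+ 2) ^+ 2 * gauss1 v))); last first.
    have := gauss1_majorant v; move: (_ * gauss1 v) (gauss_fun v) => x y; lra.
  rewrite mulrA ler_wpM2r ?gauss1_ge0//.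
  have := norm_xlnsqr_le v; rewrite /xlnsqr normrM (gtr0_norm v0).
  rewrite !mulrDr mulr1; move: (v * `|_|) => x h; nra.
- apply: (@integrableS _ _ _ _ setT) => //.
  exact: (integrableZl measurableT 16 (@integrableT_gauss R)).
Qed.

(** One majorant for all later dominations: it controls the Green function at its logarithmic
    singularity and all energy densities at once. *)
Lemma integrable_log_gauss2_majorant :
  mu2.-integrable quadrant (fun z => ((1 + `|ln (z.1 ^+ 2 + z.2 ^+ 2)| +
    (z.1 ^+ 2 + z.2 ^+ 2)) * gauss2 z)%:E).
Proof.
have mh : measurable_fun setT (fun s : R => (1 + `|ln s| + s) * expR (- (pi * s))).
  apply: measurable_radial_gauss; apply: measurable_funD => //.
  apply: measurable_funD; first exact: measurable_cst.
  by apply: measurableT_comp => //; exact: measurable_ln.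
have [+ _] := Rintegral_radial mh radial_majorant_integrable.
by apply: eq_integrable => // [|z _]; [exact: measurable_quadrant|rewrite gauss2E].
Qed.

(** This value later allows the additive constant of W_N to be written as an integral over the
    quadrant. *)
Lemma integral_gauss2 : \int[mu2]_(z in quadrant) gauss2 z = 4^-1.
Proof.
have mh : measurable_fun setT (fun s : R => 1 * expR (- (pi * s))).
  by apply: measurable_radial_gauss; exact: measurable_cst.
have pi0 : 0 < pi :> R by exact: pi_gt0.
have ih : mu.-integrable halfline (fun v : R => (v * (1 * expR (- (pi * v ^+ 2))))%:E).
  apply: le_integrable radial_majorant_integrable => //.
    apply/measurable_EFinP; apply: measurable_funTS; apply: measurable_funM => //.
    by apply: (measurableT_comp mh); exact: measurable_funX.
  move=> v _; rewrite /= lee_fin !normrM !ler_wpM2l// ler_wpM2r//.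
  rewrite normr1; apply: (le_trans _ (ler_norm _)).
  by rewrite -addrA lerDl addr_ge0 ?sqr_ge0.
have [_ E] := Rintegral_radial mh ih.
transitivity (\int[mu2]_(z in quadrant) (1 * expR (- (pi * (z.1 ^+ 2 + z.2 ^+ 2))))).
  by apply: eq_Rintegral => z _; rewrite gauss2E mul1r.
have dgauss (v : R) : is_derive v 1 (fun v => - (2 * pi)^-1 * gauss1 v) (v * gauss1 v).
  pose p : {poly R} := - (pi *: 'X^2).
  have dp : is_derive v 1 (- (2 * pi)^-1 *: (expR \o horner p)) (- (2 * pi)^-1 *: (expR p.[v] * p^`().[v])).
    by apply: is_deriveZ; apply: is_derive1_comp.
  have pE x : p.[x] = - (pi * x ^+ 2) by rewrite /p hornerN hornerZ hornerXn.
  have e1 : (fun v => - (2 * pi)^-1 * gauss1 v) = - (2 * pi)^-1 *: (expR \o horner p).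
    by apply/funext => x; rewrite /gauss1 -pE.
  have dpE x : p^`().[x] = - (pi * (x *+ 2)).
    by rewrite /p derivN derivZ derivXn hornerN hornerZ hornerMn hornerXn.
  rewrite e1; apply: is_derive_eq; rewrite /GRing.scale /= pE dpE /gauss1.
  have : pi != 0 :> R by rewrite gt_eqF.
  by rewrite -mulr_natr; move: (expR _) => e; move: (pi : R) => q q0; field.
rewrite E Rintegral_itv_obnd_cbnd; last exact: ih.
rewrite (@Rintegral_ge0_continuous_FTC2y _ _ (fun v => - (2 * pi)^-1 * gauss1 v) _ 0).
- rewrite /gauss1 expr0n mulr0 oppr0 expR0; have : pi != 0 :> R by rewrite gt_eqF.
  by move: (pi : R) => p p0; field.
- by move=> v v0; rewrite !mulr_ge0 ?expR_ge0.
- apply: continuous_subspaceT => v; apply: cvgM; first exact: cvg_id.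
  by apply: cvgM; [exact: cvg_cst|exact: continuous_gauss1].
- rewrite -[X in _ --> X](mulr0 (- (2 * pi)^-1)); apply: cvgM; first exact: cvg_cst.
  have h (v : R) : 0 <= gauss1 v <= gauss_fun v.
    rewrite gauss1_ge0 /gauss1 /gauss_fun ler_expR lerN2 ler_peMl ?sqr_ge0//.
    by have := @pi_ge2 R; lra.
  apply: (@squeeze_cvgr _ _ _ _ (cst 0) gauss_fun); first exact: nearW.
  + exact: cvg_cst.
  + exact: cvg_gauss_fun.
- by move=> v _; have [] := dgauss v.
- apply: cvg_at_right_filter; apply: cvgM; first exact: cvg_cst.
  exact: continuous_gauss1.
- move=> v _; rewrite derive1E; have dv := dgauss v.
  by rewrite (@derive_val _ _ _ _ _ _ _ dv) mul1r.
Qed.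

(** The leading 2 and the polar factor [pi / 2], against the [2 pi] of Euler's integral, leave the
    factor [1 / 2]. *)
Lemma integral_log_gauss2 :
  2 * \int[mu2]_(z in quadrant) (ln (z.1 ^+ 2 + z.2 ^+ 2) * gauss2 z) =
  - (1 / 2) * (euler_gamma R + ln pi).
Proof.
have mh : measurable_fun setT (fun s : R => ln s * expR (- (pi * s))).
  by apply: measurable_radial_gauss; exact: measurable_ln.
have [ig E] := euler_gamma_integral R.
have ih : mu.-integrable halfline (fun v : R => (v * (ln (v ^+ 2) * expR (- (pi * v ^+ 2))))%:E).
  by apply: eq_integrable ig => // v _; rewrite /xlnsqr mulrA.
have [_ E2] := Rintegral_radial mh ih.
transitivity (2 * \int[mu2]_(z in quadrant) (ln (z.1 ^+ 2 + z.2 ^+ 2) * expR (- (pi * (z.1 ^+ 2 + z.2 ^+ 2))))).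
  by congr (_ * _); apply: eq_Rintegral => z _; rewrite gauss2E.
rewrite E2 (_ : - (1 / 2) * _ = 2^-1 * - (euler_gamma R + ln pi)); last by field.
rewrite -E; transitivity (2 * (pi / 2 * \int[mu]_(v in halfline) (xlnsqr v * gauss1 v))).
  by do 2 congr (_ * _); apply: eq_Rintegral => v _; rewrite /xlnsqr mulrA.
by field.
Qed.

End radial_integrals.

(** * The Green function of the square torus *)

Section green_tail.
Variable R : realType.

(* |exp(2 i pi tau)| at tau = i. *)
Definition nome : R := expR (- (2 * pi)).

(** With [q] the nome, this is [ln |1 - q^(k+1) a e^(it)|^2], the contribution of one factor of
    Jacobi's product for the theta function; [a] will be [e^s] or [e^(-s)]. *)
Definition tail_term (a t : R) (k : nat) : R := log_quad (nome ^+ k.+1 * a) (cos t).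

Definition green_tail (a t : R) : R := limn (series (tail_term a t)).

Lemma nome_gt0 : 0 < nome. Proof. exact: expR_gt0. Qed.

Lemma nome_le : nome <= 1 / 5.
Proof.
rewrite /nome expRN -[1 / 5]invrK lef_pV2 ?posrE ?expR_gt0// div1r invrK.
have := @pi_ge2 R; have := expR_ge1Dx (2 * pi : R); lra.
Qed.

Lemma expRNpi_le : expR (- pi) <= 1 / 3 :> R.
Proof.
rewrite expRN -[1 / 3]invrK lef_pV2 ?posrE ?expR_gt0// div1r invrK.
have := @pi_ge2 R; have := expR_ge1Dx (pi : R); lra.
Qed.

Lemma one_le_expRpi : 0 <= (1 : R) <= expR (pi : R).
Proof.
by rewrite ler01 (le_trans _ (expR_ge1Dx _))// lerDl pi_ge0.
Qed.

(** The extreme value [a = e^pi] is the half-period, where [q a = e^(-pi) <= 1/3]; each further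
    factor [q] is below [1/2]. All radii thus stay away from 1, with geometric decay. *)
Lemma nome_radius (a : R) (k : nat) : 0 <= a <= expR pi ->
  0 <= nome ^+ k.+1 * a <= 1 / 3 * 2^-1 ^+ k.
Proof.
move=> /andP[a0 a1]; have n0 := nome_gt0.
rewrite mulr_ge0 ?exprn_ge0 ?(ltW n0)//= exprSr -mulrA mulrC ler_pM//.
- by rewrite mulr_ge0// ltW.
- by rewrite exprn_ge0// ltW.
- apply: le_trans expRNpi_le; apply: (@le_trans _ _ (nome * expR pi)).
    by rewrite ler_pM2l.
  by rewrite /nome -expRD ler_expR; lra.
- apply: lerXn2r; rewrite ?nnegrE ?(ltW n0)//.
  by apply: (le_trans nome_le); lra.
Qed.

(** The case [M = 0] of [log_quad_series], where [4 / (1 - r)^2 <= 9]. *)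
Lemma norm_log_quad_le (r t : R) : 0 <= r <= 1 / 3 -> `|log_quad r (cos t)| <= 9 * r.
Proof.
move=> /andP[r0 r1]; have r01 : 0 <= r < 1 by rewrite r0; lra.
have := log_quad_series t 0 r01; rewrite big_ord0 mulr0 addr0 expr1 => /le_trans; apply.
rewrite ler_pdivrMr; last by rewrite exprn_gt0// subr_gt0; lra.
have h : 4 <= 9 * (1 - r) ^+ 2 by nra.
by rewrite mulrAC ler_wpM2r.
Qed.

Lemma norm_tail_term_le (a t : R) (k : nat) : 0 <= a <= expR pi ->
  `|tail_term a t k| <= 3 * 2^-1 ^+ k.
Proof.
move=> /(nome_radius k)/andP[r0 r1].
have h : 2^-1 ^+ k <= 1 :> R by rewrite exprn_ile1// invf_le1// ler1n.
apply: (le_trans (norm_log_quad_le t _)); first by rewrite r0/=; lra.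
lra.
Qed.

Lemma sum_half_pow (K : nat) : \sum_(0 <= k < K) 2^-1 ^+ k <= 2 :> R.
Proof.
have -> : \sum_(0 <= k < K) 2^-1 ^+ k = 2 * (1 - 2^-1 ^+ K) :> R.
  elim: K => [|K IH]; first by rewrite big_geq// expr0 subrr mulr0.
  by rewrite big_nat_recr//= IH exprS; field.
have : 0 <= 2^-1 ^+ K :> R by rewrite exprn_ge0.
lra.
Qed.

Lemma is_cvg_green_tail (a t : R) : 0 <= a <= expR pi -> cvgn (series (tail_term a t)).
Proof.
move=> a01; apply: normed_cvg.
apply: (@series_le_cvg _ _ (geometric 3 2^-1)).
- by move=> k; exact: normr_ge0.
- by move=> k; apply: geometric_ge0.
- by move=> k; exact: norm_tail_term_le.
- by apply: is_cvg_geometric_series; rewrite ger0_norm// invf_lt1// ltr1n.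
Qed.

Lemma norm_series_tail_le (a t : R) (K : nat) : 0 <= a <= expR pi ->
  `|series (tail_term a t) K| <= 6.
Proof.
move=> a01; apply: (le_trans (ler_norm_sum _ _ _)).
apply: (@le_trans _ _ (\sum_(0 <= k < K) 3 * 2^-1 ^+ k)).
  by apply: ler_sum => k _; exact: norm_tail_term_le.
rewrite -mulr_sumr; have := sum_half_pow K; lra.
Qed.

Lemma norm_green_tail_le (a t : R) : 0 <= a <= expR pi -> `|green_tail a t| <= 6.
Proof.
move=> a01; have cv := @is_cvg_green_tail a t a01.
apply: (cvgr_to_le (cvg_norm cv)); apply: nearW => K.
exact: norm_series_tail_le.
Qed.

Lemma norm_ln_sub_le (x y c : R) : 0 < c -> c <= x -> c <= y ->
  `|ln x - ln y| <= `|x - y| / c.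
Proof.
move=> c0; wlog yx : x y / y <= x => [hw|] cx cy.
  have [yx|/ltW xy] := leP y x; first exact: hw.
  by rewrite distrC [`|x - y|]distrC; exact: hw.
have x0 := lt_le_trans c0 cx; have y0 := lt_le_trans c0 cy.
rewrite [X in _ <= X / _]ger0_norm ?subr_ge0// ger0_norm ?subr_ge0 ?ler_ln ?posrE//.
rewrite -ln_div ?posrE//.
have -> : x / y = 1 + (x - y) / y by field; exact: lt0r_neq0.
have h0 : 0 <= (x - y) / y by rewrite divr_ge0 ?subr_ge0// ltW.
apply: (le_trans (le_ln1Dx _)); first by apply: lt_le_trans h0.
by rewrite ler_wpM2l ?subr_ge0// lef_pV2 ?posrE.
Qed.

(** Both logarithms are taken at points at least [(1 - 1/3)^2 = 4/9], where [ln] is Lipschitz, and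
    the difference of these points carries the geometric factor. Summed over [k], this is the
    continuity of [green_tail] at [(1, 0)]. *)
Lemma tail_term_sub_le (a t : R) (k : nat) : 0 <= a <= expR pi ->
  `|tail_term a t k - tail_term 1 0 k| <=
  3 * (2 * `|a * cos t - 1| + `|a ^+ 2 - 1|) * 2^-1 ^+ k.
Proof.
move=> a01; rewrite /tail_term /log_quad cos0.
have e1 := one_le_expRpi.
have /andP[r0 r1] := nome_radius k a01; have /andP[s0 s1] := nome_radius k e1.
have hk : 2^-1 ^+ k <= 1 :> R by rewrite exprn_ile1// invf_le1// ler1n.
have hk0 : 0 <= 2^-1 ^+ k :> R by rewrite exprn_ge0.
have D (r c : R) : 0 <= r <= 1 / 3 -> `|c| <= 1 -> 4 / 9 <= 1 - 2 * r * c + r ^+ 2.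
  by move=> /andP[? ?] c1; apply: le_trans (quad_ge _ c1) => //; nra.
apply: (le_trans (norm_ln_sub_le (c := 4 / 9) _ _ _)) => //.
- by apply: D; [rewrite r0/=; lra|exact: cos_max].
- by apply: D; [rewrite s0/=; lra|rewrite normr1].
move: s0 s1; rewrite !mulr1; set q := nome ^+ k.+1 => s0 s1.
rewrite (_ : 1 - _ + _ - _ = - (2 * q * (a * cos t - 1)) + q ^+ 2 * (a ^+ 2 - 1)); last by ring.
apply: (@le_trans _ _ ((2 * q * `|a * cos t - 1| + q ^+ 2 * `|a ^+ 2 - 1|) / (4 / 9))).
  rewrite ler_wpM2r// (le_trans (ler_normD _ _))// normrN !normrM.
  by rewrite (ger0_norm s0) normr_nat expr2.
rewrite ler_pdivrMr//.
move: `|_| (normr_ge0 (a * cos t - 1)) `|_| (normr_ge0 (a ^+ 2 - 1)) => u u0 v v0.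
move: (2^-1 ^+ k) hk hk0 s1 => e e1' e0 qe.
have h1 : q * u <= 1 / 3 * e * u by rewrite ler_wpM2r.
have h2 : q ^+ 2 * v <= 1 / 3 * e * v.
  by rewrite ler_wpM2r// expr2; nra.
have eu : 0 <= e * u by rewrite mulr_ge0.
have ev : 0 <= e * v by rewrite mulr_ge0.
have -> : 3 * (2 * u + v) * e * (4 / 9) = 4 / 3 * (2 * (e * u) + e * v) by field.
lra.
Qed.

Lemma green_tail_sub_le (a t : R) : 0 <= a <= expR pi ->
  `|green_tail a t - green_tail 1 0| <= 6 * (2 * `|a * cos t - 1| + `|a ^+ 2 - 1|).
Proof.
move=> a01; have cv := @is_cvg_green_tail a t a01.
have e1 := one_le_expRpi.
have cv1 := @is_cvg_green_tail 1 0 e1.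
apply: (cvgr_to_le (cvg_norm (cvgB cv cv1))); apply: nearW => K.
set d := 2 * _ + _; have d0 : 0 <= d by rewrite addr_ge0// mulr_ge0.
rewrite fctE /series /= -sumrB; apply: (le_trans (ler_norm_sum _ _ _)).
apply: (@le_trans _ _ (\sum_(0 <= k < K) 3 * d * 2^-1 ^+ k)).
  by apply: ler_sum => k _; exact: tail_term_sub_le.
by rewrite -mulr_sumr; have := sum_half_pow K; nra.
Qed.

End green_tail.

Section green_function.
Variable R : realType.

(* Kronecker's limit formula for the square torus of side 2 pi, in the real
   coordinates (t, s). *)
Definition green (t s : R) : R :=
  s ^+ 2 / 2 - pi * s + pi ^+ 2 / 3 -
  pi * (log_quad (expR (- s)) (cos t) + green_tail (expR (- s)) t + green_tail (expR s) t).

(* The value of green t s + pi ln (t^2 + s^2) at the origin. *)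
Definition green0 : R := pi ^+ 2 / 3 - pi * (green_tail 1 0 + green_tail 1 0).

Lemma norm_sin_le (u : R) : 0 <= u -> `|sin u| <= u.
Proof.
move=> u0.
have [|c] := @MVT_segment R (@sin R) (@cos R) 0 u u0.
  by apply: continuous_subspaceT; exact: continuous_sin.
rewrite sin0 !subr0 => _ ->; rewrite normrM (ger0_norm u0) ler_piMl//.
exact: cos_max.
Qed.

(** The derivative of [sin u - u cos u] is [u sin u], nonnegative up to [pi]. *)
Lemma mul_cos_le_sin (u : R) : 0 <= u <= pi -> u * cos u <= sin u.
Proof.
move=> /andP[u0 upi].
pose f : R -> R := (@sin R) - (id * (@cos R)).
have df (x : R) : is_derive x 1 f (x * sin x).
  apply: is_derive_eq; rewrite /GRing.scale /=; ring.
have [|c] := @MVT_segment R f (fun x => x * sin x) 0 u u0.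
  by apply: derivable_within_continuous => x _; have [] := df x.
rewrite in_itv/= => /andP[c0 cu].
rewrite /f !fctE sin0 mul0r !subr0 => h; rewrite -subr_ge0 h mulr_ge0// mulr_ge0//.
by apply: sin_ge0_pi; rewrite c0 (le_trans cu).
Qed.

Lemma one_sub_cos (t : R) : 1 - cos t = 2 * sin (t / 2) ^+ 2.
Proof.
have {1}-> : t = (t / 2) *+ 2 by rewrite -mulr_natr; field.
by rewrite cos_mulr2n cos2sin2 -[_ *+ 2]mulr_natr; ring.
Qed.

Lemma quad_expE (r c : R) : 1 - 2 * r * c + r ^+ 2 = (1 - r) ^+ 2 + 2 * r * (1 - c).
Proof. by ring. Qed.

Lemma quad_exp_le (t s : R) : 0 <= t -> 0 <= s ->
  1 - 2 * expR (- s) * cos t + expR (- s) ^+ 2 <= t ^+ 2 + s ^+ 2.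
Proof.
move=> t0 s0; rewrite quad_expE one_sub_cos addrC.
have r0 : 0 < expR (- s) by exact: expR_gt0.
have r1 : expR (- s) <= 1 by rewrite -expR0 ler_expR oppr_le0.
have h1 : 1 - expR (- s) <= s by have := expR_ge1Dx (- s); lra.
apply: lerD; last by apply: lerXn2r; rewrite ?nnegrE// subr_ge0.
have h2 : sin (t / 2) ^+ 2 <= (t / 2) ^+ 2.
  rewrite -[leLHS]real_normK ?num_real//.
  by apply: lerXn2r; rewrite ?nnegrE ?divr_ge0// norm_sin_le// divr_ge0.
have s20 := sqr_ge0 (sin (t / 2)).
have -> : t ^+ 2 = 4 * (t / 2) ^+ 2 by field.
by move: (_ ^+ 2) (_ ^+ 2) h2 s20 => x y; nra.
Qed.

(** The right side is [|1 - exp(- s + i t)|^2]. The parameter [k] measures the loss in replacing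
    [2 (1 - cos t)] by [t^2]: a constant serves for the uniform bound, a value tending to 1 for the
    limit at the origin. *)
Lemma quad_exp_ge (t s k : R) : 0 <= s -> 0 <= k <= 1 -> k * t ^+ 2 <= 2 * (1 - cos t) ->
  expR (- s) ^+ 2 * k * (t ^+ 2 + s ^+ 2) <=
  1 - 2 * expR (- s) * cos t + expR (- s) ^+ 2.
Proof.
move=> s0 /andP[k0 k1] kt; rewrite quad_expE.
have r0 : 0 < expR (- s) by exact: expR_gt0.
have r1 : expR (- s) <= 1 by rewrite -expR0 ler_expR oppr_le0.
have h1 : expR (- s) * s <= 1 - expR (- s).
  have e := expR_ge1Dx s; have : expR (- s) * expR s = 1 by rewrite -expRD addNr expR0.
  by nra.
set r := expR (- s) in r0 r1 h1 *.
have rs0 : 0 <= r * s by rewrite mulr_ge0// ltW.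
have h2 : (r * s) ^+ 2 <= (1 - r) ^+ 2.
  by apply: lerXn2r; rewrite ?nnegrE// subr_ge0.
have h3 : r ^+ 2 * k * s ^+ 2 <= (r * s) ^+ 2.
  by rewrite exprMn mulrAC ler_piMr// mulr_ge0 ?sqr_ge0.
have h4 : r ^+ 2 * k * t ^+ 2 <= 2 * r * (1 - cos t).
  rewrite -mulrA [leRHS](_ : _ = r * (2 * (1 - cos t))); last by ring.
  apply: ler_pM => //; [exact: sqr_ge0|by apply: mulr_ge0 => //; exact: sqr_ge0|].
  by rewrite expr2 ler_piMr// ltW.
rewrite mulrDr addrC; apply: lerD => //; exact: le_trans h2.
Qed.

(** Up to [pi / 2] one has [cos(t/2)^2 >= 1/2]; beyond, [cos t <= 0] while [t^2 <= 16]. *)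
Lemma cos_quad_ge (t : R) : 0 <= t <= pi -> 8^-1 * t ^+ 2 <= 2 * (1 - cos t).
Proof.
move=> /andP[t0 tpi].
have pi4 : pi <= 4 :> R by have := @pihalf_lt2 R; lra.
have [th|th] := leP t (pi / 2).
  have ct : 0 <= cos t by rewrite cos_ge0_pihalf// th andbT; have := @pi_ge0 R; lra.
  have c2 : 1 / 2 <= cos (t / 2) ^+ 2.
    have : cos t = cos (t / 2) ^+ 2 *+ 2 - 1.
      by rewrite -cos_mulr2n -mulr_natr; congr cos; field.
    rewrite -mulr_natr; lra.
  rewrite one_sub_cos.
  have t2 : 0 <= t / 2 by rewrite divr_ge0.
  have h : t / 2 * cos (t / 2) <= sin (t / 2).
    by apply: mul_cos_le_sin; rewrite t2/=; have := @pi_ge0 R; lra.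
  have c0 : 0 <= cos (t / 2) by rewrite cos_ge0_pihalf//; have := @pi_ge0 R; lra.
  have h2 : (t / 2 * cos (t / 2)) ^+ 2 <= sin (t / 2) ^+ 2.
    by apply: lerXn2r; rewrite ?nnegrE ?mulr_ge0// (le_trans _ h)// mulr_ge0.
  rewrite exprMn in h2; have -> : t ^+ 2 = 4 * (t / 2) ^+ 2 by field.
  have := ler_wpM2l (sqr_ge0 (t / 2)) c2.
  have := sqr_ge0 (t / 2); lra.
have ct : cos t <= 0.
  rewrite -[t](subrK (pi / 2)) cosDpihalf oppr_le0 sin_ge0_pi//.
  by have := @pi_ge0 R; lra.
have : t ^+ 2 <= 16 by nra.
nra.
Qed.

(** The difference of logarithms is nonpositive by [quad_exp_le] and at least [ln (exp(- 2 s) k)] by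
    [quad_exp_ge]. *)
Lemma log_quad_exp_le (t s k : R) : 0 < t -> 0 <= s -> 0 < k <= 1 ->
  k * t ^+ 2 <= 2 * (1 - cos t) ->
  `|log_quad (expR (- s)) (cos t) - ln (t ^+ 2 + s ^+ 2)| <= 2 * s - ln k.
Proof.
move=> t0 s0 /andP[k0 k1] kt.
have ts : 0 < t ^+ 2 + s ^+ 2 by rewrite ltr_pwDl// ?sqr_ge0// exprn_gt0.
have U := quad_exp_le (ltW t0) s0.
have k01 : 0 <= k <= 1 by rewrite ltW.
have L := quad_exp_ge s0 k01 kt.
have c0 : 0 < expR (- s) ^+ 2 * k by rewrite mulr_gt0// exprn_gt0// expR_gt0.
have D0 : 0 < 1 - 2 * expR (- s) * cos t + expR (- s) ^+ 2.
  by apply: lt_le_trans L; rewrite mulr_gt0.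
rewrite /log_quad ler0_norm; last by rewrite subr_le0 ler_ln.
rewrite opprB lerBlDr -lerBlDl.
apply: (@le_trans _ _ (ln (expR (- s) ^+ 2 * k * (t ^+ 2 + s ^+ 2)))); last by rewrite ler_ln ?posrE// mulr_gt0.
rewrite lnM ?posrE// lnM ?posrE ?exprn_gt0 ?expR_gt0// lnXn ?expR_gt0// expRK.
by rewrite -mulr_natr; lra.
Qed.

Lemma expR_itv (s : R) : 0 <= s <= pi ->
  (0 <= expR (- s) <= expR pi) /\ (0 <= expR s <= expR pi).
Proof.
move=> /andP[s0 spi]; rewrite !expR_ge0 !ler_expR spi; split => //=.
by rewrite (le_trans _ (pi_ge0 R))// oppr_le0.
Qed.

(** On this quarter of the cell only [log_quad] is singular, like [ln (t^2 + s^2)]; the two tails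
    are bounded by 6 and the polynomial by its extreme values. *)
Lemma green_bounded : exists2 C : R, 0 <= C & forall t s : R, 0 < t <= pi -> 0 <= s <= pi ->
  `|green t s + pi * ln (t ^+ 2 + s ^+ 2)| <= C.
Proof.
have p0 := @pi_ge0 R.
exists (pi ^+ 2 * 2 + pi ^+ 2 + pi ^+ 2 + pi * ((2 * pi + ln 8) + 6 + 6)).
  have l8 : 0 <= ln 8 :> R by rewrite ln_ge0// ler1n.
  have : 0 <= pi * (2 * pi + ln 8 + 6 + 6) :> R by rewrite mulr_ge0//; lra.
  have := sqr_ge0 (pi : R); lra.
move=> t s /andP[t0 tpi] /andP[s0 spi].
have [e1 e2] : (0 <= expR (- s) <= expR pi) /\ (0 <= expR s <= expR pi).
  by apply: expR_itv; rewrite s0.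
have h1 := norm_green_tail_le t e1; have h2 := norm_green_tail_le t e2.
have h3 : `|log_quad (expR (- s)) (cos t) - ln (t ^+ 2 + s ^+ 2)| <= 2 * s - ln 8^-1.
  apply: log_quad_exp_le => //; last by apply: cos_quad_ge; rewrite (ltW t0).
  by rewrite invr_gt0 ltr0n/= invf_le1// ler1n.
rewrite lnV ?posrE// opprK in h3.
rewrite /green; set l := log_quad _ _ in h3 *; set T1 := green_tail _ _ in h1 *.
set T2 := green_tail _ _ in h2 *; set L := ln (_ + _) in h3 *.
rewrite (_ : _ + pi * L = s ^+ 2 / 2 + - (pi * s) + pi ^+ 2 / 3 - pi * ((l - L) + T1 + T2)); last by ring.
have n1 : `|(l - L) + T1 + T2| <= (2 * pi + ln 8) + 6 + 6.
  rewrite (le_trans (ler_normD _ _))// lerD// (le_trans (ler_normD _ _))// lerD//.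
  by rewrite (le_trans h3)// lerD2r ler_pM2l.
rewrite (le_trans (ler_normB _ _))//; apply: lerD; last first.
  by rewrite normrM (ger0_norm p0) ler_wpM2l.
rewrite (le_trans (ler_normD _ _))//; apply: lerD; last by rewrite ger0_norm ?divr_ge0 ?sqr_ge0//; have := sqr_ge0 (pi : R); lra.
rewrite (le_trans (ler_normD _ _))//; apply: lerD.
  rewrite ger0_norm ?divr_ge0 ?sqr_ge0//; nra.
by rewrite normrN ger0_norm ?mulr_ge0// expr2 ler_wpM2l.
Qed.

End green_function.

Section green_limit.
Variable R : realType.

Lemma cos_half_quad_ge (t : R) : 0 <= t <= pi ->
  cos (t / 2) ^+ 2 * t ^+ 2 <= 2 * (1 - cos t).
Proof.
move=> /andP[t0 tpi]; rewrite one_sub_cos.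
have t2 : 0 <= t / 2 by rewrite divr_ge0.
have h : t / 2 * cos (t / 2) <= sin (t / 2).
  by apply: mul_cos_le_sin; rewrite t2/=; lra.
have c0 : 0 <= cos (t / 2) by rewrite cos_ge0_pihalf//; have := @pi_ge0 R; lra.
have h2 : (t / 2 * cos (t / 2)) ^+ 2 <= sin (t / 2) ^+ 2.
  by apply: lerXn2r; rewrite ?nnegrE ?mulr_ge0// (le_trans _ h)// mulr_ge0.
rewrite exprMn in h2; have -> : t ^+ 2 = 4 * (t / 2) ^+ 2 by field.
by rewrite mulrC; lra.
Qed.

Lemma green_tail_cvg (a u : nat -> R) : a @ \oo --> (1 : R) -> u @ \oo --> (0 : R) ->
  (\forall n \near \oo, 0 <= a n <= expR pi) ->
  green_tail (a n) (u n) @[n --> \oo] --> green_tail (1 : R) 0.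
Proof.
move=> a1 u0 an.
pose e n := 6 * (2 * `|a n * cos (u n) - 1| + `|a n ^+ 2 - 1|).
have e0 : e @ \oo --> (0 : R).
  have -> : 0 = 6 * (2 * `|1 * cos 0 - 1| + `|1 ^+ 2 - 1|) :> R.
    by rewrite cos0 mul1r expr1n subrr normr0; ring.
  apply: cvgM; first exact: cvg_cst.
  apply: cvgD.
    apply: cvgM; first exact: cvg_cst.
    apply: cvg_norm; apply: cvgB; last exact: cvg_cst.
    apply: cvgM => //; apply: continuous_cvg => //; exact: continuous_cos.
  apply: cvg_norm; apply: cvgB; last exact: cvg_cst.
  by apply: (@continuous_cvg _ _ _ _ _ _ (fun x : R => x ^+ 2)); first exact: exprn_continuous.
apply/cvgrPdist_le => r r0.
near=> n; rewrite distrC; apply: (@le_trans _ _ (e n)).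
  by apply: green_tail_sub_le; near: n.
have : `|e n| <= r by near: n; move/cvgrPdist_le : e0 => /(_ r r0); under eq_near do rewrite sub0r normrN.
exact: le_trans (ler_norm _).
Unshelve. all: by end_near. Qed.

(** [log_quad_exp_le] is used with [k = cos(t/2)^2], which tends to 1, so the logarithms cancel in
    the limit; the tails converge to their value at [(1, 0)]. *)
Lemma green_cvg0 (u v : nat -> R) : u @ \oo --> (0 : R) -> v @ \oo --> (0 : R) ->
  (forall n, 0 < u n) -> (forall n, 0 < v n) ->
  green (u n) (v n) + pi * ln (u n ^+ 2 + v n ^+ 2) @[n --> \oo] --> green0 R.
Proof.
move=> u0 v0 up vp.
have upi : \forall n \near \oo, u n <= 1 by apply: (cvgr_le _ u0).
have vpi : \forall n \near \oo, v n <= 1 by apply: (cvgr_le _ v0).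
have pi2 := @pi_ge2 R.
pose d n := log_quad (expR (- v n)) (cos (u n)) - ln (u n ^+ 2 + v n ^+ 2).
have vN : - v n @[n --> \oo] --> (0 : R) by rewrite -oppr0; exact: cvgN.
have ev1 : expR (- v n) @[n --> \oo] --> (1 : R).
  by rewrite -[X in _ --> X](@expR0 R); apply: continuous_cvg => //; exact: continuous_expR.
have ev2 : expR (v n) @[n --> \oo] --> (1 : R).
  by rewrite -[X in _ --> X](@expR0 R); apply: continuous_cvg => //; exact: continuous_expR.
have d0 : d @ \oo --> (0 : R).
  have e0 : 2 * v n - ln (cos (u n / 2) ^+ 2) @[n --> \oo] --> (0 : R).
    have -> : 0 = 2 * 0 - ln (cos (0 / 2) ^+ 2) :> R.
      by rewrite mul0r cos0 expr1n ln1; ring.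
    apply: cvgB; first by apply: cvgM => //; exact: cvg_cst.
    apply: (@continuous_cvg _ _ _ _ _ _ (@ln R)).
      by apply: continuous_ln; rewrite mul0r cos0 expr1n.
    apply: (@continuous_cvg _ _ _ _ _ _ (fun x : R => x ^+ 2)); first exact: exprn_continuous.
    apply: continuous_cvg; first exact: continuous_cos.
    by apply: cvgM => //; exact: cvg_cst.
  apply/cvgrPdist_le => r r0; near=> n; rewrite sub0r normrN.
  have un : u n <= 1 by near: n.
  apply: (@le_trans _ _ (2 * v n - ln (cos (u n / 2) ^+ 2))).
    apply: log_quad_exp_le => //; first exact: ltW.
      have c0 : 0 < cos (u n / 2).
        by apply: cos_gt0_pihalf; have := up n; lra.
      by rewrite exprn_gt0//= exprn_ile1// ?cos_le1// ltW.
    by apply: cos_half_quad_ge; rewrite ltW//=; lra.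
  have : `|2 * v n - ln (cos (u n / 2) ^+ 2)| <= r.
    by near: n; move/cvgrPdist_le : e0 => /(_ r r0); under eq_near do rewrite sub0r normrN.
  exact: le_trans (ler_norm _).
have vn_itv : \forall n \near \oo, 0 <= v n <= pi.
  by near=> n; rewrite ltW//=; apply: (@le_trans _ _ 1); [near: n|lra].
have T1 : green_tail (expR (- v n)) (u n) @[n --> \oo] --> green_tail (1 : R) 0.
  by apply: green_tail_cvg => //; apply: filterS vn_itv => n /expR_itv[].
have T2 : green_tail (expR (v n)) (u n) @[n --> \oo] --> green_tail (1 : R) 0.
  by apply: green_tail_cvg => //; apply: filterS vn_itv => n /expR_itv[].
have -> : green0 R = 0 ^+ 2 / 2 - pi * 0 + pi ^+ 2 / 3 -
    pi * (0 + green_tail 1 0 + green_tail 1 0) by rewrite /green0; field.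
rewrite [X in X @ _ --> _](_ : _ = fun n => v n ^+ 2 / 2 - pi * v n + pi ^+ 2 / 3 -
    pi * (d n + green_tail (expR (- v n)) (u n) + green_tail (expR (v n)) (u n))); last first.
  by apply/funext => n; rewrite /green /d; ring.
apply: cvgB.
  apply: cvgD; last exact: cvg_cst.
  apply: cvgB; last by apply: cvgM => //; exact: cvg_cst.
  apply: cvgM; last exact: cvg_cst.
  by apply: (@continuous_cvg _ _ _ _ _ _ (fun x : R => x ^+ 2)); first exact: exprn_continuous.
apply: cvgM; first exact: cvg_cst.
exact: (cvgD (cvgD d0 T1) T2).
Unshelve. all: by end_near. Qed.

End green_limit.

(** * Cosine coefficients of the Green function *)

Section real_integrable.
Context d (T : measurableType d) (R : realType) (m : {measure set T -> \bar R}).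
Variable D : set T.
Hypothesis mD : measurable D.

Lemma integrable_lin (a b : R) (f g : T -> R) :
  m.-integrable D (EFin \o f) -> m.-integrable D (EFin \o g) ->
  m.-integrable D (EFin \o (fun x => a * f x + b * g x)).
Proof.
move=> intf intg.
have /(eq_integrable mD) := integrableD mD (integrableZl mD a intf) (integrableZl mD b intg).
by apply.
Qed.

Lemma Rintegral_lin (a b : R) (f g : T -> R) :
  m.-integrable D (EFin \o f) -> m.-integrable D (EFin \o g) ->
  \int[m]_(x in D) (a * f x + b * g x) =
  a * \int[m]_(x in D) f x + b * \int[m]_(x in D) g x.
Proof.
move=> intf intg; rewrite -!RintegralZl//.
exact: (RintegralD mD (integrableZl mD a intf) (integrableZl mD b intg)).
Qed.

Lemma integrable_sub (f g : T -> R) :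
  m.-integrable D (EFin \o f) -> m.-integrable D (EFin \o g) ->
  m.-integrable D (EFin \o (fun x => f x - g x)).
Proof.
move=> intf intg.
have /(eq_integrable mD) := integrable_lin 1 (-1) intf intg; apply => x _ /=.
by rewrite mul1r mulN1r.
Qed.

Lemma Rintegral_dist_le (f g h : T -> R) :
  m.-integrable D (EFin \o f) -> m.-integrable D (EFin \o g) ->
  m.-integrable D (EFin \o h) -> (forall x, D x -> `|f x - g x| <= h x) ->
  `|\int[m]_(x in D) f x - \int[m]_(x in D) g x| <= \int[m]_(x in D) h x.
Proof.
move=> intf intg inth fgh; rewrite -RintegralB//.
have intB := integrable_sub intf intg.
apply: (le_trans (le_normr_Rintegral mD intB)).
by apply: le_Rintegral => //; exact: (integrable_norm intB).
Qed.

Lemma integrable_bounded_mul (f g : T -> R) (C : R) :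
  m.-integrable D (EFin \o f) -> measurable_fun D g ->
  (forall x, D x -> `|g x| <= C) ->
  m.-integrable D (EFin \o (fun x => f x * g x)).
Proof.
move=> intf mg gC.
have mf : measurable_fun D f by apply/measurable_EFinP; exact: measurable_int intf.
apply: (le_integrable mD _ _ (integrableZl mD C (integrable_norm intf))).
  by apply/measurable_EFinP; exact: measurable_funM.
move=> x Dx /=; rewrite lee_fin normrM.
have C0 : 0 <= C by apply: le_trans (gC _ Dx).
rewrite normrM (ger0_norm C0) normr_id mulrC.
by rewrite ler_wpM2r// gC.
Qed.

End real_integrable.

(** * Cosine expansions on a half-period *)

Section cosine_integrals.
Variable R : realType.
Notation mu := (@lebesgue_measure R).
Variables (h w : R).
Hypotheses (h0 : 0 < h) (wh : w * h = pi).

Let w0 : w != 0.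
Proof. by apply/eqP => w0; have := @pi_gt0 R; rewrite -wh w0 mul0r ltxx. Qed.

Lemma Rintegral_sum_ord (A : set R) (M : nat) (f : 'I_M -> R -> R) : measurable A ->
  (forall j, mu.-integrable A (EFin \o f j)) ->
  mu.-integrable A (EFin \o (fun x => \sum_(j < M) f j x)) /\
  \int[mu]_(x in A) (\sum_(j < M) f j x) = \sum_(j < M) \int[mu]_(x in A) f j x.
Proof.
move=> mA; elim: M f => [|M IH] f intf.
  split; last first.
    rewrite big_ord0; transitivity (\int[mu]_(x in A) (0 : R)); last by rewrite Rintegral_cst// mul0r.
    by apply: eq_Rintegral => x _; rewrite big_ord0.
  rewrite (_ : _ \o _ = cst 0%E); first exact: integrable0.
  by apply/funext => x; rewrite /= big_ord0.
have [i1 e1] := IH (fun j => f (lift ord0 j)) (fun j => intf _).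
have e x : \sum_(j < M.+1) f j x = f ord0 x + \sum_(j < M) f (lift ord0 j) x.
  by rewrite big_ord_recl.
split.
  rewrite (_ : _ \o _ = (EFin \o f ord0) \+ (EFin \o (fun x => \sum_(j < M) f (lift ord0 j) x))).
    exact: integrableD.
  by apply/funext => x; rewrite /= e.
rewrite big_ord_recl -e1 -RintegralD//; exact: eq_Rintegral.
Qed.

Lemma is_derive_linear (c y : R) : is_derive y 1 (fun y => c * y) c.
Proof.
have : is_derive y 1 (c *: (id : R -> R)) (c *: 1) by apply: is_deriveZ.
by rewrite /GRing.scale /= mulr1.
Qed.

Lemma Rintegral_cst_itv (c : R) : \int[mu]_(x in `[0, h]) c = c * h.
Proof.
have cc : continuous (fun _ : R => c) by move=> x; exact: cvg_cst.
by rewrite (Rintegral_FTC h0 cc (is_derive_linear c)) mulr0 subr0.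
Qed.

Lemma is_derive_sinM (c y : R) : is_derive y 1 (fun y => sin (c * y)) (c * cos (c * y)).
Proof.
rewrite mulrC; apply: (@is_derive1_comp _ (@sin R) (fun y => c * y)).
exact: is_derive_linear.
Qed.

Lemma is_derive_cosM (c y : R) : is_derive y 1 (fun y => cos (c * y)) (- c * sin (c * y)).
Proof.
rewrite mulNr mulrC -mulNr; apply: (@is_derive1_comp _ (@cos R) (fun y => c * y)).
exact: is_derive_linear.
Qed.

Lemma is_derive_expRM (c y : R) : is_derive y 1 (fun y => expR (c * y)) (c * expR (c * y)).
Proof.
rewrite mulrC; apply: (@is_derive1_comp _ (@expR R) (fun y => c * y)).
exact: is_derive_linear.
Qed.

Lemma continuous_cosM (c : R) : continuous (fun x => cos (c * x)).
Proof.
move=> x; apply: (@continuous_comp _ _ _ (fun x => c * x) (@cos R)).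
  by apply: cvgM; [exact: cvg_cst|exact: cvg_id].
exact: continuous_cos.
Qed.

Lemma sin_natpi (n : nat) : sin (n%:R * pi) = 0 :> R.
Proof.
elim: n => [|n IH]; first by rewrite mul0r sin0.
by rewrite -natr1 mulrDl mul1r sinDpi IH oppr0.
Qed.

Lemma integral_cos_nat (n : nat) :
  \int[mu]_(x in `[0, h]) cos (n%:R * w * x) = if n == 0%N then h else 0.
Proof.
case: eqP => [->|/eqP n0].
  transitivity (\int[mu]_(x in `[0, h]) (1 : R)).
    by apply: eq_Rintegral => x _; rewrite !mul0r cos0.
  by rewrite Rintegral_cst_itv mul1r.
have k0 : n%:R * w != 0 by rewrite mulf_neq0// pnatr_eq0.
have d (x : R) : is_derive x 1 (fun x => (n%:R * w)^-1 * sin (n%:R * w * x)) (cos (n%:R * w * x)).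
  have : is_derive x 1 ((n%:R * w)^-1 *: (fun x => sin (n%:R * w * x)))
      ((n%:R * w)^-1 *: (n%:R * w * cos (n%:R * w * x))).
    by apply: is_deriveZ; exact: is_derive_sinM.
  by rewrite /GRing.scale/= mulrA mulVf// mul1r.
rewrite (Rintegral_FTC h0 (@continuous_cosM _) d).
by rewrite mulr0 sin0 mulr0 subr0 -mulrA wh sin_natpi mulr0.
Qed.

(** In the product formula the frequency [j.+1 + m] is never 0, so only the difference [k] can
    contribute. *)
Lemma integral_cos_cos (j m : nat) :
  \int[mu]_(x in `[0, h]) (cos (j.+1%:R * w * x) * cos (m%:R * w * x)) =
  if m == j.+1 then h / 2 else 0.
Proof.
pose k := if (m <= j.+1)%N then (j.+1 - m)%N else (m - j.+1)%N.
have E (x : R) : cos (j.+1%:R * w * x) * cos (m%:R * w * x) =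
    2^-1 * cos ((j.+1 + m)%N%:R * w * x) + 2^-1 * cos (k%:R * w * x).
  have -> : cos (k%:R * w * x) = cos (j.+1%:R * w * x - m%:R * w * x).
    rewrite /k; case: leqP => jm.
      by rewrite natrB// !mulrBl.
    by rewrite natrB ?(ltnW jm)// -cosN; congr cos; ring.
  have -> : (j.+1 + m)%N%:R * w * x = j.+1%:R * w * x + m%:R * w * x by rewrite natrD; ring.
  by rewrite cosD cosB; field.
transitivity (\int[mu]_(x in `[0, h]) (2^-1 * cos ((j.+1 + m)%N%:R * w * x) + 2^-1 * cos (k%:R * w * x))).
  by apply: eq_Rintegral => x _; exact: E.
have ic (n : nat) : mu.-integrable `[0, h] (EFin \o (fun x => cos (n%:R * w * x))).
  by apply: continuous_integrable; exact: continuous_cosM.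
have ic2 (n : nat) : mu.-integrable `[0, h] (EFin \o (fun x => 2^-1 * cos (n%:R * w * x))).
  by apply: continuous_integrable => x; apply: cvgM; [exact: cvg_cst|exact: continuous_cosM].
rewrite RintegralD// !RintegralZl// !integral_cos_nat addSn /= mulr0 add0r.
have -> : (k == 0%N) = (m == j.+1).
  rewrite /k; case: leqP => jm; rewrite subn_eq0 eqn_leq ?jm//.
  by rewrite [in RHS](leqNgt m) jm leqNgt jm.
by case: ifP; rewrite ?mulr0// mulrC.
Qed.

(** Cosine coefficients of [log_quad r] up to the factor [- h]; the value 0 at [m = 0] reflects its
    zero mean. *)
Definition quad_coef (r : R) (m : nat) : R :=
  if m is m'.+1 then r ^+ m / m%:R else 0.

Lemma continuous_log_quad_cos (r c : R) : 0 <= r < 1 ->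
  continuous (fun x => log_quad r (cos (c * x))).
Proof.
move=> /andP[r0 r1] x.
apply: (@continuous_comp _ _ _ (fun x => 1 - 2 * r * cos (c * x) + r ^+ 2) (@ln R)).
  apply: cvgD; last exact: cvg_cst.
  apply: cvgB; first exact: cvg_cst.
  by apply: cvgM; [exact: cvg_cst|exact: continuous_cosM].
apply: continuous_ln; apply: lt_le_trans (quad_ge r0 (cos_max _)).
by rewrite exprn_gt0// subr_gt0.
Qed.

(** The partial sums converge uniformly by [log_quad_series], and orthogonality retains the single
    term of frequency [m]. *)
Lemma integral_log_quad_cos (r : R) (m : nat) : 0 <= r < 1 ->
  \int[mu]_(x in `[0, h]) (log_quad r (cos (w * x)) * cos (m%:R * w * x)) =
  - h * quad_coef r m.
Proof.
move=> r01; have /andP[r0 r1] := r01.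
pose f_ (M : nat) (x : R) : R := \sum_(j < M) (- 2 * (r ^+ j.+1 / j.+1%:R)) * (cos (j.+1%:R * w * x) * cos (m%:R * w * x)).
pose C := 4 / (1 - r) ^+ 2.
have C0 : 0 <= C by rewrite divr_ge0// sqr_ge0.
have f_E M x : f_ M x = - (2 * \sum_(j < M) r ^+ j.+1 * cos (j.+1%:R * (w * x)) / j.+1%:R) * cos (m%:R * w * x).
  rewrite /f_ mulr_sumr -sumrN mulr_suml; apply: eq_bigr => j _.
  by rewrite !mulrA; ring.
have bd M x : `|log_quad r (cos (w * x)) * cos (m%:R * w * x) - f_ M x| <= C * r ^+ M.+1.
  rewrite f_E mulNr opprK -mulrDl normrM.
  apply: (@le_trans _ _ `|log_quad r (cos (w * x)) + 2 * \sum_(j < M) r ^+ j.+1 * cos (j.+1%:R * (w * x)) / j.+1%:R|).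
    by rewrite ler_piMr// ler_norml -ler_norml cos_max.
  by rewrite /C mulrAC; exact: log_quad_series.
have if_ M : mu.-integrable `[0, h] (EFin \o f_ M) /\
    \int[mu]_(x in `[0, h]) f_ M x = \sum_(j < M) (- 2 * (r ^+ j.+1 / j.+1%:R)) * (if m == j.+1 then h / 2 else 0).
  have ic (j : 'I_M) : mu.-integrable `[0, h] (EFin \o (fun x : R => (- 2 * (r ^+ j.+1 / j.+1%:R)) * (cos (j.+1%:R * w * x) * cos (m%:R * w * x)))).
    by apply: continuous_integrable => x; apply: cvgM; [exact: cvg_cst|apply: cvgM; exact: continuous_cosM].
  have icc (j : 'I_M) : mu.-integrable `[0, h] (EFin \o (fun x : R => (cos (j.+1%:R * w * x) * cos (m%:R * w * x)))).
    by apply: continuous_integrable => x; apply: cvgM; exact: continuous_cosM.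
  have [i1 e1] := @Rintegral_sum_ord `[0, h] M _ (measurable_itv _) ic.
  split; first exact: i1.
  rewrite e1; apply: eq_bigr => j _.
  by rewrite RintegralZl// integral_cos_cos.
have lim0 : C * r ^+ M.+1 @[M --> \oo] --> (0 : R).
  rewrite -[X in _ --> X](mulr0 C); apply: cvgM; first exact: cvg_cst.
  by rewrite cvg_shiftS; apply: cvg_expr; rewrite ger0_norm.
pose F x := log_quad r (cos (w * x)) * cos (m%:R * w * x).
have contF : continuous F.
  move=> x; apply: cvgM; last exact: continuous_cosM.
  exact: continuous_log_quad_cos.
have iF : mu.-integrable `[0, h] (EFin \o F) by apply: continuous_integrable.
have lim1 : \int[mu]_(x in `[0, h]) f_ M x @[M --> \oo] --> \int[mu]_(x in `[0, h]) F x.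
  apply/cvgrPdist_le => e e0.
  move/cvgrPdist_le : lim0 => /(_ (e / h)); rewrite divr_gt0// => /(_ isT).
  apply: filterS => M; rewrite sub0r normrN => hM.
  have [iM _] := if_ M.
  have bd' (x : R) : `[0, h]%classic x -> `|F x - f_ M x| <= e / h.
    by move=> _; apply: (le_trans (bd M x)); apply: le_trans hM; exact: ler_norm.
  have ic : mu.-integrable `[0, h] (EFin \o (fun _ : R => e / h)).
    by apply: continuous_integrable => ?; exact: cvg_cst.
  have /(_ (measurable_itv _)) := fun mI => Rintegral_dist_le mI iF iM ic bd'.
  by rewrite Rintegral_cst_itv (divfK (lt0r_neq0 h0)).
have lim2 : \int[mu]_(x in `[0, h]) f_ M x @[M --> \oo] --> - h * quad_coef r m.
  apply: cvg_near_cst; exists m => // M /= mM.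
  have [_ ->] := if_ M.
  case: m mM {if_ lim1 iF contF F bd f_E f_} => [|m] mM.
    by rewrite big1 ?mulr0// => j _; rewrite mulr0.
  rewrite (bigD1 (Ordinal mM))//= eqxx big1 ?addr0.
    by move: (r ^+ m.+1) (m.+1%:R^-1) => a b; field.
  move=> j jm; rewrite eqSS ifF ?mulr0//; apply/negbTE; apply: contra jm => /eqP mj.
  by apply/eqP/val_inj; rewrite /= mj.
exact: (cvg_unique _ lim1 lim2).
Qed.

End cosine_integrals.

Section green_integrals.
Variable R : realType.
Notation mu := (@lebesgue_measure R).
Variables (h w : R).
Hypotheses (h0 : 0 < h) (wh : w * h = pi).

Let w0 : 0 < w.
Proof. by rewrite -(pmulr_lgt0 _ h0) wh pi_gt0. Qed.

Lemma nome_pow_lt1 (m : nat) : 0 < nome R ^+ m.+1 < 1.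
Proof.
have n0 := nome_gt0 R; have n1 := nome_le R.
by rewrite exprn_gt0//= exprn_ilt1 ?(ltW n0)//; lra.
Qed.

Lemma nome_radius_lt1 (a : R) (k : nat) : 0 <= a <= expR pi -> 0 <= nome R ^+ k.+1 * a < 1.
Proof.
move=> /(nome_radius k)/andP[r0 r1]; rewrite r0/=; apply: (le_lt_trans r1).
have h1 : 2^-1 ^+ k <= 1 :> R by rewrite exprn_ile1// invf_le1// ler1n.
lra.
Qed.

(** Domination by the constant 6 allows termwise integration; the coefficients [(q^(k+1) a)^m / m]
    then sum over [k] as a geometric series of ratio [q^m]. *)
Lemma integral_green_tail_cos (a : R) (m : nat) : 0 <= a <= expR pi ->
  mu.-integrable `[0, h] (EFin \o (fun x => green_tail a (w * x) * cos (m%:R * w * x))) /\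
  \int[mu]_(x in `[0, h]) (green_tail a (w * x) * cos (m%:R * w * x)) =
  - h * (quad_coef a m * (nome R ^+ m / (1 - nome R ^+ m))).
Proof.
move=> a01.
pose u (k : nat) (x : R) : R := tail_term a (w * x) k * cos (m%:R * w * x).
have cu k : continuous (u k).
  move=> x; apply: cvgM; last exact: continuous_cosM.
  by apply: continuous_log_quad_cos; exact: nome_radius_lt1.
have iu k : mu.-integrable `[0, h] (EFin \o u k) by exact: continuous_integrable.
pose f_ (K : nat) (x : R) : R := \sum_(k < K) u k x.
have f_E K x : f_ K x = series (tail_term a (w * x)) K * cos (m%:R * w * x).
  by rewrite /f_ /series /= big_mkord mulr_suml.
have [] := @dominated_Rintegral R _ (measurableTypeR R) mu `[0, h] f_
    (fun x => green_tail a (w * x) * cos (m%:R * w * x)) (fun=> 6).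
- exact: measurable_itv.
- move=> K; apply/measurable_EFinP; apply: measurable_int.
  exact: (Rintegral_sum_ord _ _).1.
- move=> x _; under eq_fun do rewrite f_E.
  apply: cvgM; last exact: cvg_cst.
  exact: (@is_cvg_green_tail _ a (w * x) a01).
- by apply: continuous_integrable => ?; exact: cvg_cst.
- move=> K x _; rewrite f_E normrM -[6]mulr1 ler_pM ?cos_max//.
  exact: norm_series_tail_le.
move=> i1 lim1; split; first exact: i1.
suff lim2 : \int[mu]_(x in `[0, h]) f_ K x @[K --> \oo] -->
    - h * (quad_coef a m * (nome R ^+ m / (1 - nome R ^+ m))).
  exact: (cvg_unique _ lim1 lim2).
have e K : \int[mu]_(x in `[0, h]) f_ K x =
    \sum_(0 <= k < K) - h * quad_coef (nome R ^+ k.+1 * a) m.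
  rewrite (Rintegral_sum_ord _ _).2// big_mkord; apply: eq_bigr => k _.
  by rewrite -(integral_log_quad_cos h0 wh)// nome_radius_lt1.
under eq_fun do rewrite e.
case: m {u cu iu f_ f_E i1 lim1 e} => [|m].
  by rewrite /= mul0r mulr0; apply: cvg_near_cst; apply: nearW => K; rewrite big1.
have /andP[q0 q1] := nome_pow_lt1 m.
have -> : - h * (quad_coef a m.+1 * (nome R ^+ m.+1 / (1 - nome R ^+ m.+1))) =
  (- h * quad_coef a m.+1 * nome R ^+ m.+1) / (1 - nome R ^+ m.+1) by ring.
have := @cvg_geometric_series R (- h * quad_coef a m.+1 * nome R ^+ m.+1) (nome R ^+ m.+1).
rewrite ger0_norm ?(ltW q0)// => /(_ q1); apply: cvg_trans.
apply: near_eq_cvg; apply: nearW => K; apply: eq_bigr => k _ /=.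
rewrite exprMn -!exprM mulnC.
have -> : ((k.+1 * m.+1) = m.+1 + k * m.+1)%N by rewrite mulSn.
rewrite exprD [(k * _)%N]mulnC; move: (nome R ^+ _) (nome R ^+ _) => x y; ring.
Qed.

(** For [m > 0] this equals [pi h cosh(m (pi - s)) / (m sinh(m pi))], written with the nome as it
    comes out of the tail series. *)
Definition green_coef (m : nat) (s : R) : R :=
  if m is 0 then h * (s ^+ 2 / 2 - pi * s + pi ^+ 2 / 3)
  else pi * h / (m%:R * (1 - nome R ^+ m)) * (expR (- m%:R * s) + nome R ^+ m * expR (m%:R * s)).

(** A positive [s] keeps the radius [exp(- s)] below 1, so that the singular logarithm has its
    cosine expansion too. *)
Lemma integral_green_cos (m : nat) (s : R) : 0 < s <= pi ->
  mu.-integrable `[0, h] (EFin \o (fun x => green (w * x) s * cos (m%:R * w * x))) /\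
  \int[mu]_(x in `[0, h]) (green (w * x) s * cos (m%:R * w * x)) = green_coef m s.
Proof.
move=> /andP[s0 spi].
have s0pi : 0 <= s <= pi by rewrite ltW.
have [en ep] := expR_itv s0pi.
have e1 : 0 <= expR (- s) < 1 by rewrite expR_ge0/= expR_lt1; lra.
have [i1 v1] := integral_green_tail_cos m en.
have [i2 v2] := integral_green_tail_cos m ep.
have v3 := integral_log_quad_cos h0 wh m e1.
have i3 : mu.-integrable `[0, h] (EFin \o (fun x : R => log_quad (expR (- s)) (cos (w * x)) * cos (m%:R * w * x))).
  apply: continuous_integrable => x; apply: cvgM; last exact: continuous_cosM.
  exact: continuous_log_quad_cos.
have mI : @measurable _ (measurableTypeR R) `[0, h] by exact: measurable_itv.
have i4 : mu.-integrable `[0, h] (EFin \o (fun x : R => cos (m%:R * w * x))).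
  by apply: continuous_integrable; exact: continuous_cosM.
pose A : R := s ^+ 2 / 2 - pi * s + pi ^+ 2 / 3.
have E (x : R) : green (w * x) s * cos (m%:R * w * x) =
   1 * (A * cos (m%:R * w * x) + - pi * (log_quad (expR (- s)) (cos (w * x)) * cos (m%:R * w * x)))
   + - pi * (1 * (green_tail (expR (- s)) (w * x) * cos (m%:R * w * x)) + 1 * (green_tail (expR s) (w * x) * cos (m%:R * w * x))).
  rewrite /green -/A.
  move: (pi : R) (cos _) (log_quad _ _) (green_tail _ _) (green_tail _ _) => ? ? ? ? ?; ring.
have iI := integrable_lin mI 1 (- pi) (integrable_lin mI A (- pi) i4 i3) (integrable_lin mI 1 1 i1 i2).
split.
  by have /(eq_integrable mI) := iI; apply => x _ /=; rewrite E.
transitivity (\int[mu]_(x in `[0, h])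
   (1 * (A * cos (m%:R * w * x) + - pi * (log_quad (expR (- s)) (cos (w * x)) * cos (m%:R * w * x)))
   + - pi * (1 * (green_tail (expR (- s)) (w * x) * cos (m%:R * w * x)) + 1 * (green_tail (expR s) (w * x) * cos (m%:R * w * x))))).
  by apply: eq_Rintegral => x _; exact: E.
rewrite (Rintegral_lin mI 1 (- pi) (integrable_lin mI A (- pi) i4 i3)
   (integrable_lin mI 1 1 i1 i2)).
rewrite (Rintegral_lin mI A (- pi) i4 i3) (Rintegral_lin mI 1 1 i1 i2) v1 v2 v3.
rewrite (integral_cos_nat h0 wh).
case: m {v1 v2 v3 i1 i2 i3 i4 E iI} => [|m] /=.
  by rewrite /A; move: (pi : R) => p; ring.
have /andP[q0 q1] := nome_pow_lt1 m.
rewrite (_ : expR (_ *- _ * _) = expR (- s) ^+ m.+1); last first.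
  by rewrite -expRM_natl mulrN mulNr.
rewrite expRM_natl.
have m0 : m.+1%:R != 0 :> R by rewrite pnatr_eq0.
move: (expR _) (expR _) => E1 E2; move: (nome R ^+ m.+1) q0 q1 => q q0 q1.
move: (m.+1%:R) m0 (pi : R) => M m0 p.
have q2 : 1 - q != 0 by rewrite subr_eq0 gt_eqF.
by field; rewrite m0 q2.
Qed.

End green_integrals.

Section pointwise_derivatives.
Variable R : realType.
Implicit Types (f g : R -> R) (y a b c : R).

Lemma derive_add f g y a b : is_derive y 1 f a -> is_derive y 1 g b ->
  is_derive y 1 (fun y => f y + g y) (a + b).
Proof. exact: is_deriveD. Qed.

Lemma derive_sub f g y a b : is_derive y 1 f a -> is_derive y 1 g b ->
  is_derive y 1 (fun y => f y - g y) (a - b).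
Proof. exact: is_deriveB. Qed.

Lemma derive_mul f g y a b : is_derive y 1 f a -> is_derive y 1 g b ->
  is_derive y 1 (fun y => f y * g y) (f y * b + g y * a).
Proof. exact: is_deriveM. Qed.

Lemma derive_scale f y c a : is_derive y 1 f a -> is_derive y 1 (fun y => c * f y) (c * a).
Proof. exact: is_deriveZ. Qed.

Lemma derive_pow n y : is_derive y 1 (fun y => y ^+ n.+1) (n.+1%:R * y ^+ n).
Proof.
elim: n => [|n IH].
  by have -> : (fun y => y ^+ 1) = id :> (R -> R) by []; rewrite expr0 mulr1; exact: is_derive_id.
have -> : (fun y => y ^+ n.+2) = (fun y => y * y ^+ n.+1) :> (R -> R).
  by apply/funext => x; rewrite exprS.
apply: (is_derive_eq (derive_mul (is_derive_id y (1 : R)) IH)).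
by rewrite exprS -[n.+2%:R]natr1; ring.
Qed.

End pointwise_derivatives.

(** * Cosine coefficients in the second variable *)

Section green_coef_integrals.
Variable R : realType.
Notation mu := (@lebesgue_measure R).
Variables (h w : R).
Hypotheses (h0 : 0 < h) (wh : w * h = pi).

Let w0 : 0 < w.
Proof. by rewrite -(pmulr_lgt0 _ h0) wh pi_gt0. Qed.

Lemma integral_exp_cos (a b : R) : a ^+ 2 + b ^+ 2 != 0 ->
  \int[mu]_(y in `[0, h]) (expR (a * y) * cos (b * y)) =
  (expR (a * h) * (b * sin (b * h) + a * cos (b * h)) - a) / (a ^+ 2 + b ^+ 2).
Proof.
move=> ab.
pose F (y : R) : R := (a ^+ 2 + b ^+ 2)^-1 * (expR (a * y) * (b * sin (b * y) + a * cos (b * y))).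
have d (y : R) : is_derive y 1 F (expR (a * y) * cos (b * y)).
  have D := derive_scale ((a ^+ 2 + b ^+ 2)^-1) (derive_mul (is_derive_expRM a y)
    (derive_add (derive_scale b (is_derive_sinM b y)) (derive_scale a (is_derive_cosM b y)))).
  apply: (is_derive_eq D).
  move: (expR _) (cos _) (sin _) => ? ? ?; field; exact: ab.
have c : continuous (fun y : R => expR (a * y) * cos (b * y)).
  move=> y; apply: cvgM; last exact: continuous_cosM.
  apply: (@continuous_comp _ _ _ (fun x : R => a * x) (@expR R)).
    by apply: cvgM; [exact: cvg_cst|exact: cvg_id].
  exact: continuous_expR.
rewrite (Rintegral_FTC h0 c d) /F !mulr0 expR0 sin0 cos0.
move: (expR _) (cos _) (sin _) => ? ? ?; field; exact: ab.
Qed.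

Lemma continuous_quadratic : continuous (fun y : R => (w * y) ^+ 2 / 2 - pi * (w * y) + pi ^+ 2 / 3).
Proof.
move=> y; have l : w * x @[x --> y] --> w * y by apply: cvgM; [exact: cvg_cst|exact: cvg_id].
apply: cvgD; last exact: cvg_cst.
apply: cvgB; last by apply: cvgM; [exact: cvg_cst|exact: l].
by apply: cvgM; [exact: (cvgM l l)|exact: cvg_cst].
Qed.

(** The constant [pi ^+ 2 / 3] in [green] is the one that gives mean zero. *)
Lemma integral_quadratic : \int[mu]_(y in `[0, h]) ((w * y) ^+ 2 / 2 - pi * (w * y) + pi ^+ 2 / 3) = 0.
Proof.
pose F (y : R) : R := w ^+ 2 / 6 * y ^+ 3 - pi * w / 2 * y ^+ 2 + pi ^+ 2 / 3 * y.
have d (y : R) : is_derive y 1 F ((w * y) ^+ 2 / 2 - pi * (w * y) + pi ^+ 2 / 3).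
  have D := derive_add (derive_sub (derive_scale (w ^+ 2 / 6) (derive_pow 2 y))
     (derive_scale (pi * w / 2) (derive_pow 1 y)))
     (derive_scale (pi ^+ 2 / 3) (is_derive_id y (1 : R))).
  apply: (is_derive_eq D).
  by move: (pi : R) => ?; field.
have c : continuous (fun y : R => (w * y) ^+ 2 / 2 - pi * (w * y) + pi ^+ 2 / 3).
  exact: continuous_quadratic.
by rewrite (Rintegral_FTC h0 c d) /F -wh; field.
Qed.

(** [F] results from repeated integration by parts. The sines vanish at both ends and [P'] vanishes
    at [h], so only [P' 0 = - pi w] contributes. *)
Lemma integral_quadratic_cos (n : nat) :
  \int[mu]_(y in `[0, h]) (((w * y) ^+ 2 / 2 - pi * (w * y) + pi ^+ 2 / 3) * cos (n.+1%:R * w * y)) =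
  h / n.+1%:R ^+ 2.
Proof.
have n0 : n.+1%:R != 0 :> R by rewrite pnatr_eq0.
have W0 : w != 0 by rewrite gt_eqF.
have sn : sin (n.+1%:R * w * h) = 0 by rewrite -mulrA wh sin_natpi.
move: (n.+1%:R) n0 sn => b b0 sn.
pose P (y : R) : R := w ^+ 2 / 2 * y ^+ 2 - pi * w * y + pi ^+ 2 / 3.
pose P' (y : R) : R := w ^+ 2 * y - pi * w.
pose F (y : R) : R := (b * w)^-1 * (P y * sin (b * w * y)) + (b * w) ^- 2 * (P' y * cos (b * w * y))
  - w ^+ 2 * (b * w) ^- 3 * sin (b * w * y).
have d (y : R) : is_derive y 1 F (((w * y) ^+ 2 / 2 - pi * (w * y) + pi ^+ 2 / 3) * cos (b * w * y)).
  have dP : is_derive y 1 P (P' y).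
    have D := derive_add (derive_sub (derive_scale (w ^+ 2 / 2) (derive_pow 1 y))
     (derive_scale (pi * w) (is_derive_id y (1 : R)))) (is_derive_cst (pi ^+ 2 / 3 : R) y 1).
    apply: (is_derive_eq D); rewrite /P'.
    by move: (pi : R) => ?; field.
  have dP' : is_derive y 1 P' (w ^+ 2).
    have D := derive_sub (is_derive_linear (w ^+ 2) y) (is_derive_cst (pi * w : R) y 1).
    by apply: (is_derive_eq D); rewrite subr0.
  have D := derive_sub (derive_add (derive_scale (b * w)^-1 (derive_mul dP (is_derive_sinM (b * w) y)))
    (derive_scale ((b * w) ^- 2) (derive_mul dP' (is_derive_cosM (b * w) y))))
    (derive_scale (w ^+ 2 * (b * w) ^- 3) (is_derive_sinM (b * w) y)).
  apply: (is_derive_eq D); rewrite /P /P'.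
  move: (pi : R) (cos _) (sin _) => ? ? ?; field.
  by rewrite W0 b0.
have c : continuous (fun y : R => ((w * y) ^+ 2 / 2 - pi * (w * y) + pi ^+ 2 / 3) * cos (b * w * y)).
  move=> y; apply: cvgM; last exact: continuous_cosM.
  exact: continuous_quadratic.
rewrite (Rintegral_FTC h0 c d) /F /P' sn (mulr0 (b * w)) sin0 cos0 -wh.
move: (cos _) => ?; field.
by rewrite W0 b0.
Qed.

Lemma integral_green_coef_cos (m n : nat) :
  \int[mu]_(y in `[0, h]) (green_coef h m (w * y) * cos (n%:R * w * y)) =
  if (m == 0%N) && (n == 0%N) then 0 else h ^+ 2 / (m%:R ^+ 2 + n%:R ^+ 2).
Proof.
have W0 : w != 0 by rewrite gt_eqF.
have H0 : h != 0 by rewrite gt_eqF.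
have cq : continuous (fun y : R => (w * y) ^+ 2 / 2 - pi * (w * y) + pi ^+ 2 / 3).
  exact: continuous_quadratic.
case: m => [|m] /=.
  transitivity (\int[mu]_(y in `[0, h]) (h * (((w * y) ^+ 2 / 2 - pi * (w * y) + pi ^+ 2 / 3) * cos (n%:R * w * y)))).
    by apply: eq_Rintegral => y _; rewrite -mulrA.
  rewrite RintegralZl//; last first.
    by apply: continuous_integrable => y; apply: cvgM; [exact: cq|exact: continuous_cosM].
  case: n => [|n] /=.
    transitivity (h * \int[mu]_(y in `[0, h]) ((w * y) ^+ 2 / 2 - pi * (w * y) + pi ^+ 2 / 3)).
      by congr (_ * _); apply: eq_Rintegral => y _; rewrite !mul0r cos0 mulr1.
    by rewrite integral_quadratic mulr0.
  by rewrite integral_quadratic_cos expr0n add0r mulrA expr2.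
have /andP[q0 q1] := @nome_pow_lt1 R m.
have M0 : m.+1%:R != 0 :> R by rewrite pnatr_eq0.
set c := pi * h / _; set Q := nome R ^+ m.+1.
have ie (a b : R) : mu.-integrable `[0, h] (EFin \o (fun y : R => expR (a * y) * cos (b * y))).
  apply: continuous_integrable => y; apply: cvgM; last exact: continuous_cosM.
  apply: (@continuous_comp _ _ _ (fun x : R => a * x) (@expR R)).
    by apply: cvgM; [exact: cvg_cst|exact: cvg_id].
  exact: continuous_expR.
transitivity (\int[mu]_(y in `[0, h]) (c * (expR (- (m.+1%:R * w) * y) * cos (n%:R * w * y))
   + c * Q * (expR (m.+1%:R * w * y) * cos (n%:R * w * y)))).
  apply: eq_Rintegral => y _; rewrite mulNr !mulrA -!mulNr.
  by move: (expR _) (expR _) (cos _) => ? ? ?; ring.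
have mI : @measurable _ (measurableTypeR R) `[0, h] by exact: measurable_itv.
rewrite (Rintegral_lin mI c (c * Q) (ie _ _) (ie _ _)).
have s0 : 0 < (m.+1%:R * w) ^+ 2 + (n%:R * w) ^+ 2.
  by rewrite ltr_pwDl ?sqr_ge0// exprn_gt0// mulr_gt0.
rewrite !integral_exp_cos ?sqrrN ?(gt_eqF s0)//.
rewrite -!mulrA wh sin_natpi !mulr0 !add0r mulNr -mulrA wh.
(* With this identity the two boundary terms in [cos(n pi)] cancel; what remains has the factor
   [1 - Q], which cancels the denominator of [green_coef]. *)
have -> : expR (- (m.+1%:R * pi)) = Q * expR (m.+1%:R * pi) :> R.
  rewrite /Q /nome -expRM_natl -expRD; congr expR; ring.
move: (expR _) (cos _) => E C.
rewrite /c -/Q -wh.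
have Q0 : 1 - Q != 0 by rewrite subr_eq0 gt_eqF.
move: s0 M0; rewrite !exprMn -mulrDl pmulr_lgt0 ?exprn_gt0//.
move: (m.+1%:R : R) (n%:R : R) Q Q0 {q0 q1 c ie} => M N Q Q0 s0 M0.
by field; rewrite W0 Q0 M0 gt_eqF.
Qed.
End green_coef_integrals.

(** * The Green function on a quarter of the period cell *)

Section green_half_square.
Variable R : realType.
Notation mu := (@lebesgue_measure R).
Notation mu2 := (@lebesgue2 R).
Variables (h w : R).
Hypotheses (h0 : 0 < h) (wh : w * h = pi).

Let w0 : 0 < w.
Proof. by rewrite -(pmulr_lgt0 _ h0) wh pi_gt0. Qed.

(** The axes are left out: [green_bounded] asks for a positive first coordinate,
    [integral_green_cos] for a positive second one. *)
Definition half_square : set (R * R) := `]0, h] `*` `]0, h].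

Lemma measurable_half_square : measurable half_square.
Proof. by apply: measurableX; exact: measurable_itv. Qed.

Lemma half_square_itv (z : R * R) : half_square z ->
  (0 < w * z.1 <= pi) /\ (0 < w * z.2 <= pi).
Proof.
rewrite /half_square /= !in_itv /= => -[/andP[x0 xh] /andP[y0 yh]].
by rewrite !mulr_gt0//= -wh !ler_pM2l// xh yh.
Qed.

Lemma measurable_log_quad (r t : R * R -> R) :
  measurable_fun half_square r -> measurable_fun half_square t ->
  measurable_fun half_square (fun z => log_quad (r z) (cos (t z))).
Proof.
move=> mr mt; apply: measurableT_comp; first exact: measurable_ln.
have mc : measurable_fun half_square (fun z => cos (t z)).
  apply: measurableT_comp => //; apply: continuous_measurable_fun; exact: continuous_cos.
apply: measurable_funD; last exact: measurable_funX.
apply: measurable_funB => //.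
apply: measurable_funM => //; apply: measurable_funM => //.
Qed.

Lemma measurable_green_tail (a t : R * R -> R) :
  measurable_fun half_square a -> measurable_fun half_square t ->
  (forall z, half_square z -> 0 <= a z <= expR pi) ->
  measurable_fun half_square (fun z => green_tail (a z) (t z)).
Proof.
move=> ma mt a01.
apply: (measurable_fun_cvg (h := fun K z => series (tail_term (a z) (t z)) K)).
- move=> K; rewrite /series /=.
  have -> : (fun z => \sum_(0 <= k < K) tail_term (a z) (t z) k) =
     (fun z => \sum_(k <- index_iota 0 K) tail_term (a z) (t z) k) by [].
  apply: measurable_sum => k.
  apply: measurable_log_quad => //.
  by apply: measurable_funM.
- move=> z Dz; exact: (@is_cvg_green_tail _ (a z) (t z) (a01 z Dz)).
Qed.

Lemma measurable_green : measurable_fun half_square (fun z => green (w * z.1) (w * z.2)).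
Proof.
have m1 : measurable_fun half_square (fun z => w * z.1).
  by apply: measurable_funM => //; exact: measurable_funTS.
have m2 : measurable_fun half_square (fun z => w * z.2).
  by apply: measurable_funM => //; exact: measurable_funTS.
have me : measurable_fun half_square (fun z => expR (w * z.2)) by apply: measurableT_comp.
have men : measurable_fun half_square (fun z => expR (- (w * z.2))).
  by apply: measurableT_comp => //; exact: measurable_funN.
have b (z : R * R) : half_square z -> 0 <= w * z.2 <= pi.
  by move=> /half_square_itv[_ /andP[/ltW-> ->]].
apply: measurable_funB.
  apply: measurable_funD => //; apply: measurable_funB.
    by apply: measurable_funM => //; exact: measurable_funX.
  by apply: measurable_funM.
apply: measurable_funM => //; apply: measurable_funD.
  apply: measurable_funD; first exact: measurable_log_quad.
  by apply: measurable_green_tail => // z /b /expR_itv[].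
by apply: measurable_green_tail => // z /b /expR_itv[].
Qed.

(** By [green_bounded] the singularity is logarithmic. On this bounded set [gauss2] is at least [G],
    so the Gaussian majorant of the logarithm, divided by [G], dominates the function. *)
Lemma integrable_green_half : mu2.-integrable half_square (EFin \o (fun z => green (w * z.1) (w * z.2))).
Proof.
have [C C0 HC] := green_bounded R.
have mD : @measurable _ (measurableTypeR R * measurableTypeR R)%type half_square.
  exact: measurable_half_square.
have sub : half_square `<=` `]0, +oo[%classic `*` `]0, +oo[%classic.
  by move=> z; rewrite /half_square /= !in_itv/= !andbT => -[/andP[? _] /andP[? _]].
have I : mu2.-integrable half_square (fun z => ((1 + `|ln (z.1 ^+ 2 + z.2 ^+ 2)| +
    (z.1 ^+ 2 + z.2 ^+ 2)) * gauss2 z)%:E).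
  apply: (integrableS _ _ _ (integrable_log_gauss2_majorant R)).
  - exact: measurable_quadrant.
  - exact: mD.
  - exact: sub.
pose G := expR (- (pi * (h ^+ 2 + h ^+ 2))).
have G0 : 0 < G by exact: expR_gt0.
have pi0 := @pi_ge0 R.
pose K := (C + pi * `|ln (w ^+ 2)| + pi) / G.
have A0 : 0 <= C + pi * `|ln (w ^+ 2)| + pi by apply: addr_ge0 => //; apply: addr_ge0 => //; apply: mulr_ge0.
have K0 : 0 <= K by apply: divr_ge0 => //; exact: ltW.
apply: (le_integrable mD _ _ (integrableZl mD K I)).
  by apply/measurable_EFinP; exact: measurable_green.
move=> z Dz /=; rewrite lee_fin.
have [/andP[x0 xp] /andP[y0 yp]] := half_square_itv Dz.
move: Dz; rewrite /half_square /= !in_itv /= => -[/andP[z10 z1h] /andP[z20 z2h]].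
have := HC (w * z.1) (w * z.2); rewrite x0 xp (ltW y0) yp => /(_ isT isT).
set s := z.1 ^+ 2 + z.2 ^+ 2.
have s0 : 0 < s by rewrite addr_gt0// exprn_gt0.
have -> : (w * z.1) ^+ 2 + (w * z.2) ^+ 2 = w ^+ 2 * s by rewrite /s; ring.
rewrite lnM ?posrE ?exprn_gt0// => hb.
have gG : G <= gauss2 z.
  rewrite gauss2E ler_expR lerN2 ler_wpM2l// lerD// lerXn2r// nnegrE ltW//.
have B : `|green (w * z.1) (w * z.2)| <= (C + pi * `|ln (w ^+ 2)| + pi) * (1 + `|ln s| + s).
  have -> : green (w * z.1) (w * z.2) = (green (w * z.1) (w * z.2) + pi * (ln (w ^+ 2) + ln s)) - pi * (ln (w ^+ 2) + ln s) by ring.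
  apply: (le_trans (ler_normB _ _)).
  rewrite normrM (ger0_norm pi0).
  have h1 : `|ln (w ^+ 2) + ln s| <= `|ln (w ^+ 2)| + `|ln s| by exact: ler_normD.
  have h2 : pi * `|ln (w ^+ 2) + ln s| <= pi * (`|ln (w ^+ 2)| + `|ln s|) by rewrite ler_wpM2l.
  apply: (le_trans (lerD hb h2)).
  have a0 := normr_ge0 (ln (w ^+ 2)); have b0 := normr_ge0 (ln s).
  move: `|ln (w ^+ 2)| a0 `|ln s| b0 => a a0 b b0.
  have ? : 0 <= pi * a by rewrite mulr_ge0.
  have ? : 0 <= C * (b + s) by rewrite mulr_ge0// addr_ge0// ltW.
  have ? : 0 <= pi * a * (b + s) by rewrite mulr_ge0// addr_ge0// ltW.
  have ? : 0 <= pi * s by rewrite mulr_ge0// ltW.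
  move: (pi : R) pi0 => p *; nra.
have S0 : 0 <= 1 + `|ln s| + s by apply: addr_ge0; [apply: addr_ge0|exact: ltW].
have g0 : 0 <= gauss2 z by rewrite gauss2E expR_ge0.
apply: (le_trans B); rewrite [leRHS]ger0_norm; last first.
  by apply: mulr_ge0 => //; apply: mulr_ge0.
rewrite /K -mulrA ler_wpM2l// mulrCA ler_peMr//.
by rewrite mulrC ler_pdivlMr// mul1r.
Qed.

(** This is where [green] is recognized: up to the size of the cell, these are the coefficients
    [1 / (m^2 + n^2)] of E_N. The one-dimensional formulas hold on closed intervals, which differ
    from the present ones by null sets. *)
Lemma integral_half_square_cos (m n : nat) :
  \int[mu2]_(z in half_square) (green (w * z.1) (w * z.2) * (cos (m%:R * w * z.1) * cos (n%:R * w * z.2))) =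
  if (m == 0%N) && (n == 0%N) then 0 else h ^+ 2 / (m%:R ^+ 2 + n%:R ^+ 2).
Proof.
pose f (z : R * R) := green (w * z.1) (w * z.2) * (cos (m%:R * w * z.1) * cos (n%:R * w * z.2)).
have mD : @measurable _ (measurableTypeR R * measurableTypeR R)%type half_square.
  exact: measurable_half_square.
have mcos (c : R) : measurable_fun setT (fun x : R => cos (c * x)).
  by apply: continuous_measurable_fun; exact: continuous_cosM.
have If : mu2.-integrable half_square (EFin \o f).
  apply: (integrable_bounded_mul (C := 1) mD integrable_green_half).
    by apply: measurable_funTS; apply: measurable_funM; apply: (measurableT_comp (mcos _)).
  by move=> z _; rewrite normrM -[1]mulr1 ler_pM// cos_max.
rewrite /Rintegral (Fubini_rect _ _ If)//.
transitivity (fine (\int[mu]_(y in `]0, h]) (green_coef h m (w * y) * cos (n%:R * w * y))%:E)).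
  congr fine; apply: eq_integral => y; rewrite mem_setE/= in_itv/= => /andP[y0 yh].
  have yp : 0 < w * y <= pi by rewrite mulr_gt0//= -wh ler_pM2l.
  have [i e] := integral_green_cos h0 wh m yp.
  have mI : @measurable _ (measurableTypeR R) `[0, h] by exact: measurable_itv.
  have mI' : @measurable _ (measurableTypeR R) `]0, h] by exact: measurable_itv.
  have sI : `]0, h] `<=` `[0, h] by exact: subset_itv_oc_cc.
  have i' : mu.-integrable `[0, h] (EFin \o (fun x : R => f (x, y))).
    have /(eq_integrable mI) := integrable_lin mI (cos (n%:R * w * y)) 0 i i.
    by apply => x _ /=; rewrite mul0r addr0 /f /= [in RHS]mulrA [in LHS]mulrC.
  have i'' := integrableS mI mI' sI i'.
  have -> : (\int[mu]_(x in `]0%R, h]) (f (x, y))%:E = (\int[mu]_(x in `]0%R, h]) f (x, y))%R%:E)%E.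
    by rewrite /Rintegral fineK//; exact: (integrable_fin_num mI' i'').
  rewrite (Rintegral_itv_obnd_cbnd i'').
  transitivity ((\int[mu]_(x in `[0, h]) (cos (n%:R * w * y) * (green (w * x) (w * y) * cos (m%:R * w * x)))))%:E.
    by congr EFin; apply: eq_Rintegral => x _; rewrite /f /= mulrA [LHS]mulrC.
  by rewrite RintegralZl// e mulrC.
have ic' : mu.-integrable `[0, h] (EFin \o (fun y : R => green_coef h m (w * y) * cos (n%:R * w * y))).
  apply: continuous_integrable => y; apply: cvgM; last exact: continuous_cosM.
  case: m {f If} => [|m] /=.
    apply: cvgM; first exact: cvg_cst.
    exact: continuous_quadratic.
  have ce (c : R) : expR (c * (w * x)) @[x --> y] --> expR (c * (w * y)).
    apply: (@continuous_comp _ _ _ (fun x : R => c * (w * x)) (@expR R)).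
      by apply: cvgM; [exact: cvg_cst|apply: cvgM; [exact: cvg_cst|exact: cvg_id]].
    exact: continuous_expR.
  apply: cvgM; first exact: cvg_cst.
  apply: cvgD; first exact: ce.
  by apply: cvgM; [exact: cvg_cst|exact: ce].
have ic : mu.-integrable `]0, h] (EFin \o (fun y : R => green_coef h m (w * y) * cos (n%:R * w * y))).
  apply: (integrableS _ _ _ ic'); [exact: measurable_itv|exact: measurable_itv|exact: subset_itv_oc_cc].
by have := Rintegral_itv_obnd_cbnd ic; rewrite /Rintegral => ->; exact: integral_green_coef_cos.
Qed.
End green_half_square.

(** * Replacing E_N by the Green function *)

Section tensor_functional.
Variable R : realType.
Notation mu2 := (@lebesgue2 R).
Variables (D : set (R * R)) (k : R * R -> R).
Hypotheses (mD : @measurable _ (measurableTypeR R * measurableTypeR R)%type D) (ik : mu2.-integrable D (EFin \o k)).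

Definition bounded_measurable (a : R -> R) : Prop :=
  measurable_fun setT a /\ exists C : R, forall x, `|a x| <= C.

Lemma bounded_measurable_lin (s t : R) (a b : R -> R) :
  bounded_measurable a -> bounded_measurable b ->
  bounded_measurable (fun x => s * a x + t * b x).
Proof.
move=> [ma [A HA]] [mb [B HB]]; split.
  by apply: measurable_funD; apply: measurable_funM.
exists (`|s| * A + `|t| * B) => x.
by apply: (le_trans (ler_normD _ _)); rewrite !normrM lerD// ler_wpM2l.
Qed.

Lemma integrable_tensor (a b : R -> R) : bounded_measurable a -> bounded_measurable b ->
  mu2.-integrable D (EFin \o (fun z => k z * (a z.1 * b z.2))).
Proof.
move=> [ma [A HA]] [mb [B HB]].
apply: (integrable_bounded_mul (C := A * B) mD ik).
  apply: measurable_funTS.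
  by apply: measurable_funM; [apply: (measurableT_comp ma)|apply: (measurableT_comp mb)].
by move=> z _; rewrite normrM ler_pM.
Qed.

Lemma tensor_linl (s t : R) (a b c : R -> R) :
  bounded_measurable a -> bounded_measurable b -> bounded_measurable c ->
  \int[mu2]_(z in D) (k z * ((s * a z.1 + t * b z.1) * c z.2)) =
  s * \int[mu2]_(z in D) (k z * (a z.1 * c z.2)) + t * \int[mu2]_(z in D) (k z * (b z.1 * c z.2)).
Proof.
move=> ha hb hc.
rewrite -(Rintegral_lin _ s t (integrable_tensor ha hc) (integrable_tensor hb hc))//.
by apply: eq_Rintegral => z _; ring.
Qed.

Lemma tensor_linr (s t : R) (a b c : R -> R) :
  bounded_measurable a -> bounded_measurable b -> bounded_measurable c ->
  \int[mu2]_(z in D) (k z * (c z.1 * (s * a z.2 + t * b z.2))) =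
  s * \int[mu2]_(z in D) (k z * (c z.1 * a z.2)) + t * \int[mu2]_(z in D) (k z * (c z.1 * b z.2)).
Proof.
move=> ha hb hc.
rewrite -(Rintegral_lin _ s t (integrable_tensor hc ha) (integrable_tensor hc hb))//.
by apply: eq_Rintegral => z _; ring.
Qed.

(** Factors bounded by 1 make [|k|] a majorant, so pointwise convergence is enough even for an
    unbounded [k]. *)
Lemma tensor_cvg (a_ : nat -> R -> R) (a : R -> R) (I : set R) :
  (forall z, D z -> I z.1 /\ I z.2) ->
  (forall n, bounded_measurable (a_ n)) -> (forall n x, I x -> `|a_ n x| <= 1) ->
  (forall x, I x -> a_ n x @[n --> \oo] --> a x) ->
  \int[mu2]_(z in D) (k z * (a_ n z.1 * a_ n z.2)) @[n --> \oo] -->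
  \int[mu2]_(z in D) (k z * (a z.1 * a z.2)).
Proof.
move=> DI ha a1 acvg.
have [|||] := @dominated_Rintegral R _ (measurableTypeR R * measurableTypeR R)%type _ D
  (fun n z => k z * (a_ n z.1 * a_ n z.2)) (fun z => k z * (a z.1 * a z.2)) _ mD _ _ (integrable_norm ik); last by [].
- move=> n; apply/measurable_EFinP; apply: measurable_int.
  exact: (integrable_tensor (ha n) (ha n)).
- move=> z /DI[I1 I2]; apply: cvgM; first exact: cvg_cst.
  by apply: cvgM; exact: acvg.
- move=> n z /DI[I1 I2] /=; rewrite normrM ler_piMr// normrM.
  by rewrite mulr_ile1// a1.
Qed.

End tensor_functional.

Section cosine_polynomials.
Variable R : realType.
Variable w : R.

(** Finite cosine sums as an inductive predicate, so that an identity linear in each factor follows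
    by induction from pure cosines. *)
Inductive cos_poly : (R -> R) -> Prop :=
| cos_poly_cos n : cos_poly (fun x => cos (n%:R * w * x))
| cos_poly_lin s t p q : cos_poly p -> cos_poly q -> cos_poly (fun x => s * p x + t * q x).

Lemma cos_poly_ext p q : p =1 q -> cos_poly p -> cos_poly q.
Proof. by move=> /funext ->. Qed.

Lemma cos_poly_bounded p : cos_poly p -> bounded_measurable p.
Proof.
elim=> [n|s t f g _ hf _ hg]; last exact: bounded_measurable_lin.
split; last by exists 1 => x; exact: cos_max.
by apply: continuous_measurable_fun; exact: continuous_cosM.
Qed.

(** The product formula shifts the frequency by one both ways; frequency 0 is treated apart. *)
Lemma cos_poly_mul_cos p : cos_poly p -> cos_poly (fun x => p x * cos (w * x)).
Proof.
elim=> [n|s t f g _ hf _ hg]; last first.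
  by apply: cos_poly_ext (cos_poly_lin s t hf hg) => x /=; ring.
case: n => [|n].
  apply: cos_poly_ext (cos_poly_cos 1) => x /=.
  by rewrite !mul0r cos0 !mul1r.
apply: cos_poly_ext (cos_poly_lin 2^-1 2^-1 (cos_poly_cos n.+2) (cos_poly_cos n)) => x /=.
have -> : n.+2%:R * w * x = n.+1%:R * w * x + w * x by rewrite -[n.+2%:R]natr1; ring.
have -> : n%:R * w * x = n.+1%:R * w * x - w * x by rewrite -[n.+1%:R]natr1; ring.
by rewrite cosD cosB; field.
Qed.

End cosine_polynomials.

Section green_transfer.
Variable R : realType.
Notation mu2 := (@lebesgue2 R).
Variables (N : R) (f : R * R -> R).
Hypotheses (N0 : 0 < N) (hf : is_EN N f).

Let h := N / 2.
Let w := 2 * pi / N.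
Let h0 : 0 < h. Proof. by rewrite divr_gt0. Qed.
Let wh : w * h = pi.
Proof. by rewrite /w /h; move: (pi : R) => p; field; rewrite gt_eqF. Qed.

Lemma measurable_square2 : measurable (square N).
Proof. by apply: measurableX; exact: measurable_itv. Qed.

(** The product of cosines is the half-sum of the cosines of the sum and of the difference; the
    corresponding coefficients of E_N, at [(m, n)] and [(m, - n)], coincide. *)
Lemma EN_integral_cos (m n : nat) :
  \int[mu2]_(z in square N) (f z * (cos (m%:R * w * z.1) * cos (n%:R * w * z.2))) =
  if (m == 0%N) && (n == 0%N) then 0 else N ^+ 2 / (m%:R ^+ 2 + n%:R ^+ 2).
Proof.
have e1 := EN_fourier_cos N0 hf m n.
have e2 := EN_fourier_cos N0 hf m (- n%:Z).
have mS : @measurable _ (measurableTypeR R * measurableTypeR R)%type (square N).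
  exact: measurable_square2.
have ic (a b : int) : mu2.-integrable (square N) (EFin \o (fun x : R * R => f x * cos (2 * pi / N * (a%:~R * x.1 + b%:~R * x.2)))).
  apply: (integrable_bounded_mul (C := 1) mS (EN_integrable N0 hf)).
    apply: measurable_funTS; apply: (measurableT_comp (f := @cos R)).
      by apply: continuous_measurable_fun; exact: continuous_cos.
    apply: measurable_funM => //.
    by apply: measurable_funD; apply: measurable_funM.
  by move=> z _; exact: cos_max.
transitivity (\int[mu2]_(z in square N) (2^-1 * (f z * cos (2 * pi / N * ((m : int)%:~R * z.1 + (n : int)%:~R * z.2))) +
   2^-1 * (f z * cos (2 * pi / N * ((m : int)%:~R * z.1 + (- n%:Z)%:~R * z.2))))).
  apply: eq_Rintegral => z _.
  have -> : 2 * pi / N * (m%:~R * z.1 + n%:~R * z.2) = m%:R * w * z.1 + n%:R * w * z.2.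
    by rewrite /w !pmulrn; ring.
  have -> : 2 * pi / N * (m%:~R * z.1 + (- n%:Z)%:~R * z.2) = m%:R * w * z.1 - n%:R * w * z.2.
    by rewrite /w mulrNz !pmulrn; ring.
  by rewrite cosD cosB; field.
rewrite (Rintegral_lin mS 2^-1 2^-1 (ic m n) (ic m (- n%:Z))) e1 e2.
have -> : ((m%:Z, - n%:Z) == (0, 0)) = ((m == 0%N) && (n == 0%N)).
  by rewrite xpair_eqE oppr_eq0.
have -> : ((m%:Z, n%:Z) == (0, 0)) = ((m == 0%N) && (n == 0%N)) by [].
case: ifP => _; first by rewrite mulr0 addr0.
have e : 2^-1 + 2^-1 = 1 :> R by field.
by rewrite mulrNz sqrrN -mulrDl e mul1r.
Qed.

(** On pure cosines the two integrals are [N^2] and [h^2] divided by [m^2 + n^2], whence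
    [4 = (N / h)^2]; bilinearity does the rest. *)
Lemma EN_green_cos_poly p q : cos_poly w p -> cos_poly w q ->
  \int[mu2]_(z in square N) (f z * (p z.1 * q z.2)) =
  4 * \int[mu2]_(z in half_square h) (green (w * z.1) (w * z.2) * (p z.1 * q z.2)).
Proof.
have iE := EN_integrable N0 hf.
have iG := integrable_green_half h0 wh.
have mS : @measurable _ (measurableTypeR R * measurableTypeR R)%type (square N).
  exact: measurable_square2.
have mH : @measurable _ (measurableTypeR R * measurableTypeR R)%type (half_square h).
  exact: measurable_half_square.
move=> hp; elim: hp q => [m|s t a b ha IHa hb IHb] q hq; last first.
  have [? ?] := (cos_poly_bounded ha, cos_poly_bounded hb).
  have ? := cos_poly_bounded hq.
  rewrite (tensor_linl mS iE)// (tensor_linl mH iG)// IHa// IHb//; ring.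
elim: hq => [n|s t a b ha IHa hb IHb]; last first.
  have [ba bb] := (cos_poly_bounded ha, cos_poly_bounded hb).
  have bc := cos_poly_bounded (cos_poly_cos w m).
  move: (tensor_linr mS iE s t ba bb bc) (tensor_linr mH iG s t ba bb bc) => /= -> ->.
  by rewrite IHa IHb; ring.
rewrite EN_integral_cos (integral_half_square_cos h0 wh).
case: ifP => _; first by rewrite mulr0.
by rewrite /h; move: ((m%:R ^+ 2 + n%:R ^+ 2)^-1) => i; field.
Qed.
End green_transfer.

(** * Pointwise approximation by Bernstein polynomials *)

Section bernstein.
Variable R : realType.
Implicit Types (t c : R) (phi psi : nat -> R).

(* The expectation of phi at a binomial variable of parameters n and t. *)
Fixpoint bernstein (n : nat) (t : R) (phi : nat -> R) : R :=
  if n is n'.+1 then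
    t * bernstein n' t (fun j => phi j.+1) + (1 - t) * bernstein n' t phi
  else phi 0%N.

Arguments bernstein : simpl never.

Lemma bernsteinS n t phi : bernstein n.+1 t phi =
  t * bernstein n t (fun j => phi j.+1) + (1 - t) * bernstein n t phi.
Proof. by []. Qed.

Lemma bernstein_le n t phi psi : 0 <= t <= 1 ->
  (forall j, (j <= n)%N -> phi j <= psi j) -> bernstein n t phi <= bernstein n t psi.
Proof.
move=> /andP[t0 t1]; elim: n phi psi => [|n IH] phi psi H; first exact: H.
rewrite !bernsteinS.
by apply: lerD; apply: ler_wpM2l; rewrite ?subr_ge0//; apply: IH => j jn; apply: H => //; exact: ltnW.
Qed.

Lemma bernstein_affine n t a b phi :
  bernstein n t (fun j => a + b * phi j) = a + b * bernstein n t phi.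
Proof.
elim: n phi => [|n IH] phi //.
by rewrite !bernsteinS (IH (fun j => phi j.+1)) IH; ring.
Qed.

Lemma bernstein_cst n t c : bernstein n t (fun=> c) = c.
Proof. by elim: n => [|n IH] //; rewrite bernsteinS IH; ring. Qed.

(** The offset [c] closes the induction: conditioning on one trial moves it by [1 - t] or by
    [- t]. *)
Lemma bernstein_variance n t c :
  bernstein n t (fun j => (j%:R + c - n%:R * t) ^+ 2) = n%:R * t * (1 - t) + c ^+ 2.
Proof.
elim: n c => [|n IH] c; first by rewrite /bernstein; ring.
rewrite bernsteinS.
have -> : (fun j : nat => (j.+1%:R + c - n.+1%:R * t) ^+ 2) =
    (fun j : nat => (j%:R + (c + 1 - t) - n%:R * t) ^+ 2).
  by apply/funext => j; rewrite -[j.+1%:R]natr1 -[n.+1%:R]natr1; ring.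
have -> : (fun j : nat => (j%:R + c - n.+1%:R * t) ^+ 2) =
    (fun j : nat => (j%:R + (c - t) - n%:R * t) ^+ 2).
  by apply/funext => j; rewrite -[n.+1%:R]natr1; ring.
by rewrite !IH -[n.+1%:R]natr1; ring.
Qed.

Lemma bernstein0 n phi : bernstein n 0 phi = phi 0%N.
Proof. by elim: n => [|n IH] //; rewrite bernsteinS IH; ring. Qed.

Lemma bernstein1 n phi : bernstein n 1 phi = phi n.
Proof. by elim: n phi => [|n IH] phi //; rewrite bernsteinS !IH; ring. Qed.

Lemma norm_bernstein_le n t phi c : 0 <= t <= 1 ->
  (forall j, (j <= n)%N -> `|phi j| <= c) -> `|bernstein n t phi| <= c.
Proof.
move=> t01 H; rewrite ler_norml -{1}(bernstein_cst n t (- c)) -{2}(bernstein_cst n t c).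
by rewrite !bernstein_le// => j /H; rewrite ler_norml => /andP[].
Qed.

(** Chebyshev's argument. Within [d] of [t], continuity applies; farther away
    [|f x - f t| <= 2 <= 2 ((x - t) / d)^2], and the mean of this square is a variance of order
    [1 / n]. *)
Lemma bernstein_cvg (f : R -> R) t : 0 <= t <= 1 ->
  (forall x : R, 0 <= x <= 1 -> `|f x| <= 1) -> f x @[x --> t] --> f t ->
  bernstein n.+1 t (fun j => f (j%:R / n.+1%:R)) @[n --> \oo] --> f t.
Proof.
move=> t01 f1 fc; have /andP[t0 t1] := t01.
apply/cvgrPdist_le => e e0.
move/cvgrPdist_le : fc => /(_ (e / 2)); rewrite divr_gt0// => /(_ isT) [d /= d0 hd].
have d20 : 0 < d ^+ 2 by rewrite exprn_gt0.
have lim0 : 2 / d ^+ 2 / n.+1%:R @[n --> \oo] --> (0 : R).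
  rewrite -[X in _ --> X](mulr0 (2 / d ^+ 2)); apply: cvgM; first exact: cvg_cst.
  exact: cvg_harmonic.
move/cvgrPdist_le : lim0 => /(_ (e / 2)); rewrite divr_gt0// => /(_ isT).
apply: filterS => n; rewrite sub0r normrN => hn.
have N0 : 0 < n.+1%:R :> R by [].
have pt (j : nat) : (j <= n.+1)%N ->
    `|f (j%:R / n.+1%:R) - f t| <= e / 2 + 2 / d ^+ 2 / n.+1%:R ^+ 2 * (j%:R + 0 - n.+1%:R * t) ^+ 2.
  move=> jn.
  have x01 : 0 <= (j%:R / n.+1%:R : R) <= 1.
    by rewrite divr_ge0//= ler_pdivrMr// mul1r ler_nat.
  have -> : 2 / d ^+ 2 / n.+1%:R ^+ 2 * (j%:R + 0 - n.+1%:R * t) ^+ 2 =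
    2 * ((j%:R / n.+1%:R - t) / d) ^+ 2.
    by field; rewrite !gt_eqF.
  move: (j%:R / n.+1%:R) x01 => x x01.
  have [xd|xd] := ltP `|t - x| d.
    rewrite distrC; apply: (le_trans (hd x xd)).
    by rewrite lerDl mulr_ge0// sqr_ge0.
  have : `|f x - f t| <= 2 by apply: (le_trans (ler_normB _ _)); rewrite -[2]/(1 + 1) lerD ?f1.
  move=> /le_trans; apply.
  have : 1 <= ((x - t) / d) ^+ 2.
    rewrite -[X in X <= _](expr1n _ 2) -[((x - t) / d) ^+ 2]real_normK ?num_real// lerXn2r ?nnegrE//.
    by rewrite normrM normfV (gtr0_norm d0) ler_pdivlMr// mul1r distrC.
  by move: (_ ^+ 2) => ?; lra.
rewrite distrC.
have -> : bernstein n.+1 t (fun j => f (j%:R / n.+1%:R)) - f t =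
    bernstein n.+1 t (fun j => - f t + 1 * f (j%:R / n.+1%:R)).
  by rewrite bernstein_affine mul1r addrC.
pose B := e / 2 + 2 / d ^+ 2 / n.+1%:R ^+ 2 * (n.+1%:R * t * (1 - t) + 0 ^+ 2).
have BE : bernstein n.+1 t (fun j => e / 2 + 2 / d ^+ 2 / n.+1%:R ^+ 2 * (j%:R + 0 - n.+1%:R * t) ^+ 2) = B.
  by rewrite bernstein_affine bernstein_variance.
apply: (@le_trans _ _ B).
  rewrite ler_norml; apply/andP; split.
    rewrite -BE -[X in X <= _]mulN1r -[X in X <= _]add0r -bernstein_affine.
    apply: bernstein_le => // j jn; rewrite add0r mulN1r mul1r [- f t + _]addrC.
    by have := pt j jn; rewrite ler_norml => /andP[].
  rewrite -BE; apply: bernstein_le => // j jn; rewrite mul1r [- f t + _]addrC.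
  by have := pt j jn; rewrite ler_norml => /andP[].
have -> : B = e / 2 + 2 / d ^+ 2 / n.+1%:R * (t * (1 - t)).
  by rewrite /B; field; rewrite !gt_eqF.
have A0 : 0 <= 2 / d ^+ 2 / n.+1%:R by rewrite !divr_ge0// ltW.
rewrite ger0_norm// in hn.
have tt : 0 <= t * (1 - t) <= 1 by apply/andP; split; nra.
have : 2 / d ^+ 2 / n.+1%:R * (t * (1 - t)) <= 2 / d ^+ 2 / n.+1%:R.
  by rewrite ler_piMr//; case/andP: tt.
move=> H; apply: (le_trans (lerD (lexx _) (le_trans H hn))).
by rewrite -splitr.
Qed.

(** The recursion only multiplies by [(1 + cos) / 2] and [(1 - cos) / 2], under which cosine
    polynomials are stable. *)
Lemma cos_poly_bernstein (w : R) n phi :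
  cos_poly w (fun x => bernstein n ((1 + cos (w * x)) / 2) phi).
Proof.
elim: n phi => [|n IH] phi.
  apply: cos_poly_ext (cos_poly_lin (phi 0%N) 0 (cos_poly_cos w 0) (cos_poly_cos w 0)) => x /=.
  by rewrite /bernstein !mul0r cos0 mulr1 addr0.
have A := IH (fun j => phi j.+1); have B := IH phi.
apply: cos_poly_ext (cos_poly_lin 1 2^-1
  (cos_poly_lin 2^-1 2^-1 A (cos_poly_mul_cos A))
  (cos_poly_lin 1 (-1) B (cos_poly_mul_cos B))) => x /=; rewrite bernsteinS.
by move: (cos _) (bernstein _ _ _) (bernstein _ _ _) => ? ? ?; field.
Qed.

End bernstein.

Section green_gauss.
Variable R : realType.
Notation mu2 := (@lebesgue2 R).
Variables (N : R) (f : R * R -> R).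
Hypotheses (N0 : 0 < N) (hf : is_EN N f).

Let h := N / 2.
Let w := 2 * pi / N.
Let h0 : 0 < h. Proof. by rewrite divr_gt0. Qed.
Let wh : w * h = pi.
Proof. by rewrite /w /h; move: (pi : R) => p; field; rewrite gt_eqF. Qed.
Let w0 : 0 < w.
Proof. by rewrite -(pmulr_lgt0 _ h0) wh pi_gt0. Qed.

Lemma gauss1_fold_sym (u : R) : gauss1_fold N (N - u) = gauss1_fold N u.
Proof.
rewrite /gauss1_fold /gauss1 (_ : N - u - N = - u); last by ring.
rewrite sqrrN (_ : (N - u) ^+ 2 = (u - N) ^+ 2); last by ring.
by move: (expR _) (expR _) => a b; field; rewrite gt_eqF.
Qed.

Lemma continuous_gauss1_fold : continuous (gauss1_fold N).
Proof.
move=> x; rewrite /gauss1_fold.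
have d : x / N @[x --> x] --> x / N by apply: cvgM; [exact: cvg_id|exact: cvg_cst].
apply: cvgD; apply: cvgM => //.
- by apply: cvgB => //; exact: cvg_cst.
- exact: continuous_gauss1.
- apply: (@continuous_comp _ _ _ (fun x : R => x - N) (@gauss1 R)); last exact: continuous_gauss1.
  by apply: cvgB; [exact: cvg_id|exact: cvg_cst].
Qed.

(** [gauss1_fold] on [[0, h]], read in the variable [t = (1 + cos (w x)) / 2]. *)
Let phi (t : R) : R := gauss1_fold N (acos (2 * t - 1) / w).

Let phi_le (t : R) : 0 <= t <= 1 -> `|phi t| <= 1.
Proof.
move=> t01; have c1 : -1 <= 2 * t - 1 <= 1 by lra.
have u01 : 0 <= acos (2 * t - 1) / w <= N.
  rewrite divr_ge0 ?acos_ge0 ?(ltW w0)//= ler_pdivrMr//.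
  apply: (le_trans (acos_lepi c1)).
  by rewrite /w mulrC divfK ?gt_eqF// ler_pMl ?pi_gt0// ler1n.
by have /andP[p0 p1] := gauss1_fold_itv N0 u01; rewrite ger0_norm.
Qed.

Let phi_cos (x : R) : 0 <= x <= h -> phi ((1 + cos (w * x)) / 2) = gauss1_fold N x.
Proof.
move=> /andP[x0 xh]; rewrite /phi (_ : 2 * _ - 1 = cos (w * x)); last by field.
rewrite cosK; last by rewrite in_itv/= mulr_ge0 ?(ltW w0)//= -wh ler_pM2l.
by congr gauss1_fold; field; rewrite gt_eqF.
Qed.

Let phi_cvg (t : R) : 0 < t < 1 -> phi x @[x --> t] --> phi t.
Proof.
move=> t01.
apply: (@continuous_comp _ _ _ (fun t : R => acos (2 * t - 1) / w) (gauss1_fold N)); last exact: continuous_gauss1_fold.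
apply: cvgM; last exact: cvg_cst.
apply: (@continuous_comp _ _ _ (fun t : R => 2 * t - 1) (@acos R)).
  by apply: cvgB; [apply: cvgM; [exact: cvg_cst|exact: cvg_id]|exact: cvg_cst].
by apply: continuous_acos; lra.
Qed.

Let approx (n : nat) (x : R) : R :=
  bernstein n.+1 ((1 + cos (w * x)) / 2) (fun j => phi (j%:R / n.+1%:R)).

Let approx_cvg_half (x : R) : 0 <= x <= h -> approx n x @[n --> \oo] --> gauss1_fold N x.
Proof.
move=> x01; rewrite -phi_cos//.
have := cos_max (w * x); rewrite ler_norml => /andP[c1 c2].
have t01 : 0 <= (1 + cos (w * x)) / 2 <= 1 by lra.
(* At both ends of [[0, 1]], which [phi_cvg] does not cover, Bernstein polynomials take the exact
   value. *)
have [c0|c0] := eqVneq (cos (w * x)) (-1).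
  rewrite /approx c0 subrr mul0r; apply: cvg_near_cst; apply: nearW => n.
  by rewrite bernstein0 mul0r.
have [c0'|c0'] := eqVneq (cos (w * x)) 1.
  rewrite /approx c0' (_ : (1 + 1) / 2 = 1); last by field.
  apply: cvg_near_cst; apply: nearW => n.
  by rewrite bernstein1 divff.
apply: bernstein_cvg => //.
apply: phi_cvg.
have : -1 < cos (w * x) by rewrite lt_neqAle eq_sym c0.
have : cos (w * x) < 1 by rewrite lt_neqAle c0'.
lra.
Qed.

(** [cos (w x)] and [gauss1_fold] are both invariant under [x -> N - x], so convergence on [[0, h]]
    suffices. *)
Let approx_cvg (x : R) : 0 <= x <= N -> approx n x @[n --> \oo] --> gauss1_fold N x.
Proof.
move=> /andP[x0 xN]; have [xh|xh] := leP x h; first by apply: approx_cvg_half; rewrite x0.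
rewrite -gauss1_fold_sym.
have -> : approx ^~ x = approx ^~ (N - x).
  apply/funext => n; rewrite /approx.
  have -> : w * (N - x) = - (w * x) + pi *+ 2.
    by rewrite /w; move: (pi : R) => p; field; rewrite gt_eqF.
  by rewrite cosD2pi cosN.
by apply: approx_cvg_half; rewrite subr_ge0 xN/=; move: xh; rewrite /h; lra.
Qed.

(** Both sides are limits along the same cosine polynomials [approx], on which [EN_green_cos_poly]
    gives equality. *)
Lemma EN_green_gauss :
  \int[mu2]_(z in square N) (f z * (gauss1_fold N z.1 * gauss1_fold N z.2)) =
  4 * \int[mu2]_(z in half_square h) (green (w * z.1) (w * z.2) * (gauss1_fold N z.1 * gauss1_fold N z.2)).
Proof.
have iE := EN_integrable N0 hf.
have iG := integrable_green_half h0 wh.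
have mS : @measurable _ (measurableTypeR R * measurableTypeR R)%type (square N).
  exact: measurable_square2.
have mH : @measurable _ (measurableTypeR R * measurableTypeR R)%type (half_square h).
  exact: measurable_half_square.
have cp n : cos_poly w (approx n) by exact: cos_poly_bernstein.
have bm n := cos_poly_bounded (cp n).
have a1 n (x : R) : `|approx n x| <= 1.
  apply: norm_bernstein_le.
    by have := cos_max (w * x); rewrite ler_norml => /andP[c1 c2]; lra.
  move=> j jn; apply: phi_le.
  by rewrite divr_ge0//= ler_pdivrMr// mul1r ler_nat.
have L1 := tensor_cvg (I := `[0, N]) mS iE _ bm (fun n x _ => a1 n x) _.
have L2 := tensor_cvg (I := `[0, N]) mH iG _ bm (fun n x _ => a1 n x) _.
have ac (x : R) : `[0, N]%classic x -> approx n x @[n --> \oo] --> gauss1_fold N x.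
  by rewrite /= in_itv /=; exact: approx_cvg.
have {}L1 := L1 _ (fun z hz => hz) ac.
have {}L2 : \int[mu2]_(z in half_square h) (green (w * z.1) (w * z.2) * (approx n z.1 * approx n z.2)) @[n --> \oo] -->
   \int[mu2]_(z in half_square h) (green (w * z.1) (w * z.2) * (gauss1_fold N z.1 * gauss1_fold N z.2)).
  apply: L2 => // z; rewrite /half_square /= !in_itv /= => -[/andP[z1 z1h] /andP[z2 z2h]].
  by rewrite /h in z1h z2h; split; lra.
have L3 : \int[mu2]_(z in square N) (f z * (approx n z.1 * approx n z.2)) @[n --> \oo] -->
   4 * \int[mu2]_(z in half_square h) (green (w * z.1) (w * z.2) * (gauss1_fold N z.1 * gauss1_fold N z.2)).
  under eq_fun do rewrite (EN_green_cos_poly N0 hf (cp _) (cp _)).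
  by apply: cvgM; [exact: cvg_cst|exact: L2].
exact: (cvg_unique _ L1 L3).
Qed.

End green_gauss.

(** * The limit *)

Section eta.
Variable R : realType.
Local Notation "x %:C" := (real_complex R x).

Lemma tail_termE (k : nat) : tail_term (1 : R) 0 k = 2 * ln (1 - nome R ^+ k.+1).
Proof.
have /andP[q0 q1] := @nome_pow_lt1 R k.
rewrite /tail_term /log_quad cos0 !mulr1.
have -> : 1 - 2 * nome R ^+ k.+1 + (nome R ^+ k.+1) ^+ 2 = (1 - nome R ^+ k.+1) ^+ 2 by ring.
by rewrite lnXn ?subr_gt0// mulr_natl.
Qed.

(** By [tail_termE] the tail at [(1, 0)] is twice the logarithm of the Euler product, whence the
    factor [2^-1]. *)
Lemma euler_product_cvg :
  \prod_(1 <= k < n.+1) (1 - nome R ^+ k) @[n --> \oo] --> expR (2^-1 * green_tail (1 : R) 0).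
Proof.
have e1 := one_le_expRpi R.
have cv := @is_cvg_green_tail R 1 0 e1.
have E n : \prod_(1 <= k < n.+1) (1 - nome R ^+ k) = expR (2^-1 * series (tail_term (1 : R) 0) n).
  elim: n => [|n IH]; first by rewrite big_geq// /series /= big_geq// mulr0 expR0.
  have /andP[q0 q1] := @nome_pow_lt1 R n.
  rewrite big_nat_recr//= IH seriesSr [2^-1 * (_ + _)]mulrDr expRD; congr (_ * _).
  by rewrite tail_termE mulrA mulVf// mul1r lnK// posrE subr_gt0.
under eq_fun do rewrite E.
apply: continuous_cvg; first exact: continuous_expR.
by apply: cvgM; [exact: cvg_cst|exact: cv].
Qed.

(** At [tau = i] the number [exp(2 i pi tau)] is the real [nome], so every factor of the product is
    real. *)
Lemma dedekind_eta_i :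
  dedekind_eta ('i : R[i]) = (expR (- (pi / 12)) * expR (2^-1 * green_tail (1 : R) 0))%:C.
Proof.
rewrite /dedekind_eta.
have -> : 2%:R * 'i * pi%:C * 'i = (- (2 * pi) : R)%:C.
  have i2 : 'i * 'i = -1 :> R[i] by rewrite -expr2 sqrCi.
  have -> : 2%:R * 'i * pi%:C * 'i = 2%:R * ('i * 'i) * pi%:C :> R[i] by ring.
  by rewrite i2 rmorphN rmorphM rmorph_nat mulrN1 mulNr.
have -> : (- (2 * pi))%:C / 24%:R = (- (pi / 12) : R)%:C.
  have -> : (24%:R : R[i]) = (24%:R : R)%:C by rewrite rmorph_nat.
  rewrite -fmorph_div; congr (_%:C); move: (pi : R) => p; by field.
rewrite !Cexp_real.
have E n : \prod_(1 <= k < n.+1) (1 - (expR (- (2 * pi)))%:C ^+ k) =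
    (\prod_(1 <= k < n.+1) (1 - nome R ^+ k))%:C.
  rewrite rmorph_prod; apply: eq_bigr => k _.
  by rewrite rmorphB rmorph1 rmorphXn.
rewrite rmorphM; congr (_ * _).
rewrite /Clim; apply/eqP; rewrite eq_complex /=; apply/andP; split; apply/eqP.
  apply: cvg_lim => //; under eq_fun do rewrite E /=.
  exact: euler_product_cvg.
apply: cvg_lim => //; under eq_fun do rewrite E /=.
exact: cvg_cst.
Qed.

Lemma Re_eta_sqr :
  complex.Re (dedekind_eta ('i : R[i]) ^+ 2) = expR (- (pi / 6) + green_tail (1 : R) 0).
Proof.
rewrite dedekind_eta_i -rmorphXn /= -expRD -expRM_natl; congr expR.
by move: (pi : R) => p; field.
Qed.

(** Together with [Re_eta_sqr] this says that the regularized Green function equals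
    [- 2 pi log(eta(i)^2)] at the origin; note [pi^2 / 3 = 2 pi (pi / 6)]. *)
Lemma green0_eta : green0 R = - (2 * pi) * (- (pi / 6) + green_tail (1 : R) 0).
Proof. by rewrite /green0; move: (pi : R) => p; field. Qed.
End eta.

(** * Dominated convergence of the energy densities *)

Section asymptotics.
Variable R : realType.
Notation mu2 := (@lebesgue2 R).
Notation quadrant := ((`]0%R, +oo[%classic : set R) `*` (`]0%R, +oo[%classic : set R)).
Notation eta_log := (- (pi / 6) + green_tail (1 : R) 0).

Let mQ : @measurable _ (measurableTypeR R * measurableTypeR R)%type quadrant.
Proof. exact: measurable_quadrant. Qed.

Let mH (h : R) : @measurable _ (measurableTypeR R * measurableTypeR R)%type (half_square h).
Proof. exact: measurable_half_square. Qed.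

Let half_sub (h : R) : half_square h `<=` quadrant.
Proof.
by move=> z; rewrite /half_square /= !in_itv/= !andbT => -[/andP[? _] /andP[? _]].
Qed.

Let quadrantP (z : R * R) : quadrant z -> 0 < z.1 /\ 0 < z.2.
Proof. by rewrite /= !in_itv/= !andbT. Qed.

(** Extended by 0, so that the integrals for all [N] live on one quadrant. *)
Definition gauss2_cut (N : R) : R * R -> R :=
  (fun z => gauss1_fold N z.1 * gauss1_fold N z.2) \_ (half_square (N / 2)).

(** In the near half of the period [|u - N| >= u], so the folded Gaussian value is the smaller of
    the two. *)
Lemma gauss1_fold_near (N u : R) : 0 < N -> 0 <= u <= N / 2 ->
  (1 - u / N) * gauss1 u <= gauss1_fold N u <= gauss1 u.
Proof.
move=> N0 /andP[u0 uN].
have uN1 : 0 <= u / N by rewrite divr_ge0// ltW.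
have uN2 : u / N <= 1 by rewrite ler_pdivrMr// mul1r; lra.
rewrite /gauss1_fold lerDl mulr_ge0//= ?gauss1_ge0//.
have gg : gauss1 (u - N) <= gauss1 u.
  rewrite /gauss1 ler_expR lerN2 ler_wpM2l ?pi_ge0//.
  have -> : (u - N) ^+ 2 = u ^+ 2 + N * (N - 2 * u) by ring.
  by rewrite lerDl mulr_ge0 ?(ltW N0)//; lra.
have : u / N * gauss1 (u - N) <= u / N * gauss1 u by rewrite ler_wpM2l.
by move: (gauss1 _) (gauss1 _) => a b; lra.
Qed.

(** Inside the half square the defect is governed by [1 - (1 - a) (1 - b) <= a + b]. Outside, one
    coordinate exceeds [N / 2], and the factor 2 brings the bound up to [gauss2 z]. *)
Lemma gauss2_cut_bounds (N : R) (z : R * R) : 0 < N -> quadrant z ->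
  [/\ 0 <= gauss2_cut N z, gauss2_cut N z <= gauss2 z &
    gauss2 z - gauss2_cut N z <= 2 * (z.1 + z.2) / N * gauss2 z].
Proof.
move=> N0 /quadrantP[x0 y0].
have gx := gauss1_ge0 z.1; have gy := gauss1_ge0 z.2.
have g0 : 0 <= gauss2 z by rewrite mulr_ge0.
rewrite /gauss2_cut patchE; case: ifPn => zh; last first.
  split => //; rewrite subr0 ler_peMl// ler_pdivlMr// mul1r.
  rewrite leNgt; apply: contra zh => zN; rewrite inE /half_square /= !in_itv/= x0 y0 /=.
  by split; lra.
move: zh; rewrite inE /half_square /= !in_itv/= => -[/andP[_ xN] /andP[_ yN]].
have /andP[x1 x2] := @gauss1_fold_near N z.1 N0 (introT andP (conj (ltW x0) xN)).
have /andP[y1 y2] := @gauss1_fold_near N z.2 N0 (introT andP (conj (ltW y0) yN)).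
have a0 : 0 <= z.1 / N by rewrite divr_ge0// ltW.
have b0 : 0 <= z.2 / N by rewrite divr_ge0// ltW.
have a1 : z.1 / N <= 1 by rewrite ler_pdivrMr// mul1r; lra.
have b1 : z.2 / N <= 1 by rewrite ler_pdivrMr// mul1r; lra.
have ag : 0 <= (1 - z.1 / N) * gauss1 z.1 by rewrite mulr_ge0// subr_ge0.
have bg : 0 <= (1 - z.2 / N) * gauss1 z.2 by rewrite mulr_ge0// subr_ge0.
have p0 := le_trans ag x1; have q0 := le_trans bg y1.
split; first exact: mulr_ge0; first exact: ler_pM.
have lo : (1 - z.1 / N) * gauss1 z.1 * ((1 - z.2 / N) * gauss1 z.2) <= gauss1_fold N z.1 * gauss1_fold N z.2.
  exact: ler_pM.
apply: (le_trans (lerB (lexx _) lo)).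
rewrite -subr_ge0.
have -> : 2 * (z.1 + z.2) / N * gauss2 z - (gauss2 z - (1 - z.1 / N) * gauss1 z.1 * ((1 - z.2 / N) * gauss1 z.2)) =
  (z.1 / N + z.2 / N + z.1 / N * (z.2 / N)) * gauss2 z.
  by rewrite /gauss2; ring.
by rewrite mulr_ge0// !addr_ge0// mulr_ge0.
Qed.

Definition scaled_green (N : R) (z : R * R) : R := green (2 * pi / N * z.1) (2 * pi / N * z.2).

(** The additive constant of W_N appears as 4 times itself because [gauss2] has integral [1/4]; the
    coefficient [2 / pi] is the 4 of [EN_green_gauss] divided by [2 pi]. *)
Definition energy_density (N : R) (z : R * R) : R :=
  4 * (- ln (2 * pi / N) - eta_log) * gauss2 z + - (2 / pi) * (scaled_green N z * gauss2_cut N z).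

Let scaled_green_cutE (N : R) : (fun z => scaled_green N z * gauss2_cut N z) =
  (fun z => scaled_green N z * (gauss1_fold N z.1 * gauss1_fold N z.2)) \_ (half_square (N / 2)).
Proof.
by apply/funext => z; rewrite /gauss2_cut !patchE; case: ifP => // _; rewrite mulr0.
Qed.

Let wh (N : R) : 0 < N -> 2 * pi / N * (N / 2) = pi.
Proof. by move=> N0; move: (pi : R) => p; field; rewrite gt_eqF. Qed.

Let integrable_scaled_half (N : R) : 0 < N ->
  mu2.-integrable (half_square (N / 2))
    (EFin \o (fun z => scaled_green N z * (gauss1_fold N z.1 * gauss1_fold N z.2))).
Proof.
move=> N0; have h0 : 0 < N / 2 by rewrite divr_gt0.
apply: (integrable_bounded_mul (C := 1) (mH _) (integrable_green_half h0 (wh N0))).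
  apply: measurable_funTS; apply: measurable_funM.
    by apply: (measurableT_comp (measurable_gauss1_fold N)).
  by apply: (measurableT_comp (measurable_gauss1_fold N)).
move=> z; rewrite /half_square /= !in_itv/= => -[/andP[x0 xN] /andP[y0 yN]].
have /andP[a0 a1] : 0 <= gauss1_fold N z.1 <= 1 by apply: gauss1_fold_itv => //; lra.
have /andP[b0 b1] : 0 <= gauss1_fold N z.2 <= 1 by apply: gauss1_fold_itv => //; lra.
by rewrite ger0_norm ?mulr_ge0// mulr_ile1.
Qed.

Let integrable_scaled_cut (N : R) : 0 < N ->
  mu2.-integrable quadrant (EFin \o (fun z => scaled_green N z * gauss2_cut N z)).
Proof.
move=> N0; rewrite scaled_green_cutE -restrict_EFin.
apply: (integrableS _ _ (subsetT _)); [exact: measurableT|exact: mQ|].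
apply: (integrable_mkcond _ (mH (N / 2))).1.
exact: integrable_scaled_half.
Qed.

Let integral_scaled_cut (N : R) :
  \int[mu2]_(z in quadrant) (scaled_green N z * gauss2_cut N z) =
  \int[mu2]_(z in half_square (N / 2)) (scaled_green N z * (gauss1_fold N z.1 * gauss1_fold N z.2)).
Proof.
rewrite scaled_green_cutE -Rintegral_mkcondr.
by congr (\int[mu2]_(z in _) _); apply: setIidr; exact: half_sub.
Qed.

Let integrable_gauss2 : mu2.-integrable quadrant (EFin \o (@gauss2 R)).
Proof.
have mg : measurable_fun setT (@gauss2 R).
  by apply: measurable_funM; [apply: (measurableT_comp (@measurable_gauss1 R))|apply: (measurableT_comp (@measurable_gauss1 R))].
apply: (le_integrable mQ _ _ (integrable_log_gauss2_majorant R)).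
  by apply/measurable_EFinP; exact: measurable_funTS.
move=> z _ /=; rewrite lee_fin.
have g0 : 0 <= gauss2 z by rewrite gauss2E expR_ge0.
have s0 : 0 <= z.1 ^+ 2 + z.2 ^+ 2 by rewrite addr_ge0// sqr_ge0.
have l0 := normr_ge0 (ln (z.1 ^+ 2 + z.2 ^+ 2)).
have m1 : 1 <= 1 + `|ln (z.1 ^+ 2 + z.2 ^+ 2)| + (z.1 ^+ 2 + z.2 ^+ 2).
  by rewrite -addrA lerDl; exact: addr_ge0.
by rewrite [leRHS]normrM ler_peMl// ger0_norm// (le_trans ler01 m1).
Qed.

Lemma integrable_energy_density (N : R) : 0 < N ->
  mu2.-integrable quadrant (EFin \o energy_density N).
Proof.
move=> N0; apply: (integrable_lin mQ); [exact: integrable_gauss2|exact: integrable_scaled_cut].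
Qed.

Lemma expectation_W_density d (T : measurableType d) (P : probability T R)
    (X : point_process R T) (hX : is_determinantal P X (@ginibre_kernel R))
    (N : R) (f : R * R -> R) : 0 < N -> is_EN N f ->
  'E_P[W X N f]%E = (\int[mu2]_(z in quadrant) energy_density N z)%:E.
Proof.
move=> N0 hf; rewrite (expectation_W hX N0 hf) (EN_green_gauss N0 hf); congr EFin.
have -> := Rintegral_lin mQ (4 * (- ln (2 * pi / N) - eta_log)) (- (2 / pi)) integrable_gauss2 (integrable_scaled_cut N0).
rewrite integral_gauss2 integral_scaled_cut /scaled_green.
rewrite Re_eta_sqr.
have p0 : 0 < pi :> R by exact: pi_gt0.
have -> : ln (N / (2 * pi * expR eta_log)) = - ln (2 * pi / N) - eta_log.
  rewrite (_ : N / _ = (2 * pi / N * expR eta_log)^-1); last first.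
    have E0 : 0 < expR eta_log by exact: expR_gt0.
    move: (expR _) E0 => e E0; move: (pi : R) p0 => p p0.
    by field; rewrite !gt_eqF.
  rewrite lnV ?posrE ?mulr_gt0 ?expR_gt0 ?invr_gt0// lnM ?posrE ?mulr_gt0 ?expR_gt0 ?invr_gt0//.
  by rewrite expRK opprD.
move: (ln _) (\int[mu2]_(z in half_square _) _) (green_tail _ _) p0 => l I g.
move: (pi : R) => p p0; field; exact: lt0r_neq0.
Qed.

Let period0 (n : nat) : 0 < 2 * pi / n.+1%:R :> R.
Proof. by rewrite !mulr_gt0 ?pi_gt0// invr_gt0. Qed.

Let radius0 (z : R * R) : quadrant z -> 0 < z.1 ^+ 2 + z.2 ^+ 2.
Proof. by move=> /quadrantP[x0 y0]; rewrite addr_gt0// exprn_gt0. Qed.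

Lemma ln_div_cvg0 : ln n.+1%:R / n.+1%:R @[n --> \oo] --> (0 : R).
Proof.
have L : 2 * Num.sqrt (n.+1%:R^-1) @[n --> \oo] --> (0 : R).
  rewrite -[X in _ --> X](mulr0 2); apply: cvgM; first exact: cvg_cst.
  rewrite -(sqrtr0 R); apply: continuous_cvg; first exact: sqrt_continuous.
  exact: cvg_harmonic.
apply: (squeeze_cvgr _ (cvg_cst (0 : R)) L); apply: nearW => n.
have n0 : 0 < n.+1%:R :> R by [].
rewrite divr_ge0 ?ln_ge0 ?ler1n//= ler_pdivrMr//.
pose r : R := Num.sqrt n.+1%:R.
have r0 : 0 < r by rewrite sqrtr_gt0.
have r2 : n.+1%:R = r ^+ 2 by rewrite sqr_sqrtr// ltW.
rewrite sqrtrV ?(ltW n0)// -/r r2 lnXn//.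
have -> : 2 * r^-1 * r ^+ 2 = r *+ 2 by field; rewrite gt_eqF.
by rewrite lerMn2r /=; apply: ltW; exact: ln_sublinear.
Qed.

Lemma ln_period_cvg0 : ln (2 * pi / n.+1%:R) / n.+1%:R @[n --> \oo] --> (0 : R).
Proof.
have -> : (fun n => ln (2 * pi / n.+1%:R) / n.+1%:R) =
    (fun n : nat => ln (2 * pi) * n.+1%:R^-1 - ln n.+1%:R / n.+1%:R :> R).
  apply/funext => n; rewrite lnM ?posrE ?mulr_gt0 ?pi_gt0 ?invr_gt0// lnV ?posrE//.
  by rewrite mulrDl mulNr.
rewrite -[X in _ --> X](subr0 0); apply: cvgB; last exact: ln_div_cvg0.
rewrite -[X in _ --> X](mulr0 (ln (2 * pi))); apply: cvgM; first exact: cvg_cst.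
exact: cvg_harmonic.
Qed.

(** The Green function freed of its logarithm: bounded uniformly in [n] on the half square by
    [green_bounded], and convergent to [green0] at each point of the quadrant by [green_cvg0]. *)
Definition regular_green (n : nat) (z : R * R) : R :=
  scaled_green n.+1%:R z + pi * ln ((2 * pi / n.+1%:R * z.1) ^+ 2 + (2 * pi / n.+1%:R * z.2) ^+ 2).

(** Once the singularity is extracted, the divergent [ln (2 pi / N)] multiplies only the defect
    [gauss2 - gauss2_cut], which is of order [1 / N]. *)
Lemma energy_densityE (n : nat) (z : R * R) : quadrant z ->
  energy_density n.+1%:R z =
  - 4 * (ln (2 * pi / n.+1%:R) * (gauss2 z - gauss2_cut n.+1%:R z)) - 4 * eta_log * gauss2 z
  - 2 / pi * (regular_green n z * gauss2_cut n.+1%:R z)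
  + 2 * ln (z.1 ^+ 2 + z.2 ^+ 2) * gauss2_cut n.+1%:R z.
Proof.
move=> /radius0 s0; rewrite /regular_green /energy_density.
have w0 := period0 n.
have -> : (2 * pi / n.+1%:R * z.1) ^+ 2 + (2 * pi / n.+1%:R * z.2) ^+ 2 =
  (2 * pi / n.+1%:R) ^+ 2 * (z.1 ^+ 2 + z.2 ^+ 2) by ring.
have -> : ln ((2 * pi / n.+1%:R) ^+ 2 * (z.1 ^+ 2 + z.2 ^+ 2)) =
    2 * ln (2 * pi / n.+1%:R) + ln (z.1 ^+ 2 + z.2 ^+ 2).
  move: (2 * pi / _) w0 (_ + _) s0 => w w0 s s0.
  have w20 : 0 < w ^+ 2 by rewrite exprn_gt0.
  by rewrite lnM ?posrE// lnXn// mulr_natl.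
have p0 : pi != 0 :> R by rewrite gt_eqF ?pi_gt0.
move: (ln _) (ln _) (green_tail _ _) (scaled_green _ _) (gauss2 z) (gauss2_cut _ _).
by move: (pi : R) p0 => p p0 a b c u v x; field.
Qed.

Let cut_defect_le (n : nat) (z : R * R) : quadrant z ->
  `|ln (2 * pi / n.+1%:R) * (gauss2 z - gauss2_cut n.+1%:R z)| <=
  `|ln (2 * pi / n.+1%:R) / n.+1%:R| * (2 * (z.1 + z.2) * gauss2 z).
Proof.
move=> Dz; have n0 : 0 < n.+1%:R :> R by [].
have [c0 c1 c2] := gauss2_cut_bounds n0 Dz.
rewrite normrM [`|_ / _|]normrM normfV (ger0_norm (ltW n0)) [`|gauss2 z - _|]ger0_norm ?subr_ge0//.
apply: (le_trans (ler_wpM2l (normr_ge0 _) c2)).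
by rewrite -subr_ge0 (_ : _ - _ = 0)//; move: `|_| => l; field; rewrite gt_eqF.
Qed.

Lemma gauss2_cut_cvg (z : R * R) : quadrant z ->
  gauss2_cut n.+1%:R z @[n --> \oo] --> gauss2 z.
Proof.
move=> Dz.
have L : gauss2 z - 2 * (z.1 + z.2) * gauss2 z * n.+1%:R^-1 @[n --> \oo] --> gauss2 z.
  rewrite -[X in _ --> X](subr0 (gauss2 z)); apply: cvgB; first exact: cvg_cst.
  rewrite -[X in _ --> X](mulr0 (2 * (z.1 + z.2) * gauss2 z)).
  by apply: cvgM; [exact: cvg_cst|exact: cvg_harmonic].
apply: (squeeze_cvgr _ L (cvg_cst (gauss2 z))); apply: nearW => n.
have n0 : 0 < n.+1%:R :> R by [].
have [c0 -> c2] := gauss2_cut_bounds n0 Dz; rewrite andbT.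
by rewrite lerBlDr addrC -lerBlDr mulrAC.
Qed.

Lemma energy_density_cvg (z : R * R) : quadrant z ->
  energy_density n.+1%:R z @[n --> \oo] --> 2 * ln (z.1 ^+ 2 + z.2 ^+ 2) * gauss2 z.
Proof.
move=> Dz; have [x0 y0] := quadrantP Dz.
have cc := gauss2_cut_cvg Dz.
have L1 : ln (2 * pi / n.+1%:R) * (gauss2 z - gauss2_cut n.+1%:R z) @[n --> \oo] --> (0 : R).
  have B : `|ln (2 * pi / n.+1%:R) / n.+1%:R| * (2 * (z.1 + z.2) * gauss2 z) @[n --> \oo] --> (0 : R).
    have A : `|ln (2 * pi / n.+1%:R) / n.+1%:R| @[n --> \oo] --> (0 : R).
      by rewrite -(normr0 R); exact: (cvg_norm ln_period_cvg0).
    rewrite -[X in _ --> X](mul0r (2 * (z.1 + z.2) * gauss2 z)).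
    by apply: cvgM; [exact: A|exact: cvg_cst].
  apply/norm_cvg0P.
  apply: (squeeze_cvgr _ (cvg_cst (0 : R)) B); apply: nearW => n.
  by rewrite normr_ge0 cut_defect_le.
have W : 2 * pi / n.+1%:R @[n --> \oo] --> (0 : R).
  rewrite -[X in _ --> X](mulr0 (2 * pi)); apply: cvgM; first exact: cvg_cst.
  exact: cvg_harmonic.
have Wz (x : R) : 2 * pi / n.+1%:R * x @[n --> \oo] --> (0 : R).
  by rewrite -[X in _ --> X](mul0r x); apply: cvgM; [exact: W|exact: cvg_cst].
have L2 : regular_green n z @[n --> \oo] --> green0 R.
  by apply: (green_cvg0 (Wz z.1) (Wz z.2)) => n; rewrite mulr_gt0.
(* By [green0_eta], the two constants [- 4 eta_log] and [- (2 / pi) green0] cancel. *)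
have -> : 2 * ln (z.1 ^+ 2 + z.2 ^+ 2) * gauss2 z =
   - 4 * 0 - 4 * eta_log * gauss2 z - 2 / pi * (green0 R * gauss2 z) + 2 * ln (z.1 ^+ 2 + z.2 ^+ 2) * gauss2 z.
  have p0 : pi != 0 :> R by rewrite gt_eqF ?pi_gt0.
  rewrite green0_eta; move: (ln _) (gauss2 z) (green_tail _ _).
  by move: (pi : R) p0 => p p0 a b c; field.
have -> : (fun n => energy_density n.+1%:R z) = (fun n =>
    - 4 * (ln (2 * pi / n.+1%:R) * (gauss2 z - gauss2_cut n.+1%:R z)) - 4 * eta_log * gauss2 z
    - 2 / pi * (regular_green n z * gauss2_cut n.+1%:R z)
    + 2 * ln (z.1 ^+ 2 + z.2 ^+ 2) * gauss2_cut n.+1%:R z).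
  by apply/funext => n; exact: energy_densityE.
apply: cvgD; last by apply: cvgM; [exact: cvg_cst|exact: cc].
apply: cvgB; last by apply: cvgM; [exact: cvg_cst|apply: cvgM; [exact: L2|exact: cc]].
by apply: cvgB; [apply: cvgM; [exact: cvg_cst|exact: L1]|exact: cvg_cst].
Qed.

Lemma energy_density_bounded : exists M : R, forall n z, quadrant z ->
  `|energy_density n.+1%:R z| <=
  M * ((1 + `|ln (z.1 ^+ 2 + z.2 ^+ 2)| + (z.1 ^+ 2 + z.2 ^+ 2)) * gauss2 z).
Proof.
have [C C0 HC] := green_bounded R.
pose K : R := `|ln (2 * pi)| + 1.
have lnK (n : nat) : `|ln (2 * pi / n.+1%:R) / n.+1%:R| <= K.
  have n0 : 0 < n.+1%:R :> R by [].
  have n1 : 1 <= n.+1%:R :> R by rewrite ler1n.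
  rewrite normrM normfV (ger0_norm (ltW n0)) ler_pdivrMr//.
  rewrite lnM ?posrE ?mulr_gt0 ?pi_gt0 ?invr_gt0// lnV ?posrE//.
  apply: (le_trans (ler_normB _ _)); rewrite /K [leRHS]mulrDl mul1r lerD//.
    by rewrite ler_peMr.
  by rewrite ger0_norm ?ln_ge0// ltW// ln_sublinear.
(* One summand for each term of [energy_densityE]; the 8 combines its factor 4 with the 2 of
   [gauss2_cut_bounds]. *)
pose M : R := 8 * K + 4 * `|eta_log| + 2 / pi * C + 2.
exists M => n z Dz; have [x0 y0] := quadrantP Dz.
have n0 : 0 < n.+1%:R :> R by [].
have [c0 c1 _] := gauss2_cut_bounds n0 Dz.
have g0 : 0 <= gauss2 z by rewrite gauss2E expR_ge0.
have p0 : 0 <= 2 / pi :> R by rewrite divr_ge0// pi_ge0.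
rewrite (energy_densityE _ Dz).
have H1 : `|- 4 * (ln (2 * pi / n.+1%:R) * (gauss2 z - gauss2_cut n.+1%:R z))| <= 8 * K * (z.1 + z.2) * gauss2 z.
  rewrite normrM normrN normr_nat.
  have D0 : 0 <= 2 * (z.1 + z.2) * gauss2 z.
    by apply: mulr_ge0 => //; apply: mulr_ge0 => //; apply: addr_ge0; exact: ltW.
  have := le_trans (cut_defect_le n Dz) (ler_wpM2r D0 (lnK n)).
  by move: `|_| => u hu; lra.
have H2 : `|4 * eta_log * gauss2 z| <= 4 * `|eta_log| * gauss2 z.
  by rewrite normrM [`|4 * _|]normrM normr_nat (ger0_norm g0).
have H3 : `|2 / pi * (regular_green n z * gauss2_cut n.+1%:R z)| <= 2 / pi * C * gauss2 z.
  rewrite normrM (ger0_norm p0) -mulrA ler_wpM2l// normrM (ger0_norm c0).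
  (* [green_bounded] is available only on the half square, beyond which the truncated factor is
     0. *)
  have [zh|zh] := boolP (z \in half_square (n.+1%:R / 2)); last first.
    by rewrite /gauss2_cut patchE (negbTE zh) mulr0 mulr_ge0.
  apply: ler_pM => //.
  have h0 : 0 < n.+1%:R / 2 :> R by rewrite divr_gt0.
  have [a b] := half_square_itv h0 (wh n0) (set_mem zh).
  apply: HC => //.
  by case/andP: b => /ltW -> ->.
have H4 : `|2 * ln (z.1 ^+ 2 + z.2 ^+ 2) * gauss2_cut n.+1%:R z| <= 2 * `|ln (z.1 ^+ 2 + z.2 ^+ 2)| * gauss2 z.
  by rewrite normrM [`|2 * _|]normrM normr_nat (ger0_norm c0) ler_wpM2l// mulr_ge0.
apply: (le_trans (ler_normD _ _)); apply: (le_trans (lerD (ler_normB _ _) H4)).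
apply: (le_trans (lerD (lerD (ler_normB _ _) H3) (lexx _))).
apply: (le_trans (lerD (lerD (lerD H1 H2) (lexx _)) (lexx _))).
rewrite [leRHS]mulrA -!mulrDl ler_wpM2r//.
have l0 := normr_ge0 (ln (z.1 ^+ 2 + z.2 ^+ 2)).
have e0 := normr_ge0 eta_log.
have K0 : 0 <= K by rewrite addr_ge0.
have q0 : 0 <= 2 / pi * C by rewrite mulr_ge0.
have xy : z.1 + z.2 <= 1 + (z.1 ^+ 2 + z.2 ^+ 2).
  have u0 := sqr_ge0 (z.1 - 2^-1); have v0 := sqr_ge0 (z.2 - 2^-1).
  have : 0 <= (z.1 - 2^-1) ^+ 2 + (z.2 - 2^-1) ^+ 2 by apply: addr_ge0.
  by move: (z.1) (z.2) => x y; rewrite !sqrrB !expr2; lra.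
rewrite /M; move: (z.1 ^+ 2 + z.2 ^+ 2) (radius0 Dz) l0 xy => s s0.
move: (z.1 + z.2) `|ln s| `|eta_log| e0 (2 / pi * C) q0 => xy l e e0 q q0 l0 hxy.
have T1 : K * xy <= K * (1 + s) by rewrite ler_wpM2l.
have T2 : 0 <= K * l by rewrite mulr_ge0.
have T3 : 0 <= e * (l + s) by rewrite mulr_ge0// addr_ge0// ltW.
have T4 : 0 <= q * (l + s) by rewrite mulr_ge0// addr_ge0// ltW.
have -> : (8 * K + 4 * e + q + 2) * (1 + l + s) =
  8 * (K * (1 + s)) + 8 * (K * l) + 4 * e + 4 * (e * (l + s)) + q + q * (l + s) + 2 * (1 + l + s) by ring.
have -> : 8 * K * xy = 8 * (K * xy) by ring.
lra.
Qed.

Lemma integral_energy_density_cvg :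
  \int[mu2]_(z in quadrant) energy_density n.+1%:R z @[n --> \oo] -->
  - (1 / 2) * (euler_gamma R + ln pi).
Proof.
have [M HM] := energy_density_bounded.
have [||] := @dominated_Rintegral R _ (measurableTypeR R * measurableTypeR R)%type _ quadrant
  (fun n z => energy_density n.+1%:R z)
  (fun z => 2 * ln (z.1 ^+ 2 + z.2 ^+ 2) * gauss2 z)
  (fun z => M * ((1 + `|ln (z.1 ^+ 2 + z.2 ^+ 2)| + (z.1 ^+ 2 + z.2 ^+ 2)) * gauss2 z))
  mQ _ _ (integrableZl mQ M (integrable_log_gauss2_majorant R)) (fun n z Dz => HM n z Dz).
- move=> n; apply/measurable_EFinP; apply: measurable_int.
  by apply: integrable_energy_density.
- move=> z Dz; exact: energy_density_cvg.
move=> I L; rewrite -integral_log_gauss2.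
suff <- : \int[mu2]_(z in quadrant) (2 * ln (z.1 ^+ 2 + z.2 ^+ 2) * gauss2 z) =
  2 * \int[mu2]_(z in quadrant) (ln (z.1 ^+ 2 + z.2 ^+ 2) * gauss2 z) by exact: L.
have -> : \int[mu2]_(z in quadrant) (ln (z.1 ^+ 2 + z.2 ^+ 2) * gauss2 z) =
  \int[mu2]_(z in quadrant) (2^-1 * (2 * ln (z.1 ^+ 2 + z.2 ^+ 2) * gauss2 z)).
  by apply: eq_Rintegral => z _; rewrite !mulrA mulVf// mul1r.
by rewrite (RintegralZl 2^-1 mQ I) mulrA divff// mul1r.
Qed.
End asymptotics.

Theorem proposition3p3 (R : realType) (d : measure_display)
    (T : measurableType d) (P : probability T R) (X : point_process R T)
    (hX : is_determinantal P X (@ginibre_kernel R))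
    (E : nat -> R * R -> R)
    (hE : forall N : nat, (1 <= N)%N -> is_EN (N%:R : R) (E N)) :
  'E_P[W X N%:R (E N)]%E @[N --> \oo]
    --> (- (1 / 2) * (euler_gamma R + ln pi))%:E.
Proof.
(* E_N is given for [N >= 1]; the shift discards the term at 0, which does not affect the limit. *)
rewrite -(cvg_shiftS (fun N : nat => 'E_P[W X N%:R (E N)]%E)).
have -> : (fun n : nat => 'E_P[W X n.+1%:R (E n.+1)]%E) = EFin \o (fun n : nat =>
    \int[@lebesgue2 R]_(z in (`]0, +oo[%classic : set R) `*` (`]0, +oo[%classic : set R))
      energy_density n.+1%:R z).
  apply/funext => n /=.
  exact: (expectation_W_density hX (ltr0Sn R n) (hE n.+1 (ltn0Sn n))).
apply: cvg_EFin; first exact: nearW.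
exact: integral_energy_density_cvg.
Qed.
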